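(* Let $p>0$ and let $\alpha>1$ and $\beta>0$ satisfy \[ \beta\ln(\alpha)\leq\frac{4\pi}{1+4p}. \] Furthermore, let \[ \phi_i=\lambda_{i,1}P_p+\lambda_{i,2}\mathscr{H}P_p,\quad i=1,2,3, \] for a collection of full spark vectors $\{\lambda_i=(\lambda_{i,1},\lambda_{i,2})\}_{i=1}^{3}$ in $\mathbb{R}^2$. Then every $f\in L^2(\mathbb{R},\mathbb{R})$ is uniquely determined, up to a global sign, by the magnitudes of the multi-wavelet frame coefficients \[ \{\lvert \mathcal{W}_{\phi_i} f(b,a) \rvert: i\in\{1,2,3\},\ (b,a)\in\Lambda(\beta,\alpha)\}; \] that is, if $f,g\in L^2(\mathbb{R},\mathbb{R})$ satisfy $\lvert \mathcal{W}_{\phi_i} f(b,a) \rvert=\lvert \mathcal{W}_{\phi_i} g(b,a) \rvert$ for all $i\in\{1,2,3\}$ and all $(b,a)\in\Lambda(\beta,\alpha)$, then $f=g$ or $f=-g$. Equivalently, the multi-wavelet frame \[ \{T_bD_a\phi_1\}_{(b,a)\in\Lambda(\beta,\alpha)}\cup \{T_bD_a\phi_2\}_{(b,a)\in\Lambda(\beta,\alpha)}\cup \{T_bD_a\phi_3\}_{(b,a)\in\Lambda(\beta,\alpha)} \] does sign retrieval in $L^2(\mathbb{R},\mathbb{R})$.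
   Context: $\mathbb{R}_+=(0,+\infty)$, and $L^2(\mathbb{R},\mathbb{R})$ is the real Hilbert space of real-valued square-integrable functions on $\mathbb{R}$ (Lebesgue measure). The Fourier transform is $\widehat f(\xi)=\int_{\mathbb{R}} f(x)e^{-2\pi i x\xi}\,dx$ on $L^1(\mathbb{R})$, extended to $L^2(\mathbb{R})$ by density. For $\phi,f\in L^2(\mathbb{R})$ the wavelet transform is \[ \mathcal{W}_{\phi}f(b,a)=a^{-1/2}\int_{\mathbb{R}} f(x)\,\overline{\phi\left(\frac{x-b}{a}\right)}\,dx=\langle f,T_bD_a\phi\rangle,\qquad b\in\mathbb{R},\ a\in\mathbb{R}_+, \] where $T_bf(x)=f(x-b)$ and $D_af(x)=a^{-1/2}f(a^{-1}x)$. For $p>0$ the Poisson wavelet of order $p$ is the real-valued function $P_p\in L^2(\mathbb{R})$ with $\widehat{P}_p(\xi)=(2\pi)^{p+1/2}|\xi|^pe^{-2\pi|\xi|}$, $\xi\in\mathbb{R}$. The Hilbert transform $\mathscr{H}$ is the unitary operator on $L^2(\mathbb{R})$ given by $\widehat{\mathscr{H}\varphi}(\xi)=-i\,\mathrm{sgn}(\xi)\widehat\varphi(\xi)$ for a.e. $\xi\in\mathbb{R}$; it maps real-valued functions to real-valued functions. For $\alpha>1$, $\beta>0$, the hyperbolic lattice is $\Lambda(\beta,\alpha)=\{(\alpha^m\beta n,\alpha^m)\}_{m,n\in\mathbb{Z}}\subseteq\mathbb{R}\times\mathbb{R}_+$. A collection of vectors in $\mathbb{R}^M$ (with at least $M$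 members) is full spark if every subcollection of $M$ of its vectors spans $\mathbb{R}^M$; here $M=2$, so any two of $\lambda_1,\lambda_2,\lambda_3$ span $\mathbb{R}^2$. A countable family $\{f_i\}_{i\in I}$ in a separable Hilbert space $\mathcal{H}$ is a frame if there are $A,B>0$ with $A\|f\|^2\le\sum_{i\in I}|\langle f,f_i\rangle|^2\le B\|f\|^2$ for all $f\in\mathcal{H}$. A frame $\{\varphi_i\}_{i\in I}$ of $L^2(\mathbb{R},\mathbb{R})$ does sign retrieval if the map $[f]\mapsto(|\langle f,\varphi_i\rangle|)_{i\in I}$ is injective on $L^2(\mathbb{R},\mathbb{R})/\!\sim$, where $f\sim g$ if and only if $f=\pm g$. Unions of families are understood as families indexed by the disjoint union of index sets. *)

(* Defs.v *)
From HB Require Import structures.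
From mathcomp Require Import all_boot all_order all_algebra complex.
From mathcomp Require Import all_classical all_reals all_analysis.

Set Implicit Arguments.
Unset Strict Implicit.
Unset Printing Implicit Defensive.

Import Order.TTheory GRing.Theory Num.Theory.
Import numFieldNormedType.Exports.

Local Open Scope classical_set_scope.
Local Open Scope ring_scope.
Local Open Scope complex_scope.

(* Elements of L^1 and L^2 are represented by Borel functions of finite norm;
   equality of classes is equality almost everywhere. *)

Section fourier.
Context {R : realType}.
Local Notation mu := (@lebesgue_measure R).
Implicit Types (f g h : R -> R[i]) (xi t : R).

Definition cLfun (p : \bar R) f : Prop :=
  (fun x => complex.Re (f x)) \in Lfun mu p /\
  (fun x => complex.Im (f x)) \in Lfun mu p.

Definition cdist2 f g : \bar R :=
  'N[mu]_2%:E [(fun x => (ComplexField.Normc.normc (f x - g x))%:E)]%E.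

Definition cintegral f : R[i] :=
  (\int[mu]_x complex.Re (f x)) +i* (\int[mu]_x complex.Im (f x)).

Definition expi t : R[i] := cos t +i* sin t.

Definition fourier1 f xi : R[i] :=
  cintegral (fun x => f x * expi (- (2 * pi * x * xi))).

(* Graph of the extension of the Fourier transform to L^2 by density:
   h is the L^2 limit of the transforms of a sequence in L^1 /\ L^2 which
   tends to f in L^2; by Plancherel, h is unique up to a null set. *)
Definition is_fourier2 f h : Prop :=
  [/\ cLfun 2%:E f, cLfun 2%:E h &
      exists u : nat -> R -> R[i],
        [/\ forall n, cLfun 1 (u n) /\ cLfun 2%:E (u n),
            cdist2 (u n) f @[n --> \oo] --> 0%E &
            cdist2 (fourier1 (u n)) h @[n --> \oo] --> 0%E]].

End fourier.

Section wavelet.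
Context {R : realType}.
Local Notation mu := (@lebesgue_measure R).
Implicit Types (f g phi psi : R -> R) (a b p alpha beta : R).

Definition realL2 f : Prop := f \in Lfun mu 2%:E.

Definition is_poisson_wavelet p phi : Prop :=
  realL2 phi /\
  is_fourier2 (fun x => (phi x)%:C)
    (fun xi => ((2 * pi) `^ (p + 2^-1) * `|xi| `^ p
                  * expR (- (2 * pi * `|xi|)))%:C).

Definition is_hilbert_transform phi psi : Prop :=
  [/\ realL2 phi, realL2 psi &
      exists h : R -> R[i],
        is_fourier2 (fun x => (phi x)%:C) h /\
        is_fourier2 (fun x => (psi x)%:C)
          (fun xi => (0 -i* Num.sg xi) * h xi)].

Definition translation b f : R -> R := fun x => f (x - b).

Definition dilation a f : R -> R := fun x => a `^ (- 2^-1) * f (a^-1 * x).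

Definition inner2 f g : R := \int[mu]_x (f x * g x).

(* The functions are real-valued, so that the conjugation is omitted. *)
Definition wavelet_transform phi f b a : R :=
  a `^ (- 2^-1) * \int[mu]_x (f x * phi ((x - b) / a)).

Definition hyperbolic_lattice beta alpha : set (R * R) :=
  [set z | exists m n : int, z = (alpha ^ m * beta * n%:~R, alpha ^ m)].

(* The families are indexed by a set D of indices. *)
Definition is_frame (I : choiceType) (D : set I) (F : I -> R -> R) : Prop :=
  [/\ countable D,
      forall i, D i -> realL2 (F i) &
      exists A B : R, [/\ 0 < A, 0 < B &
        forall f, realL2 f ->
          (A%:E * 'N[mu]_2%:E [EFin \o f] ^+ 2
             <= \esum_(i in D) (`|inner2 f (F i)| ^+ 2)%:E)%E /\
          (\esum_(i in D) (`|inner2 f (F i)| ^+ 2)%:E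
             <= B%:E * 'N[mu]_2%:E [EFin \o f] ^+ 2)%E]].

Definition eq_up_to_sign f g : Prop :=
  f = g %[ae mu] \/ f = (fun x => - g x) %[ae mu].

Definition does_sign_retrieval (I : choiceType) (D : set I)
    (F : I -> R -> R) : Prop :=
  is_frame D F /\
  forall f g, realL2 f -> realL2 g ->
    (forall i, D i -> `|inner2 f (F i)| = `|inner2 g (F i)|) ->
    eq_up_to_sign f g.

End wavelet.

Definition full_spark (K : fieldType) (M N : nat) (v : 'I_N -> 'rV[K]_M) :
    Prop :=
  (M <= N)%N /\
  forall s : 'I_M -> 'I_N, injective s -> row_full (\matrix_(k < M) v (s k)).

(* Main.v *)
Require Import Defs.
From HB Require Import structures.
From mathcomp Require Import all_boot all_order all_algebra complex.
From mathcomp Require Import all_classical all_reals all_analysis.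
From mathcomp Require Import measurable_realfun ring lra zify.

(** Let f be a real function of L^2.  Up to the positive factor c a^(p + 1/2),
    its wavelet transforms with respect to P and to the Hilbert transform of P
    are the real and the imaginary part of
      F (b, a) = \int_0^oo t^p C (t) exp (- 2 i pi t b - 2 pi t a) dt,
    where C = A + i B is built from the Fourier transform of f on the positive
    half-line and |C|^2 has integral 2 |f|^2 (spectrum).  Thus F is an analytic
    function of b - i a on the upper half-plane, and t^p C is its spectrum; the
    coefficients of the family lambda are linear forms in the two coordinates
    of F.

    Sign retrieval.  Let F_- and F_+ belong to f - g and f + g.  At a lattice
    point, equality of the magnitudes says that each of the three linear forms
    vanishes on F_- or on F_+; one of the two is hit twice, and full spark makes
    it vanish (spark_dichotomy).  Hence the product F_- F_+ vanishes on the
    lattice.  A uniqueness theorem shows that it vanishes on the line of height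
    1 (product_vanish).  Both factors are analytic, so that one of them vanishes
    on that line (one_factor_vanishes), and by Plancherel f = g or f = - g
    (U_inj).

    The uniqueness theorem.  The points of height Y = alpha^-i of the lattice
    form a row of spacing beta Y.  By Parseval's identity, sampling on a row is
    periodizing the spectrum with period tau = 1 / (beta Y), and division
    of the spectrum by a shift by tau minus a constant splits off a periodic
    Blaschke factor which vanishes on the row (row_step).  So, up to the energy
    of the samples, a row at height Y shrinks the norm between the line of
    height h and the line of height 1 by the bound of its Blaschke factor.
    With h = alpha^-j the rows of heights 1, alpha^-1, .., alpha^-(j-1) gain
    together exp (- 4 pi j / beta) on the squared norm (rows_decay).  On the other side,
    the spectrum of F_- F_+ is the convolution of those of F_- and F_+, and
    Young's inequality bounds its squared norm on the line of height
    alpha^-j by o (alpha^(j (1 + 4 p))).  If beta ln alpha (1 + 4 p) <= 4 pi,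
    then the gain wins and a product which vanishes on the rows is zero.

    The frame property.  For one function, the squared norm on the line of
    height alpha^k with the weight alpha^(2 p k) is summable over k, with a sum
    comparable to |f|^2 (sum_energy).  The same estimate on rows bounds each of
    these terms by the samples on j rows and by half of the term of index k - j,
    as soon as beta ln alpha < 2 pi / p, which the hypothesis entails; summing over
    k gives the lower bound, and Bessel's inequality on each row gives the upper
    one (spectral_frame).

    The Fourier analysis is done with real integrals: FC and FS are the cosine
    and the sine transform, so that the Fourier transform of f is FC f - i FS f.
    Completeness of the trigonometric system comes from the Fejer kernels,
    Parseval's identity on the circle from it, and Plancherel's identity by
    integrating Parseval's identity over the translates of the integers. *)

Set Implicit Arguments.
Unset Strict Implicit.
Unset Printing Implicit Defensive.

Import Order.TTheory GRing.Theory Num.Theory.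
Import numFieldNormedType.Exports.

Local Open Scope classical_set_scope.
Local Open Scope ring_scope.

(** * Real integrals and the square norm *)

Section real_integral.
Context {R : realType}.
Local Notation mu := (@lebesgue_measure R).
Implicit Types f g h : R -> R.

Definition intble f := mu.-integrable setT (EFin \o f).

Lemma intble_meas f : intble f -> measurable_fun setT f.
Proof. by case/integrableP => /measurable_EFinP. Qed.

Lemma intble_le f g : measurable_fun setT f -> (forall x, `|f x| <= `|g x|) ->
  intble g -> intble f.
Proof.
move=> mf fg; apply: le_integrable => //; first exact/measurable_EFinP.
by move=> x _; rewrite lee_fin.
Qed.

Lemma intbleD f g : intble f -> intble g -> intble (fun x => f x + g x).
Proof. by move=> fi gi; exact: (integrableD measurableT fi gi). Qed.

Lemma intbleZ k f : intble f -> intble (fun x => k * f x).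
Proof.
by move=> fi; exact: (integrableZl measurableT k fi).
Qed.

Lemma intbleB f g : intble f -> intble g -> intble (fun x => f x - g x).
Proof. by move=> fi gi; exact: (integrableB measurableT fi gi). Qed.

Lemma intbleN f : intble f -> intble (fun x => - f x).
Proof. by move=> fi; exact: (integrableN fi). Qed.

Lemma intble0 : intble (fun=> 0).
Proof. exact: integrable0. Qed.

Lemma intble_abs f : intble f -> intble (fun x => `|f x|).
Proof. by move=> fi; exact: (integrable_norm fi). Qed.

Lemma intbleP f : intble f <->
  measurable_fun setT f /\ (\int[mu]_x (`|f x|)%:E < +oo)%E.
Proof.
split => [/integrableP[/measurable_EFinP mf h]|[mf h]]; first by split.
by apply/integrableP; split => //; exact/measurable_EFinP.
Qed.

Lemma ge0_intbleP f : (forall x, 0 <= f x) -> intble f <->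
  measurable_fun setT f /\ (\int[mu]_x (f x)%:E < +oo)%E.
Proof.
move=> f0; rewrite intbleP.
by under eq_integral do rewrite ger0_norm//.
Qed.

Lemma intble_bounded f g (M : R) : measurable_fun setT f -> (forall x, `|f x| <= M) ->
  intble g -> intble (fun x => f x * g x).
Proof.
move=> mf fM gi; apply: (@intble_le _ (fun x => M * g x)) (intbleZ _ gi).
  exact: measurable_funM mf (intble_meas gi).
move=> x; rewrite !normrM ler_wpM2r//.
by rewrite (le_trans (fM x))// ler_norm.
Qed.

Lemma EFin_I f : intble f -> (\int[mu]_x f x)%:E = (\int[mu]_x (f x)%:E)%E.
Proof. by move=> fi; rewrite fineK//; exact: integrable_fin_num. Qed.

Lemma ID f g : intble f -> intble g ->
  \int[mu]_x (f x + g x) = \int[mu]_x f x + \int[mu]_x g x.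
Proof. by move=> fi gi; rewrite RintegralD. Qed.

Lemma IB f g : intble f -> intble g ->
  \int[mu]_x (f x - g x) = \int[mu]_x f x - \int[mu]_x g x.
Proof. by move=> fi gi; rewrite RintegralB. Qed.

Lemma IZ k f : intble f -> \int[mu]_x (k * f x) = k * \int[mu]_x f x.
Proof. by move=> fi; rewrite RintegralZl. Qed.

Lemma IN f : intble f -> \int[mu]_x (- f x) = - \int[mu]_x f x.
Proof.
move=> fi; rewrite -mulN1r -IZ//; apply: eq_Rintegral => x _; by rewrite mulN1r.
Qed.

Lemma I_ge0 f : (forall x, 0 <= f x) -> 0 <= \int[mu]_x f x.
Proof. by move=> f0; apply: Rintegral_ge0. Qed.

Lemma le_I f g : intble f -> intble g -> (forall x, f x <= g x) ->
  \int[mu]_x f x <= \int[mu]_x g x.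
Proof. by move=> fi gi fg; apply: le_Rintegral. Qed.

Lemma abs_I f : intble f -> `|\int[mu]_x f x| <= \int[mu]_x `|f x|.
Proof. by move=> fi; exact: le_normr_Rintegral. Qed.

Lemma intble_sum (T : Type) (s : seq T) (F : T -> R -> R) :
  (forall i, intble (F i)) -> intble (fun x => \sum_(i <- s) F i x).
Proof.
move=> Fi; elim: s => [|i s ih].
  by under eq_fun do rewrite big_nil; exact: intble0.
by under eq_fun do rewrite big_cons; exact: intbleD.
Qed.

Lemma I_sum (T : Type) (s : seq T) (F : T -> R -> R) :
  (forall i, intble (F i)) ->
  \int[mu]_x (\sum_(i <- s) F i x) = \sum_(i <- s) \int[mu]_x F i x.
Proof.
move=> Fi; elim: s => [|i s ih].
  rewrite big_nil; under eq_Rintegral do rewrite big_nil.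
  by rewrite /Rintegral integral0.
rewrite big_cons -ih -ID//; last exact: intble_sum.
by apply: eq_Rintegral => x _; rewrite big_cons.
Qed.

(** The Lebesgue measure is determined by its values on half-open
    intervals, so that an affine change of variables has to be checked only
    there. *)
Lemma lebesgue_measure_affine (a b : R) (A : set R) : 0 < a -> measurable A ->
  mu A = (a%:E * mu ((fun x : R => a * x + b)%R @^-1` A))%E.
Proof.
move=> a0 mA.
have mphi : measurable_fun setT ((fun x : R => a * x + b) : measurableTypeR R -> measurableTypeR R).
  apply: continuous_measurable_fun => x.
  by apply: cvgD; [apply: cvgM => //; exact: cvg_cst|exact: cvg_cst].
pose phi : measurableTypeR R -> measurableTypeR R := fun x : R => a * x + b.
have a0' : 0 <= a by exact: ltW.
pose nu := mscale (NngNum a0') (pushforward mu phi).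
rewrite (_ : (_ * _)%E = nu mphi A); last by [].
apply: lebesgue_measure_unique => //= _ [[u v]] _ <-.
rewrite /nu /mscale/= /pushforward /=.
rewrite (_ : phi @^-1` `]u, v] = [set` `](u - b) / a, (v - b) / a]]).
  rewrite !lebesgue_measure_itv /= !lte_fin ltr_pM2r ?invr_gt0// ltrD2r.
  case: ifPn => uv; last by rewrite mule0.
  by rewrite -!EFinD -EFinM; congr EFin; field; rewrite gt_eqF.
apply/seteqP; split => x /=; rewrite !in_itv/= => /andP[h1 h2]; apply/andP; split.
- by rewrite ltr_pdivrMr// ltrBlDr mulrC.
- by rewrite ler_pdivlMr// lerBrDr mulrC.
- by move: h1; rewrite ltr_pdivrMr// ltrBlDr mulrC.
- by move: h2; rewrite ler_pdivlMr// lerBrDr mulrC.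
Qed.

Lemma measurable_affine (a b : R) : measurable_fun setT (fun x : R => a * x + b).
Proof.
apply: continuous_measurable_fun => x.
by apply: cvgD; [apply: cvgM => //; exact: cvg_cst|exact: cvg_cst].
Qed.

Lemma measurable_comp_affine d (T : measurableType d) (f : R -> T) (a b : R) :
  measurable_fun setT f -> measurable_fun setT (fun x => f (a * x + b)).
Proof.
by move=> mf; apply: (@measurableT_comp _ _ _ _ _ _ f _ (fun x : R => a * x + b));
  [exact: mf|exact: measurable_affine].
Qed.

Lemma ge0_integral_affine (a b : R) (f : R -> \bar R) : 0 < a ->
  measurable_fun setT f -> (forall x, 0 <= f x)%E ->
  (\int[mu]_x f (a * x + b)%R = a^-1%:E * \int[mu]_x f x)%E.
Proof.
move=> a0 mf f0.
have mphi := measurable_affine a b.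
have mphi' : measurable_fun setT ((fun x : R => a * x + b) : measurableTypeR R -> measurableTypeR R).
  exact: mphi.
pose phi : measurableTypeR R -> measurableTypeR R := fun x : R => a * x + b.
have a0' : 0 <= a by exact: ltW.
pose nu := mscale (NngNum a0') (pushforward mu phi).
rewrite [X in (_ = _ * X)%E](_ : _ = \int[nu mphi']_x f x)%E; last first.
  apply: eq_measure_integral => A mA _.
  exact: (lebesgue_measure_affine b a0 mA).
rewrite ge0_integral_mscale//= ge0_integral_pushforward//=.
by rewrite muleA -EFinM mulVf ?gt_eqF// mul1e preimage_setT.
Qed.

Lemma intble_affine (a b : R) f : 0 < a -> intble f ->
  intble (fun x => f (a * x + b)).
Proof.
move=> a0 /intbleP[mf fi]; apply/intbleP; split; first exact: measurable_comp_affine.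
rewrite (@ge0_integral_affine a b (fun x => `|f x|%:E))//.
  by rewrite lte_mul_pinfty// lee_fin invr_ge0 ltW.
by apply/measurable_EFinP; exact: measurableT_comp.
Qed.

Lemma I_affine (a b : R) f : 0 < a -> intble f ->
  \int[mu]_x f (a * x + b) = a^-1 * \int[mu]_x f x.
Proof.
move=> a0 fi; have mf := intble_meas fi.
have fai := intble_affine b a0 fi.
have mEf : measurable_fun setT (EFin \o f) by exact/measurable_EFinP.
apply: EFin_inj; rewrite EFinM !EFin_I// integralE [in RHS]integralE.
rewrite muleBr//; last first.
  by rewrite fin_num_adde_defl// fin_numN; exact: integrable_neg_fin_num.
congr (_ - _)%E.
- rewrite -(@ge0_integral_affine a b (funepos (EFin \o f)))//.
    by apply: eq_integral => x _; rewrite !funeposE.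
  exact: measurable_funepos.
- rewrite -(@ge0_integral_affine a b (funeneg (EFin \o f)))//.
    by apply: eq_integral => x _; rewrite !funenegE.
  exact: measurable_funeneg.
Qed.

Lemma ge0_integral_opp (g : R -> \bar R) :
  measurable_fun setT g -> (forall x, 0 <= g x)%E ->
  (\int[mu]_x g (- x)%R = \int[mu]_x g x)%E.
Proof.
move=> mg g0.
rewrite [RHS](_ : _ = \int[pushforward mu (-%R : measurableTypeR R -> measurableTypeR R)]_x g x)%E; last first.
  by apply: eq_measure_integral => A mA _; exact/esym/lebesgue_measureN.
by rewrite ge0_integral_pushforward//= preimage_setT.
Qed.

Lemma I_opp f : measurable_fun setT f -> \int[mu]_x f (- x) = \int[mu]_x f x.
Proof.
move=> mf; rewrite /Rintegral; congr fine.
have mEf : measurable_fun setT (EFin \o f) by exact/measurable_EFinP.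
rewrite integralE [in RHS]integralE; congr (_ - _)%E.
  - rewrite -(@ge0_integral_opp (funepos (EFin \o f)))//.
    by apply: eq_integral => x _; rewrite !funeposE.
  exact: measurable_funepos.
- rewrite -(@ge0_integral_opp (funeneg (EFin \o f)))//.
    by apply: eq_integral => x _; rewrite !funenegE.
  exact: measurable_funeneg.
Qed.

(** Dominated convergence, stated for real integrals and everywhere
    convergent sequences. *)
Lemma I_dct (u : nat -> R -> R) f g : (forall n, measurable_fun setT (u n)) ->
  (forall x, u n x @[n --> \oo] --> f x) -> intble g ->
  (forall n x, `|u n x| <= g x) ->
  [/\ intble f, \int[mu]_x (u n x) @[n --> \oo] --> \int[mu]_x f x &
      \int[mu]_x `|u n x - f x| @[n --> \oo] --> 0].
Proof.
move=> mu_ uf gi ug.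
have mf : measurable_fun setT f by apply: (measurable_fun_cvg mu_) => x _; exact: uf.
have ui n : intble (u n).
  apply: (intble_le _ _ gi) => // x.
  by rewrite (le_trans (ug n x))// ler_norm.
have [] := @dominated_convergence _ _ _ mu setT measurableT (fun n => EFin \o u n)
  (EFin \o f) (EFin \o g).
- by move=> n; exact: (measurable_int _ (ui n)).
- by have mEf : measurable_fun setT (EFin \o f) by exact/measurable_EFinP.
- apply: aeW => x _ /=.
  apply: cvg_EFin; first exact: nearW.
  exact: uf.
- exact: gi.
- by apply: aeW => x n _ /=; rewrite lee_fin.
move=> fi c0 c1; split => //.
  apply: fine_cvg; rewrite fineK; first exact: c1.
  exact: integrable_fin_num.
have c0' : (\int[mu]_x `|u n x - f x|%:E)%E @[n --> \oo] --> 0%:E by exact: c0.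
exact: fine_cvg c0'.
Qed.

End real_integral.

Section square_integrable.
Context {R : realType}.
Local Notation mu := (@lebesgue_measure R).
Implicit Types f g h : R -> R.

Definition L2 f := measurable_fun setT f /\ intble (fun x => f x ^+ 2).

Definition sqn f : R := \int[mu]_x (f x ^+ 2).

Lemma L2_meas f : L2 f -> measurable_fun setT f. Proof. by case. Qed.

Lemma L2M f g : L2 f -> L2 g -> intble (fun x => f x * g x).
Proof.
move=> [mf fi] [mg gi]; apply: intble_le (intbleD fi gi).
  exact: measurable_funM.
move=> x; rewrite [leRHS]ger0_norm ?addr_ge0 ?sqr_ge0// normrM.
have := sqr_ge0 (`|f x| - `|g x|); rewrite -(real_normK (num_real (f x))).
by rewrite -(real_normK (num_real (g x))); have := sqr_ge0 `|f x|; have := sqr_ge0 `|g x|; nra.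
Qed.

Lemma L2_le f g : measurable_fun setT f -> (forall x, `|f x| <= `|g x|) ->
  L2 g -> L2 f.
Proof.
move=> mf fg [mg gi]; split => //; apply: intble_le gi.
  exact: measurable_funX.
by move=> x; rewrite !normrX lerXn2r// nnegrE.
Qed.

Lemma L2Z k f : L2 f -> L2 (fun x => k * f x).
Proof.
move=> [mf fi]; split; first exact: measurable_funM.
by under eq_fun do rewrite exprMn; exact: intbleZ.
Qed.

Lemma L2D f g : L2 f -> L2 g -> L2 (fun x => f x + g x).
Proof.
move=> Lf Lg; have [mf fi] := Lf; have [mg gi] := Lg.
split; first exact: measurable_funD.
rewrite (_ : (fun x => _) = (fun x => (f x ^+ 2 + g x ^+ 2) + 2 * (f x * g x))).
  by apply: intbleD; [exact: intbleD|apply: intbleZ; exact: L2M].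
by apply/funext => x; ring.
Qed.

Lemma L2N f : L2 f -> L2 (fun x => - f x).
Proof. by move=> /(@L2Z (-1)); under eq_fun do rewrite mulN1r. Qed.

Lemma L2B f g : L2 f -> L2 g -> L2 (fun x => f x - g x).
Proof. by move=> Lf Lg; exact: L2D Lf (L2N Lg). Qed.

Lemma L2_0 : L2 (fun=> 0).
Proof.
split; first exact: measurable_cst.
by under eq_fun do rewrite expr0n; exact: intble0.
Qed.

Lemma L2_sum (T : Type) (s : seq T) (F : T -> R -> R) :
  (forall i, L2 (F i)) -> L2 (fun x => \sum_(i <- s) F i x).
Proof.
move=> Fi; elim: s => [|i s ih].
  by under eq_fun do rewrite big_nil; exact: L2_0.
by under eq_fun do rewrite big_cons; exact: L2D.
Qed.

Lemma L2_bounded f g (M : R) : measurable_fun setT f -> (forall x, `|f x| <= M) ->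
  L2 g -> L2 (fun x => f x * g x).
Proof.
move=> mf fM Lg; apply: (@L2_le _ (fun x => M * g x)) (L2Z _ Lg).
  exact: measurable_funM mf (L2_meas Lg).
move=> x; rewrite !normrM ler_wpM2r//.
by rewrite (le_trans (fM x))// ler_norm.
Qed.

Lemma L2_affine f (a b : R) : 0 < a -> L2 f -> L2 (fun x => f (a * x + b)).
Proof.
move=> a0 [mf fi]; split; first exact: measurable_comp_affine.
exact: (intble_affine b a0 fi).
Qed.

Lemma sqn_affine f (a b : R) : 0 < a -> L2 f ->
  sqn (fun x => f (a * x + b)) = a^-1 * sqn f.
Proof. by move=> a0 [mf fi]; rewrite /sqn (@I_affine _ a b (fun x => f x ^+ 2)). Qed.

Lemma sqn_ge0 f : 0 <= sqn f.
Proof. by apply: I_ge0 => x; exact: sqr_ge0. Qed.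

Lemma EFin_sqn f : L2 f -> (sqn f)%:E = (\int[mu]_x (f x ^+ 2)%:E)%E.
Proof. by move=> [_ fi]; exact: EFin_I. Qed.

Lemma le_sqn f g : measurable_fun setT f -> (forall x, `|f x| <= `|g x|) ->
  L2 g -> sqn f <= sqn g.
Proof.
move=> mf fg Lg; have [_ fi] := L2_le mf fg Lg; apply: le_I => //; first exact: Lg.2.
move=> x; rewrite -(real_normK (num_real (f x))) -(real_normK (num_real (g x))).
by rewrite lerXn2r// nnegrE.
Qed.

Lemma ipC f g : inner2 f g = inner2 g f.
Proof. by apply: eq_Rintegral => x _; rewrite mulrC. Qed.

Lemma ipDl f g h : L2 f -> L2 g -> L2 h ->
  inner2 (fun x => f x + g x) h = inner2 f h + inner2 g h.
Proof.
move=> Lf Lg Lh; rewrite /inner2 -ID; [|exact: L2M..].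
by apply: eq_Rintegral => x _; rewrite mulrDl.
Qed.

Lemma ipZl k f h : L2 f -> L2 h -> inner2 (fun x => k * f x) h = k * inner2 f h.
Proof.
move=> Lf Lh; rewrite /inner2 -IZ; [|exact: L2M].
by apply: eq_Rintegral => x _; rewrite mulrA.
Qed.

Lemma ipBl f g h : L2 f -> L2 g -> L2 h ->
  inner2 (fun x => f x - g x) h = inner2 f h - inner2 g h.
Proof.
move=> Lf Lg Lh; rewrite /inner2 -IB; [|exact: L2M..].
by apply: eq_Rintegral => x _; rewrite mulrBl.
Qed.

Lemma ipBr f g h : L2 f -> L2 g -> L2 h ->
  inner2 h (fun x => f x - g x) = inner2 h f - inner2 h g.
Proof. by move=> *; rewrite ipC ipBl// ![inner2 h _]ipC. Qed.

Lemma ipDr f g h : L2 f -> L2 g -> L2 h ->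
  inner2 h (fun x => f x + g x) = inner2 h f + inner2 h g.
Proof. by move=> *; rewrite ipC ipDl// ![inner2 h _]ipC. Qed.

Lemma ip_suml (T : Type) (s : seq T) (F : T -> R -> R) h :
  (forall i, L2 (F i)) -> L2 h ->
  inner2 (fun x => \sum_(i <- s) F i x) h = \sum_(i <- s) inner2 (F i) h.
Proof.
move=> LF Lh; rewrite /inner2 -I_sum => [|i]; last exact: L2M.
by apply: eq_Rintegral => x _; rewrite big_distrl.
Qed.

Lemma ipxx f : inner2 f f = sqn f.
Proof. by apply: eq_Rintegral => x _; rewrite expr2. Qed.

Lemma sqnD f g : L2 f -> L2 g ->
  sqn (fun x => f x + g x) = sqn f + 2 * inner2 f g + sqn g.
Proof.
move=> Lf Lg; rewrite -!ipxx ipDl// ?ipDr//; try exact: L2D.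
by rewrite (ipC g f); ring.
Qed.

Lemma sqnZ k f : L2 f -> sqn (fun x => k * f x) = k ^+ 2 * sqn f.
Proof.
by move=> [mf fi]; rewrite /sqn -IZ//; apply: eq_Rintegral => x _; rewrite exprMn.
Qed.

Lemma sqnN f : sqn (fun x => - f x) = sqn f.
Proof. by apply: eq_Rintegral => x _; rewrite sqrrN. Qed.

Lemma sqnB f g : L2 f -> L2 g ->
  sqn (fun x => f x - g x) = sqn f - 2 * inner2 f g + sqn g.
Proof.
move=> Lf Lg; rewrite -!ipxx ipBl// ?ipBr//; try exact: L2B.
by rewrite (ipC g f); ring.
Qed.

Lemma sqnBC f g : sqn (fun x => f x - g x) = sqn (fun x => g x - f x).
Proof. by rewrite -sqnN; congr sqn; apply/funext => x; ring. Qed.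

(** The discriminant of a nonnegative quadratic polynomial. *)
Lemma cauchy_schwarz f g : L2 f -> L2 g -> inner2 f g ^+ 2 <= sqn f * sqn g.
Proof.
move=> Lf Lg; have := sqn_ge0 g; rewrite le_eqVlt => /predU1P[g0|g0].
  have [->|ip0] := eqVneq (inner2 f g) 0; first by rewrite expr0n/= -g0 mulr0.
  pose t := - (sqn f + 1) / (2 * inner2 f g).
  have := sqn_ge0 (fun x => f x + t * g x).
  rewrite sqnD//; last exact: L2Z.
  rewrite (ipC f) ipZl// (ipC g) sqnZ// -g0 mulr0 addr0.
  have -> : 2 * (t * inner2 f g) = - (sqn f + 1) by rewrite /t; field.
  by lra.
have := sqn_ge0 (fun x => sqn g * f x - inner2 f g * g x).
rewrite sqnB; [|exact: L2Z..].
rewrite ipZl//; last exact: L2Z.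
rewrite (ipC f (fun x => _ * _)) ipZl// (ipC g f) !sqnZ//.
set a := inner2 f g; set F := sqn f; set G := sqn g => h.
have : 0 <= G * (G * F - a ^+ 2) by move: h; congr (_ <= _); ring.
by rewrite pmulr_rge0// subr_ge0 mulrC.
Qed.

Lemma sqnD_le f g : L2 f -> L2 g ->
  sqn (fun x => f x + g x) <= 2 * (sqn f + sqn g).
Proof.
move=> Lf Lg; have := sqn_ge0 (fun x => f x - g x); rewrite sqnB// sqnD//; lra.
Qed.

(** Weighted so that the factor of the first term is as close to one as
    desired: losses of this kind can be repeated a finite number of times. *)
Lemma sqnD_young f g (d : R) : 0 < d -> L2 f -> L2 g ->
  sqn (fun x => f x + g x) <= (1 + d) * sqn f + (1 + d^-1) * sqn g.
Proof.
move=> d0 Lf Lg; have := sqn_ge0 (fun x => d * f x - g x).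
rewrite sqnB//; last exact: L2Z.
rewrite sqnZ// ipZl// sqnD//.
set a := inner2 f g; set F := sqn f; set G := sqn g => h.
rewrite -subr_ge0.
have -> : (1 + d) * F + (1 + d^-1) * G - (F + 2 * a + G) =
  d^-1 * (d ^+ 2 * F - 2 * (d * a) + G) by field; rewrite gt_eqF.
by rewrite mulr_ge0// invr_ge0 ltW.
Qed.

Lemma abs_ip f g : L2 f -> L2 g ->
  `|inner2 f g| <= Num.sqrt (sqn f) * Num.sqrt (sqn g).
Proof.
move=> Lf Lg; rewrite -sqrtrM ?sqn_ge0// -sqrtr_sqr ler_wsqrtr//.
exact: cauchy_schwarz.
Qed.

Definition L2cvg (u : nat -> R -> R) f :=
  sqn (fun x => u n x - f x) @[n --> \oo] --> 0.

Lemma ip_cvg (u v : nat -> R -> R) f g :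
  (forall n, L2 (u n)) -> (forall n, L2 (v n)) -> L2 f -> L2 g ->
  L2cvg u f -> L2cvg v g ->
  inner2 (u n) (v n) @[n --> \oo] --> inner2 f g.
Proof.
move=> Lu Lv Lf Lg uf vg.
have su : Num.sqrt (sqn (fun x => u n x - f x)) @[n --> \oo] --> 0.
  by rewrite -sqrtr0; apply: continuous_cvg uf; exact: sqrt_continuous.
have sv : Num.sqrt (sqn (fun x => v n x - g x)) @[n --> \oo] --> 0.
  by rewrite -sqrtr0; apply: continuous_cvg vg; exact: sqrt_continuous.
apply/subr_cvg0/norm_cvg0P.
apply: (@squeeze_cvgr _ _ _ _ (fun=> 0) (fun n =>
  Num.sqrt (sqn (fun x => u n x - f x)) * Num.sqrt (sqn (fun x => v n x - g x)) +
  Num.sqrt (sqn (fun x => u n x - f x)) * Num.sqrt (sqn g) +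
  Num.sqrt (sqn f) * Num.sqrt (sqn (fun x => v n x - g x)))).
- apply: nearW => n; rewrite normr_ge0/=.
  rewrite (_ : _ - _ = inner2 (fun x => u n x - f x) (fun x => v n x - g x) +
    inner2 (fun x => u n x - f x) g + inner2 f (fun x => v n x - g x)).
    rewrite (le_trans (ler_normD _ _))// lerD//; last by rewrite abs_ip//; exact: L2B.
    rewrite (le_trans (ler_normD _ _))// lerD//; rewrite abs_ip//; exact: L2B.
  rewrite !(ipBl, ipBr)//; try exact: L2B.
  by ring.
- exact: cvg_cst.
- rewrite (_ : 0 = 0 * 0 + 0 * Num.sqrt (sqn g) + Num.sqrt (sqn f) * 0 :> R);
    last by rewrite !mulr0 mul0r !addr0.
  by apply: cvgD; [apply: cvgD; [exact: cvgM|apply: cvgM => //; exact: cvg_cst]|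
    apply: cvgM => //; exact: cvg_cst].
Qed.

Lemma sqn_cvg (u : nat -> R -> R) f : (forall n, L2 (u n)) -> L2 f ->
  L2cvg u f -> sqn (u n) @[n --> \oo] --> sqn f.
Proof.
move=> Lu Lf uf; rewrite -ipxx; under eq_fun do rewrite -ipxx.
exact: ip_cvg.
Qed.

Lemma sqn_eq0 f : L2 f -> sqn f = 0 -> {ae mu, forall x, f x = 0}.
Proof.
move=> Lf f0; have [mf fi] := Lf.
have mf2 : measurable_fun setT (EFin \o (fun x => f x ^+ 2)) := measurable_int _ fi.
have : (\int[mu]_x `|(EFin \o (fun x => f x ^+ 2)%R) x| = 0)%E.
  under eq_integral do rewrite gee0_abs ?lee_fin ?sqr_ge0//.
  by rewrite -EFin_sqn// f0.
move/(ae_eq_integral_abs mu measurableT mf2).1; apply: filterS => x /= /(_ I) [].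
by move=> /eqP; rewrite sqrf_eq0 => /eqP.
Qed.

End square_integrable.

(** * Completeness of the space of square integrable functions *)

Section completeness.
Context {R : realType}.
Local Notation mu := (@lebesgue_measure R).
Implicit Types f g h : R -> R.

Lemma ae_mono (P Q : R -> Prop) : (forall x, P x -> Q x) ->
  {ae mu, forall x, P x} -> {ae mu, forall x, Q x}.
Proof.
move=> PQ [N [mN N0 PN]]; exists N; split => //.
by apply: subset_trans PN => x /=; apply: contra_not; exact: PQ.
Qed.

Lemma ae_and (P Q : R -> Prop) : {ae mu, forall x, P x} ->
  {ae mu, forall x, Q x} -> {ae mu, forall x, P x /\ Q x}.
Proof.
move=> [N [mN N0 PN]] [M [mM M0 QM]]; exists (N `|` M); split.
- exact: measurableU.
- by rewrite null_set_setU.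
- move=> x /= /not_andP[h|h]; [left; exact: PN|right; exact: QM].
Qed.

Lemma ae_sqn_eq f g : measurable_fun setT f -> measurable_fun setT g ->
  {ae mu, forall x, f x = g x} -> sqn f = sqn g.
Proof.
move=> mf mg fg; rewrite /sqn /Rintegral; congr fine.
apply: ge0_ae_eq_integral => //.
- by apply/measurable_EFinP; exact: measurable_funX.
- by apply/measurable_EFinP; exact: measurable_funX.
- by move=> x _; rewrite lee_fin sqr_ge0.
- by move=> x _; rewrite lee_fin sqr_ge0.
- by apply: ae_mono fg => x /= -> _.
Qed.

Lemma ae_sqn0 f : measurable_fun setT f -> {ae mu, forall x, f x = 0} -> sqn f = 0.
Proof.
move=> mf f0; rewrite (ae_sqn_eq mf (measurable_cst (0:R)))//.
rewrite /sqn; under eq_Rintegral do rewrite expr0n.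
by rewrite /Rintegral integral0.
Qed.

(** Fatou's lemma, in the form in which it turns a Cauchy estimate into an
    estimate of the distance to the limit. *)
Lemma sqn_fatou (v : nat -> R -> R) f (e : R) : (forall n, L2 (v n)) ->
  measurable_fun setT f -> {ae mu, forall x, v n x @[n --> \oo] --> f x} ->
  (\forall n \near \oo, sqn (v n) <= e) -> L2 f /\ sqn f <= e.
Proof.
move=> Lv mf vf ve.
have mv n : measurable_fun setT (fun x => (v n x ^+ 2)%:E).
  by apply/measurable_EFinP; apply: measurable_funX; exact: L2_meas.
have mf2 : measurable_fun setT (fun x => (f x ^+ 2)%:E).
  by apply/measurable_EFinP; exact: measurable_funX.
have key : (\int[mu]_x (f x ^+ 2)%:E <= e%:E)%E.
  rewrite (_ : \int[mu]_x _ = \int[mu]_x limn_einf (fun n => (v n x ^+ 2)%:E))%E; last first.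
    apply: ge0_ae_eq_integral => //.
    - rewrite (_ : (fun x => _) = (fun x => - limn_esup (fun n => - (v n x ^+ 2)%:E))%E).
        apply: measurableT_comp => //; apply: measurable_fun_limn_esup => n.
        by apply: measurableT_comp => //; exact: mv.
      apply/funext => x; rewrite -limn_einfN; congr limn_einf; apply/funext => n.
      by rewrite compE oppeK.
    - by move=> x _; rewrite lee_fin sqr_ge0.
    - move=> x _; rewrite limn_einf_lim; apply: lime_ge.
        exact: is_cvg_einfs.
      by apply: nearW => n; apply: le_ereal_inf_tmp => _ [m _ <-]; rewrite lee_fin sqr_ge0.
    - apply: ae_mono vf => x /= vx _; apply/esym.
      apply: (cvg_limn_einf_sup _).1; apply: cvg_EFin; first exact: nearW.
      have vx2 : v n x ^+ 2 @[n --> \oo] --> f x ^+ 2.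
        by under eq_fun do rewrite expr2; rewrite expr2; exact: cvgM.
      exact: vx2.
  apply: le_trans (fatou _ measurableT _ _) _ => //.
    by move=> n x _; rewrite lee_fin sqr_ge0.
  rewrite limn_einf_lim; apply: lime_le; first exact: is_cvg_einfs.
  case: ve => N _ ve; apply: nearW => n; apply: ereal_inf_le.
  exists (\int[mu]_x (v (maxn n N) x ^+ 2)%:E)%E.
    by exists (maxn n N) => //=; exact: leq_maxl.
  by rewrite -EFin_sqn// lee_fin ve//= leq_maxr.
have Lf : L2 f.
  split => //; apply/(ge0_intbleP (fun x => sqr_ge0 _)); split.
    exact: measurable_funX.
  by rewrite (le_lt_trans key)// ltry.
by split => //; rewrite -lee_fin EFin_sqn.
Qed.

(** Fast convergence in norm forces convergence almost everywhere: a
    weighted sum of the squared increments has a finite integral. *)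
Lemma L2cvg_ae_sub (u : nat -> R -> R) : (forall n, L2 (u n)) ->
  (forall n, sqn (fun x => u n.+1 x - u n x) <= 8^-1 ^+ n) ->
  {ae mu, forall x, cvgn (u ^~ x)}.
Proof.
move=> Lu ud; pose d n x := u n.+1 x - u n x.
have Ld n : L2 (d n) by exact: L2B.
(* Since 4^n 8^-n is summable, this sum is finite almost everywhere, and
   then the increments are at most a multiple of 2^-n. *)
pose F (n : nat) (x : R) : \bar R := (4 ^+ n * d n x ^+ 2)%:E.
have mF n : measurable_fun setT (F n).
  by apply/measurable_EFinP; apply: measurable_funM => //; apply: measurable_funX; exact: L2_meas.
have F0 n x : (0 <= F n x)%E by rewrite lee_fin mulr_ge0// ?sqr_ge0// exprn_ge0.
have iF : (\int[mu]_x (\sum_(n <oo) F n x) < +oo)%E.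
  rewrite integral_nneseries//.
  apply: (@le_lt_trans _ _ (\sum_(n <oo) (2^-1 ^+ n)%:E)%E).
    apply: lee_nneseries => n _; first by move=> _; apply: integral_ge0.
    rewrite (_ : \int[mu]_x F n x = \int[mu]_x ((4 ^+ n)%:E * (d n x ^+ 2)%:E))%E; last by [].
    rewrite ge0_integralZl//; last 2 first.
    - by apply/measurable_EFinP; apply: measurable_funX; exact: L2_meas.
    - by move=> x _; rewrite lee_fin sqr_ge0.
    rewrite -EFin_sqn// -EFinM lee_fin.
    apply: (@le_trans _ _ (4 ^+ n * 8^-1 ^+ n)); first by rewrite ler_wpM2l ?exprn_ge0// ud.
    by rewrite -exprMn (_ : 4 * 8^-1 = 2^-1 :> R)//; field.
  apply: (@le_lt_trans _ _ 2%:E); last exact: ltry.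
  apply: lime_le; first by apply: is_cvg_nneseries => n _ _; rewrite lee_fin exprn_ge0.
  apply: nearW => n; rewrite sumEFin lee_fin.
  have := @geometric_le_lim R n 1 2^-1; rewrite seriesEnat/=.
  rewrite (eq_bigr (fun i => 2^-1 ^+ i)) => [h|i _]; last by rewrite mul1r.
  apply: (le_trans (h _ _ _)) => //.
    by rewrite ger0_norm ?invr_ge0// invf_lt1// ltr1n.
  by rewrite mul1r le_eqVlt; apply/orP; left; apply/eqP; field.
have mS : measurable_fun setT (fun x => (\sum_(n <oo) F n x)%E).
  exact: ge0_emeasurable_sum.
have S0 x : (0 <= \sum_(n <oo) F n x)%E by exact: nneseries_ge0.
have iS : mu.-integrable setT (fun x => (\sum_(n <oo) F n x)%E).
  apply/integrableP; split => //.
  by under eq_integral do rewrite gee0_abs//.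
apply: ae_mono (integrable_ae measurableT iS) => x /= /(_ I) Sfin.
set S := (\sum_(n <oo) F n x)%E in Sfin.
have S1 n : 4 ^+ n * d n x ^+ 2 <= fine S.
  rewrite -lee_fin fineK// -/(F n x).
  apply: le_trans (nneseries_lim_ge n.+1 (P := xpredT) (u_ := F ^~ x) _) => //.
  by rewrite big_nat_recr//= leeDr// sume_ge0.
have fS0 : 0 <= fine S by apply: fine_ge0; exact: S0.
have db n : `|d n x| <= geometric (Num.sqrt (fine S)) 2^-1 n.
  rewrite /geometric/= -(@ler_pXn2r _ 2)// ?nnegrE ?mulr_ge0 ?exprn_ge0 ?sqrtr_ge0//.
  rewrite exprMn sqr_sqrtr// real_normK ?num_real// exprAC.
  rewrite (_ : 2^-1 ^+ 2 = 4^-1 :> R); last by field.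
  by rewrite exprVn ler_pdivlMr ?exprn_gt0// mulrC.
rewrite (_ : u ^~ x = (fun n => u 0 x + series (telescope (u ^~ x)) n)); last first.
  by apply/funext => n; rewrite [LHS](eq_sum_telescope (u ^~ x)).
apply: is_cvgD; first exact: is_cvg_cst.
apply: normed_cvg.
apply: (@series_le_cvg _ _ (geometric (Num.sqrt (fine S)) 2^-1)) => //.
- by move=> n; exact: normr_ge0.
- by move=> n; rewrite geometric_ge0// ?sqrtr_ge0// invr_ge0.
- by apply: is_cvg_geometric_series; rewrite ger0_norm ?invr_ge0// invf_lt1// ltr1n.
Qed.

(** Riesz-Fischer. *)
Lemma L2_complete (u : nat -> R -> R) : (forall n, L2 (u n)) ->
  (forall e : R, 0 < e -> exists N, forall m n, (N <= m)%N -> (N <= n)%N ->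
     sqn (fun x => u m x - u n x) <= e) ->
  exists2 f, L2 f & L2cvg u f.
Proof.
move=> Lu uC.
have h8 n : 0 < 8^-1 ^+ n :> R by rewrite exprn_gt0// invr_gt0.
have [N NP] := choice (fun k => uC _ (h8 k)).
(* A nondecreasing choice of indices beyond all the N k. *)
pose M k := (k + \sum_(i < k.+1) N i)%N.
have NM k : (N k <= M k)%N by rewrite /M big_ord_recr/= addnA leq_addl.
have MS k : (M k <= M k.+1)%N by rewrite /M [in leqRHS]big_ord_recr/= addSn ltnW// ltnS addnA leq_addr.
pose v k := u (M k).
have Lv k : L2 (v k) by exact: Lu.
have vc : {ae mu, forall x, cvgn (v ^~ x)}.
  apply: L2cvg_ae_sub => // n; apply: NP => //.
  exact: leq_trans (NM n) (MS n).
(* The upper limit is measurable, even at points where the subsequence does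
   not converge. *)
pose f x := fine (limn_esup (fun k => (v k x)%:E)).
have mf : measurable_fun setT f.
  apply: measurableT_comp => //; apply: measurable_fun_limn_esup => n.
  by apply/measurable_EFinP; exact: L2_meas.
have vf : {ae mu, forall x, v n x @[n --> \oo] --> f x}.
  apply: ae_mono vc => x /= /cvg_ex[l vl].
  have : (v n x)%:E @[n --> \oo] --> l%:E.
    by apply: cvg_EFin => //; exact: nearW.
  by move=> /cvg_limn_einf_sup[_]; rewrite /f => ->.
have Mge (e : R) k K : (forall m n, (K <= m)%N -> (K <= n)%N ->
     sqn (fun x => u m x - u n x) <= e) -> (K <= k)%N ->
    L2 (fun x => u k x - f x) /\ sqn (fun x => u k x - f x) <= e.
  move=> KP Kk.
  apply: (@sqn_fatou (fun n x => u k x - v n x)).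
  - by move=> n; exact: L2B.
  - by apply: measurable_funB => //; exact: L2_meas.
  - apply: ae_mono vf => x /= vx; apply: cvgB => //; exact: cvg_cst.
  - exists K => //= n Kn; apply: KP => //.
    by rewrite (leq_trans Kn)// leq_addr.
have Lf : L2 f.
  have [K KP] := uC 1 ltr01.
  have [h _] := Mge 1 K K KP (leqnn _).
  by have := L2B (Lu K) h; under eq_fun do rewrite opprB addrC subrK.
exists f => //; apply/cvgrPdist_le => e e0.
have [K KP] := uC e e0.
exists K => //= n Kn; rewrite sub0r normrN ger0_norm ?sqn_ge0//.
by have [] := Mge e n K KP Kn.
Qed.

End completeness.

(** * Trigonometric system *)

Section indicator.
Context {R : realType}.
Local Notation mu := (@lebesgue_measure R).
Implicit Types f g h : R -> R.

Lemma measurable_fun_indic (A : set R) : measurable A ->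
  measurable_fun setT (\1_A : R -> R).
Proof. by move=> mA; exact: measurable_indic. Qed.

Lemma indic_norm_le1 (A : set R) x : `|\1_A x : R| <= 1.
Proof. by rewrite indicE; case: (_ \in _); rewrite ?normr1 ?normr0. Qed.

Lemma intble_indic (A : set R) f : measurable A -> intble f ->
  intble (fun x => f x * \1_A x).
Proof.
move=> mA fi; under eq_fun do rewrite mulrC.
by apply: (@intble_bounded _ _ _ 1) => //; exact: indic_norm_le1.
Qed.

Lemma L2_indic (A : set R) f : measurable A -> L2 f -> L2 (fun x => f x * \1_A x).
Proof.
move=> mA fi; under eq_fun do rewrite mulrC.
by apply: (@L2_bounded _ _ _ 1) => //; exact: indic_norm_le1.
Qed.

Lemma I_indicE (A : set R) f : \int[mu]_x (f x * \1_A x) = \int[mu]_(x in A) f x.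
Proof.
rewrite [RHS]Rintegral_mkcond /Rintegral; congr fine; apply: eq_integral => x _.
by rewrite patchE indicE; case: (_ \in _); rewrite ?mulr1 ?mulr0.
Qed.

Lemma L2_1_itv (b0 b1 : bool) (a b : R) : L2 (\1_[set` Interval (BSide b0 a) (BSide b1 b)]).
Proof.
split; first exact: measurable_fun_indic.
rewrite (_ : (fun x => _) = \1_[set` Interval (BSide b0 a) (BSide b1 b)]).
  exact: integrable_indic_itv.
by apply/funext => x; rewrite indicE; case: (_ \in _); rewrite ?expr1n ?expr0n.
Qed.

(** A square integrable function of bounded support is integrable. *)
Lemma L2_intble_itv f (a b : R) : L2 f -> intble (fun x => f x * \1_(`[a, b[) x).
Proof. by move=> Lf; apply: L2M => //; exact: L2_1_itv. Qed.

Lemma intble_cont_itv f (a b : R) : continuous f ->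
  intble (fun x => f x * \1_(`[a, b[) x).
Proof.
move=> cf; apply: (@intble_le _ _ (fun x => f x * \1_(`[a, b]) x)).
- apply: measurable_funM; last exact: measurable_fun_indic.
  exact: continuous_measurable_fun.
- move=> x; rewrite !normrM ler_wpM2l// !indicE.
  case: (boolP (x \in `[a, b[%classic)) => [|_]; last by rewrite normr0.
  rewrite inE/= in_itv/= => /andP[h1 h2].
  by rewrite mem_set//= in_itv/= h1 ltW.
have : mu.-integrable `[a, b] (EFin \o f).
  apply: continuous_compact_integrable; first exact: segment_compact.
  exact: continuous_subspaceT.
move=> /(integrable_mkcond _ _).1 => /(_ (measurable_itv _)).
apply: eq_integrable => // x _; rewrite /= patchE indicE /=.
by case: (_ \in _); rewrite ?mulr1 ?mulr0.
Qed.

(** The fundamental theorem of calculus, with the indicator of a half-open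
    interval as a factor, so that adjacent intervals add up. *)
Lemma I_FTC f F (a b : R) : a < b -> continuous f ->
  (forall x, is_derive x (1:R) F (f x)) ->
  \int[mu]_x (f x * \1_(`[a, b[) x) = F b - F a.
Proof.
move=> ab cf dF; rewrite I_indicE Rintegral_itv_bndo_bndc; last first.
  have : mu.-integrable `[a, b] (EFin \o f).
    apply: continuous_compact_integrable; first exact: segment_compact.
    exact: continuous_subspaceT.
  apply: integrableS => //; exact: subset_itv_co_cc.
rewrite /Rintegral (@continuous_FTC2 _ f F)//.
- exact: continuous_subspaceT.
- have cF : continuous F.
    by move=> x; apply: differentiable_continuous; apply/derivable1_diffP.
  split => //.
  - by apply: cvg_at_right_filter; exact: cF.
  - by apply: cvg_at_left_filter; exact: cF.
- by move=> x _; rewrite derive1E; exact: derive_val.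
Qed.

(** The primitive of f is constant, and f is its derivative at almost every
    point. *)
Lemma I_initial_eq0 f (b : R) : L2 f ->
  (forall x, 0 < x < b -> \int[mu]_t (f t * \1_(`[0, x[) t) = 0) ->
  {ae mu, forall x, 0 < x < b -> f x = 0}.
Proof.
move=> Lf f0.
have fi (a c : R) : mu.-integrable `[a, c] (EFin \o f).
  have := L2M Lf (L2_1_itv true false a c).
  move=> h; apply/(integrable_mkcond _ _).2 => //.
  apply: eq_integrable h => // x _; rewrite /= patchE indicE /=.
  by case: (_ \in _); rewrite ?mulr1 ?mulr0.
have lf : locally_integrable setT f.
  split; [exact: L2_meas|exact: openT|move=> K _ cK].
  have /compact_bounded [M [_ MK]] := cK.
  have h : mu.-integrable K (EFin \o f).
    apply: integrableS (fi (- (`|M| + 1)) (`|M| + 1)) => //.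
    - exact: compact_measurable.
    - move=> x Kx /=; rewrite in_itv/= -ler_norml; apply: MK => //.
      by rewrite (le_lt_trans (ler_norm M))// ltrDl.
  by case/integrableP : h.
have := @FTC1 R f (BLeft 0) (fi 0) lf.
apply: ae_mono => x hx /andP[x0 xb].
have [|_ <-] := hx; first by rewrite /= lte_fin.
rewrite derive1E.
have : \forall y \near x, (fun y => \int[mu]_(t in [set` Interval (BLeft 0) (BRight y)]) f t) y = cst 0 y.
  near=> y => /=.
  rewrite -[RHS](f0 y).
    rewrite I_indicE Rintegral_itv_bndo_bndc//.
    by apply: integrableS (fi 0 y) => //; exact: subset_itv_co_cc.
  by apply/andP; split; near: y; [exact: lt_nbhsr|exact: lt_nbhsl].
move=> h; rewrite (near_eq_derive _ h)//; first by rewrite derive_cst.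
Unshelve. all: by end_near. Qed.

End indicator.

Section trigonometric_system.
Context {R : realType}.
Local Notation mu := (@lebesgue_measure R).
Implicit Types f g h : R -> R.
Implicit Types (n m : int) (x y : R).

Lemma cos_2pi_int n : cos (2 * pi * n%:~R) = 1 :> R.
Proof.
have h k : cos (2 * pi * k%:R) = 1 :> R.
  have := periodicn (@cosD2pi R) k 0; rewrite add0r cos0 => E; rewrite -[RHS]E.
  by congr cos; rewrite -[RHS]mulr_natr -[pi *+ 2]mulr_natl.
case: n => k; first exact: h.
by rewrite NegzE mulrNz mulrN cosN; exact: h.
Qed.

Lemma sin_2pi_int n : sin (2 * pi * n%:~R) = 0 :> R.
Proof.
have h k : sin (2 * pi * k%:R) = 0 :> R.
  have := periodicn (@sinD2pi R) k 0; rewrite add0r sin0 => E; rewrite -[RHS]E.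
  by congr sin; rewrite -[RHS]mulr_natr -[pi *+ 2]mulr_natl.
case: n => k; first exact: h.
by rewrite NegzE mulrNz mulrN sinN h oppr0.
Qed.

Lemma continuous_cosM (c d : R) : continuous (fun x => cos (c * x + d)).
Proof.
move=> x; apply: continuous_comp; last exact: continuous_cos.
by apply: cvgD; [apply: cvgM => //; exact: cvg_cst|exact: cvg_cst].
Qed.

Lemma continuous_sinM (c d : R) : continuous (fun x => sin (c * x + d)).
Proof.
move=> x; apply: continuous_comp; last exact: continuous_sin.
by apply: cvgD; [apply: cvgM => //; exact: cvg_cst|exact: cvg_cst].
Qed.

Lemma I01_cos n (d : R) :
  \int[mu]_x (cos (2 * pi * n%:~R * x + d) * \1_(`[0, 1[) x) = cos d * (n == 0)%:R.
Proof.
have [->|n0] := eqVneq n 0.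
  transitivity (\int[mu]_x (cst (cos d) x * \1_(`[0, 1[) x)).
    by apply: eq_Rintegral => x _; rewrite mulr0 mul0r add0r.
  have dF x : is_derive x (1:R) (fun x => cos d * x) (cst (cos d) x).
    have := is_deriveZ (cos d) (is_derive_id x (1:R)).
    by rewrite /GRing.scale/= mulr1.
  by rewrite (I_FTC ltr01 _ dF) ?mulr0 ?subr0// => x; exact: cvg_cst.
pose c : R := 2 * pi * n%:~R.
have c0 : c != 0 by rewrite !mulf_neq0// ?intr_eq0// gt_eqF ?pi_gt0.
have dF x : is_derive x (1:R) (fun x => c^-1 * sin (c * x + d)) (cos (c * x + d)).
  have h : is_derive x (1:R) (fun x => c * x + d) c.
    have -> : (fun x => c * x + d) = ((c \*: @id R) + cst d) by [].
    by apply: is_derive_eq; rewrite addr0 /GRing.scale/= mulr1.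
  have D := @is_derive1_comp R sin (fun x => c * x + d) x _ _ (is_derive_sin (c * x + d)) h.
  have D2 := is_deriveZ c^-1 D.
  apply: (is_derive_eq D2).
  by rewrite /GRing.scale/= mulrCA mulVf// mulr1.
rewrite (I_FTC ltr01 _ dF); last exact: continuous_cosM.
rewrite mulr0 add0r mulr1 mulr0 sinD /c cos_2pi_int sin_2pi_int mul0r add0r.
by rewrite mul1r subrr.
Qed.

Lemma I01_sin n (d : R) :
  \int[mu]_x (sin (2 * pi * n%:~R * x + d) * \1_(`[0, 1[) x) = sin d * (n == 0)%:R.
Proof.
have := I01_cos n (d - pi / 2); rewrite cosBpihalf => <-.
by apply: eq_Rintegral => x _; rewrite addrA cosBpihalf.
Qed.

Definition cas x : R := cos x + sin x.

Lemma cas_le2 x : `|cas x| <= 2.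
Proof.
rewrite /cas (le_trans (ler_normD _ _))// (_ : 2 = 1 + 1 :> R)//.
by rewrite lerD// ?cos_max ?sin_max.
Qed.

(** The functions cos + sin of integral frequencies form a real orthonormal
    system indexed by all the integers, the signs of the frequencies
    standing for the two phases. *)
Definition circle n x : R := cas (2 * pi * x * n%:~R) * \1_(`[0, 1[) x.

Lemma measurable_cas (c : R) : measurable_fun setT (fun x => cas (2 * pi * x * c)).
Proof.
rewrite /cas; apply: continuous_measurable_fun => x.
have -> : (fun x => cos (2 * pi * x * c) + sin (2 * pi * x * c)) =
    (fun x => cos ((2 * pi * c) * x + 0) + sin ((2 * pi * c) * x + 0)).
  by apply/funext => y; congr (cos _ + sin _); ring.
by apply: cvgD; [exact: continuous_cosM|exact: continuous_sinM].
Qed.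

Lemma L2_circle n : L2 (circle n).
Proof.
apply: (@L2_bounded _ _ _ 2); first exact: measurable_cas.
  by move=> x; exact: cas_le2.
exact: L2_1_itv.
Qed.

Lemma indic_sq (A : set R) x : \1_A x * \1_A x = \1_A x :> R.
Proof. by rewrite indicE; case: (_ \in _); rewrite ?mulr1 ?mulr0. Qed.

Lemma circle_orthonormal n m : inner2 (circle n) (circle m) = (n == m)%:R.
Proof.
rewrite /inner2 (_ : (fun x => _) = (fun x =>
   cos (2 * pi * (n - m)%:~R * x + 0) * \1_(`[0, 1[) x +
   sin (2 * pi * (n + m)%:~R * x + 0) * \1_(`[0, 1[) x)); last first.
  apply/funext => x; rewrite /circle !addr0.
  rewrite (_ : 2 * pi * (n - m)%:~R * x = 2 * pi * x * n%:~R - 2 * pi * x * m%:~R);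
    last by rewrite intrB; ring.
  rewrite (_ : 2 * pi * (n + m)%:~R * x = 2 * pi * x * n%:~R + 2 * pi * x * m%:~R);
    last by rewrite intrD; ring.
  rewrite cosB sinD /cas -[in RHS](indic_sq `[0, 1[ x).
  by move: (cos _) (sin _) (cos _) (sin _) (\1__ _) => a b c d e; ring.
rewrite ID; last 2 first.
- by apply: intble_cont_itv; exact: continuous_cosM.
- by apply: intble_cont_itv; exact: continuous_sinM.
by rewrite I01_cos I01_sin cos0 sin0 mul0r addr0 mul1r subr_eq0.
Qed.

End trigonometric_system.

Section parseval.
Context {R : realType}.
Local Notation mu := (@lebesgue_measure R).
Implicit Types f g h : R -> R.

(** The partial sums form a Cauchy sequence by Bessel's inequality; its
    limit differs from f by a function orthogonal to the system, hence
    orthogonal to f. *)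
Lemma parseval_nat (e : nat -> R -> R) f : (forall n, L2 (e n)) ->
  (forall i j, inner2 (e i) (e j) = (i == j)%:R) -> L2 f ->
  (forall g, L2 g -> (forall n, inner2 g (e n) = 0) -> inner2 g f = 0) ->
  \sum_(0 <= i < n) inner2 f (e i) ^+ 2 @[n --> \oo] --> sqn f.
Proof.
move=> Le eo Lf tot.
pose c i := inner2 f (e i).
pose s n x := \sum_(0 <= i < n) c i * e i x.
have Lce i : L2 (fun x => c i * e i x) by exact: L2Z.
have Ls n : L2 (s n) by exact: L2_sum.
have ipse n j : inner2 (s n) (e j) = if (j < n)%N then c j else 0.
  rewrite ip_suml// (eq_bigr (fun i => c i * (i == j)%:R)); last first.
    by move=> i _; rewrite ipZl// eo.
  case: ifPn => jn.
    rewrite (bigD1_seq j)//= ?mem_index_iota ?iota_uniq//.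
    rewrite eqxx mulr1 big1 ?addr0// => i /negbTE ->; exact: mulr0.
  rewrite big_nat_cond big1// => i /andP[/andP[_ ilt] _].
  case: eqP => [ij|_]; last by rewrite mulr0.
  by move: jn; rewrite -ij ilt.
have ipfs n : inner2 f (s n) = \sum_(0 <= i < n) c i ^+ 2.
  rewrite ipC ip_suml//; apply: eq_bigr => i _.
  by rewrite ipZl// ipC -expr2.
have ss n : sqn (s n) = \sum_(0 <= i < n) c i ^+ 2.
  rewrite -ipxx ip_suml//; apply: eq_big_nat => i /andP[_ ilt].
  by rewrite ipZl// ipC ipse ilt expr2.
have bes n : \sum_(0 <= i < n) c i ^+ 2 <= sqn f.
  by have := sqn_ge0 (fun x => f x - s n x); rewrite sqnB// ipfs ss; lra.
have ndS : nondecreasing_seq (fun n => \sum_(0 <= i < n) c i ^+ 2).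
  by apply/nondecreasing_seqP => n; rewrite big_nat_recr//= lerDl sqr_ge0.
have cS : cvgn (fun n => \sum_(0 <= i < n) c i ^+ 2).
  apply: nondecreasing_is_cvgn => //; exists (sqn f) => _ [n _ <-]; exact: bes.
have sB m n : (m <= n)%N -> sqn (fun x => s n x - s m x) =
    \sum_(0 <= i < n) c i ^+ 2 - \sum_(0 <= i < m) c i ^+ 2.
  move=> mn; rewrite sqnB// !ss.
  have -> : inner2 (s n) (s m) = \sum_(0 <= i < m) c i ^+ 2.
    rewrite ipC ip_suml//; apply: eq_big_nat => i /andP[_ im].
    by rewrite ipZl// ipC ipse (leq_trans im mn) expr2.
  ring.
have [|t Lt st] := @L2_complete _ s Ls.
  move=> eps eps0.
  have [N _ NP] := (cvgrPdist_le _ _).1 cS eps eps0.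
  have main m n : (N <= m)%N -> (m <= n)%N -> sqn (fun x => s n x - s m x) <= eps.
    move=> Nm mn; rewrite sB//.
    have := NP m Nm; have := nondecreasing_cvgn_le ndS cS n.
    have := nondecreasing_cvgn_le ndS cS m => h1 h2.
    by rewrite ger0_norm ?subr_ge0//; apply: le_trans; rewrite lerD2r.
  exists N => m n Nm Nn; have [mn|nm] := leqP m n; first by rewrite sqnBC main.
  by apply: main => //; exact: ltnW.
have fs : L2cvg (fun=> f) f.
  rewrite /L2cvg (_ : (fun _ => _) = fun=> 0); first exact: cvg_cst.
  apply/funext => _; rewrite sqnB// ipxx; ring.
have te j : inner2 t (e j) = c j.
  have h1 : inner2 (s n) (e j) @[n --> \oo] --> inner2 t (e j).
    apply: (ip_cvg Ls (fun=> Le j) Lt (Le j) st).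
    rewrite /L2cvg (_ : (fun _ => _) = fun=> 0); first exact: cvg_cst.
    by apply/funext => _; rewrite sqnB// ipxx; ring.
  apply: (cvg_unique _ h1); first exact: Rhausdorff.
  by apply: cvg_near_cst; exists j.+1 => //= n jn; rewrite ipse jn.
have h0 : inner2 (fun x => f x - t x) f = 0.
  by apply: tot => [|n]; [exact: L2B|rewrite ipBl// te subrr].
rewrite (_ : sqn f = inner2 f t); last first.
  by move: h0; rewrite ipBl// ipxx (ipC t) => /eqP; rewrite subr_eq0 => /eqP.
by under eq_fun do rewrite -ipfs; exact: ip_cvg.
Qed.

End parseval.

(** * Fejer kernels *)

Section fejer.
Context {R : realType}.
Local Notation mu := (@lebesgue_measure R).
Implicit Types f g h : R -> R.
Implicit Types (N : nat) (b x y t theta : R).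

Let csum N theta : R := \sum_(0 <= j < N) cos (j%:R * theta).
Let ssum N theta : R := \sum_(0 <= j < N) sin (j%:R * theta).

(** The squared modulus of 1 + z + .. + z^(N - 1) divided by N, at z = exp
    (2 i pi t). *)
Definition fejer N t : R :=
  N%:R^-1 * (csum N (2 * pi * t) ^+ 2 + ssum N (2 * pi * t) ^+ 2).

(** Real and imaginary part of (e^(i theta) - 1) (1 + e^(i theta) + .. +
    e^(i (N - 1) theta)) = e^(i N theta) - 1. *)
Lemma dirichlet_telescope N theta :
  csum N theta * (cos theta - 1) - ssum N theta * sin theta = cos (N%:R * theta) - 1 /\
  csum N theta * sin theta + ssum N theta * (cos theta - 1) = sin (N%:R * theta).
Proof.
elim: N => [|N [ih1 ih2]].
  by rewrite /csum /ssum !big_nil !mul0r cos0 sin0 !subrr addr0.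
rewrite /csum /ssum !big_nat_recr//= -/(csum N theta) -/(ssum N theta).
have -> : N.+1%:R * theta = N%:R * theta + theta by rewrite -natr1; ring.
rewrite cosD sinD; split.
  transitivity (cos (N%:R * theta) - 1 + (cos (N%:R * theta) * (cos theta - 1) -
    sin (N%:R * theta) * sin theta)); last by ring.
  by rewrite -ih1; ring.
transitivity (sin (N%:R * theta) + (cos (N%:R * theta) * sin theta +
  sin (N%:R * theta) * (cos theta - 1))); last by ring.
by rewrite -ih2; ring.
Qed.

Lemma dirichlet_sq N theta : (csum N theta ^+ 2 + ssum N theta ^+ 2) *
  (2 - 2 * cos theta) = 2 - 2 * cos (N%:R * theta).
Proof.
have [h1 h2] := dirichlet_telescope N theta.
have e1 := cos2Dsin2 theta; have e2 := cos2Dsin2 (N%:R * theta).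
transitivity ((csum N theta * (cos theta - 1) - ssum N theta * sin theta) ^+ 2 +
  (csum N theta * sin theta + ssum N theta * (cos theta - 1)) ^+ 2).
  transitivity ((csum N theta ^+ 2 + ssum N theta ^+ 2) *
     (1 - 2 * cos theta + (cos theta ^+ 2 + sin theta ^+ 2))); last by ring.
  by rewrite e1; ring.
rewrite h1 h2; transitivity (1 - 2 * cos (N%:R * theta) +
  (cos (N%:R * theta) ^+ 2 + sin (N%:R * theta) ^+ 2)); first by ring.
by rewrite e2; ring.
Qed.

Lemma fejer_ge0 N t : 0 <= fejer N t.
Proof. by rewrite mulr_ge0// ?invr_ge0// addr_ge0// sqr_ge0. Qed.

Lemma fejerE N t : fejer N t = \sum_(0 <= j < N) \sum_(0 <= k < N)
  N%:R^-1 * cos (2 * pi * (j%:Z - k%:Z)%:~R * t).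
Proof.
rewrite /fejer !expr2 /csum /ssum !big_distrlr/= -big_split/= mulr_sumr.
apply: eq_bigr => j _; rewrite -big_split/= mulr_sumr; apply: eq_bigr => k _.
congr (_ * _); rewrite -cosB; congr cos; rewrite intrB/=; ring.
Qed.

Lemma cos_far (d t : R) : 0 < d -> d <= t -> t <= 1 - d ->
  cos (2 * pi * t) <= cos (2 * pi * d).
Proof.
move=> d0 dt td.
have pi0 := pi_gt0 R.
have h (u : R) : d <= u -> u <= 2^-1 -> cos (2 * pi * u) <= cos (2 * pi * d).
  rewrite le_eqVlt => /predU1P[->//|du] u2; apply/ltW.
  rewrite ltr_cos ?in_itv/=.
  - by rewrite ltr_pM2l// mulr_gt0.
  - by apply/andP; split; nra.
  - by apply/andP; split; nra.
have [t2|t2] := leP t 2^-1; first exact: h.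
have -> : cos (2 * pi * t) = cos (2 * pi * (1 - t)).
  rewrite -[LHS]cosN -[in LHS](cosD2pi (- (2 * pi * t))); congr cos.
  by rewrite -[pi *+ 2]mulr_natl; ring.
by apply: h; lra.
Qed.

Lemma cos_lt1 (d : R) : 0 < d -> d <= 2^-1 -> cos (2 * pi * d) < 1.
Proof.
move=> d0 d2; have pi0 := pi_gt0 R.
rewrite -[ltRHS](@cos0 R) ltr_cos ?in_itv/= ?lexx ?(ltW pi0)//.
  by rewrite !mulr_gt0.
by apply/andP; split; [rewrite !mulr_ge0 ?(ltW pi0) ?ltW|nra].
Qed.

(** The numerator of the Fejer kernel is bounded, and its denominator is
    bounded below away from the integers. *)
Lemma fejer_far N (d t : R) : 0 < d -> d <= `|t| -> `|t| <= 1 - d ->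
  fejer N t <= N%:R^-1 * (4 / (2 - 2 * cos (2 * pi * d))).
Proof.
move=> d0 dt td.
have cd : cos (2 * pi * `|t|) <= cos (2 * pi * d) by exact: cos_far.
have c1 : cos (2 * pi * d) < 1 by apply: cos_lt1 => //; lra.
have ct : cos (2 * pi * `|t|) = cos (2 * pi * t).
  by case: (ger0P t) => _ //; rewrite mulrN cosN.
rewrite /fejer ler_wpM2l ?invr_ge0//.
rewrite ler_pdivlMr; last by lra.
apply: (@le_trans _ _ ((csum N (2 * pi * t) ^+ 2 + ssum N (2 * pi * t) ^+ 2) *
   (2 - 2 * cos (2 * pi * t)))).
  by rewrite ler_wpM2l ?addr_ge0 ?sqr_ge0//; lra.
rewrite dirichlet_sq; have := cos_geN1 (N%:R * (2 * pi * t)); lra.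
Qed.

Lemma continuous_sum (T : Type) (s : seq T) (F : T -> R -> R) :
  (forall i, continuous (F i)) -> continuous (fun x => \sum_(i <- s) F i x).
Proof.
move=> cF; elim: s => [|i s ih] x.
  by under eq_fun do rewrite big_nil; exact: cvg_cst.
rewrite (_ : (fun x0 => _) = (fun x0 => F i x0 + \sum_(j <- s) F j x0)).
  by apply: cvgD; [exact: cF|exact: ih].
by apply/funext => y; rewrite big_cons.
Qed.

Lemma continuous_fejer N x : continuous (fun y => fejer N (x - y)).
Proof.
rewrite (_ : (fun y => _) = (fun y => \sum_(0 <= j < N) \sum_(0 <= k < N)
  N%:R^-1 * cos (2 * pi * (j%:Z - k%:Z)%:~R * (x - y)))).
  apply: continuous_sum => j; apply: continuous_sum => k y.
  apply: cvgM; first exact: cvg_cst.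
  have := @continuous_cosM R (- (2 * pi * (j%:Z - k%:Z)%:~R)) (2 * pi * (j%:Z - k%:Z)%:~R * x) y.
  rewrite (_ : (fun x0 => _) = fun y0 => cos (2 * pi * (j%:Z - k%:Z)%:~R * (x - y0)))//.
  by apply/funext => z; congr cos; ring.
by apply/funext => y; exact: fejerE.
Qed.

Definition fejer_step N b x : R := \int[mu]_y (fejer N (x - y) * \1_(`[0, b[) y).

(** Averages against the Fejer kernel are trigonometric polynomials. *)
Lemma fejer_stepE N b x : fejer_step N b x =
  \sum_(0 <= j < N) \sum_(0 <= k < N) N%:R^-1 *
   (cos (2 * pi * x * (j%:Z - k%:Z)%:~R) *
      \int[mu]_y (cos (2 * pi * (j%:Z - k%:Z)%:~R * y + 0) * \1_(`[0, b[) y) +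
    sin (2 * pi * x * (j%:Z - k%:Z)%:~R) *
      \int[mu]_y (sin (2 * pi * (j%:Z - k%:Z)%:~R * y + 0) * \1_(`[0, b[) y)).
Proof.
have ic (n : int) : intble (fun y => cos (2 * pi * n%:~R * y + 0) * \1_(`[0, b[) y).
  by apply: intble_cont_itv; exact: continuous_cosM.
have isn (n : int) : intble (fun y => sin (2 * pi * n%:~R * y + 0) * \1_(`[0, b[) y).
  by apply: intble_cont_itv; exact: continuous_sinM.
pose F (j k : nat) y : R := N%:R^-1 *
  (cos (2 * pi * x * (j%:Z - k%:Z)%:~R) * (cos (2 * pi * (j%:Z - k%:Z)%:~R * y + 0) * \1_(`[0, b[) y) +
   sin (2 * pi * x * (j%:Z - k%:Z)%:~R) * (sin (2 * pi * (j%:Z - k%:Z)%:~R * y + 0) * \1_(`[0, b[) y)).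
have iF j k : intble (F j k).
  by apply: intbleZ; apply: intbleD; apply: intbleZ.
transitivity (\int[mu]_y (\sum_(0 <= j < N) \sum_(0 <= k < N) F j k y)).
  apply: eq_Rintegral => y _; rewrite fejerE mulr_suml; apply: eq_bigr => j _.
  rewrite mulr_suml; apply: eq_bigr => k _.
  rewrite (_ : 2 * pi * (j%:Z - k%:Z)%:~R * (x - y) =
    2 * pi * x * (j%:Z - k%:Z)%:~R - 2 * pi * (j%:Z - k%:Z)%:~R * y); last by ring.
  by rewrite cosB /F !addr0; ring.
rewrite I_sum => [|j]; last exact: intble_sum.
apply: eq_bigr => j _; rewrite I_sum//; apply: eq_bigr => k _.
rewrite IZ; last by apply: intbleD; apply: intbleZ.
by rewrite ID; [rewrite !IZ|apply: intbleZ|apply: intbleZ].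
Qed.

Lemma fejer_step1 N x : (0 < N)%N -> fejer_step N 1 x = 1.
Proof.
move=> N0; rewrite fejer_stepE.
under eq_bigr => j _ do under eq_bigr => k _ do
  rewrite I01_cos I01_sin cos0 sin0 mul0r mulr0 addr0 mul1r subr_eq0 eqz_nat.
rewrite (eq_big_nat _ _ (F2 := fun=> N%:R^-1)); last first.
  move=> j /andP[_ jN]; rewrite (bigD1_seq j)//= ?mem_index_iota ?iota_uniq//.
  rewrite eqxx mulr1 subrr mulr0 cos0 mulr1 big1 ?addr0// => k.
  by rewrite eq_sym => /negbTE ->; rewrite !mulr0.
rewrite sumr_const_nat subn0 -[RHS](@mulVf _ N%:R) ?pnatr_eq0 ?gt_eqF//.
by rewrite mulr_natr.
Qed.

Lemma intble_fejer N x (a c : R) : intble (fun y => fejer N (x - y) * \1_(`[a, c[) y).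
Proof. by apply: intble_cont_itv; exact: continuous_fejer. Qed.

Lemma fejer_step_compl N b x : (0 < N)%N -> 0 < b <= 1 ->
  fejer_step N b x + \int[mu]_y (fejer N (x - y) * \1_(`[b, 1[) y) = 1.
Proof.
move=> N0 /andP[b0 b1]; rewrite -[RHS](fejer_step1 x N0) /fejer_step -ID; try exact: intble_fejer.
apply: eq_Rintegral => y _; rewrite -mulrDr; congr (_ * _).
rewrite !indicE !mem_setE/= !in_itv/=.
by do ! case: ltP => ? //=; do ?[by rewrite ?addr0 ?add0r]; lra.
Qed.

Lemma fejer_far_integral N (a c d x : R) : 0 < d -> 0 <= a -> a < c -> c <= 1 ->
  (forall y, a <= y -> y < c -> d <= `|x - y| <= 1 - d) ->
  `|\int[mu]_y (fejer N (x - y) * \1_(`[a, c[) y)| <=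
    N%:R^-1 * (4 / (2 - 2 * cos (2 * pi * d))).
Proof.
move=> d0 a0 ac c1 hd; set K := _ * (4 / _).
have K0 : 0 <= K.
  have /andP[h1 h2] := hd a (lexx _) ac.
  exact: le_trans (fejer_ge0 N _) (fejer_far _ d0 h1 h2).
rewrite ger0_norm; last first.
  by apply: I_ge0 => y; rewrite mulr_ge0// ?fejer_ge0// indicE.
apply: (@le_trans _ _ (\int[mu]_y (cst K y * \1_(`[a, c[) y))).
  apply: le_I; first exact: intble_fejer.
    by apply: intble_cont_itv => y; exact: cvg_cst.
  move=> y; rewrite indicE; case: (boolP (y \in `[a, c[%classic)); last by rewrite !mulr0.
  rewrite inE/= in_itv/= !mulr1 => /andP[h1 h2]; have /andP[h3 h4] := hd y h1 h2.
  exact: fejer_far.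
have dF y : is_derive y (1:R) (fun x => K * x) (cst K y).
  by have := is_deriveZ K (is_derive_id y (1:R)); rewrite /GRing.scale/= mulr1.
rewrite (I_FTC ac _ dF); last by move=> y; exact: cvg_cst.
by rewrite -mulrBr ler_piMr//; lra.
Qed.

Lemma cvg_invn_mul (K : R) : n%:R^-1 * K @[n --> \oo] --> 0.
Proof.
rewrite -(mul0r K); apply: cvgM; last exact: cvg_cst.
apply/cvgrPdist_le => e e0; near=> n.
rewrite sub0r normrN ger0_norm ?invr_ge0//.
rewrite -[leRHS]invrK lef_pV2 ?posrE ?invr_gt0//.
- near: n; exact: nbhs_infty_ger.
- rewrite ltr0n; near: n; exact: nbhs_infty_gt.
Unshelve. all: by end_near. Qed.

(** The mass of the kernel concentrates at the point x, which is inside or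
    outside of the interval. *)
Lemma cvg_fejer_step b x : 0 < b <= 1 -> 0 < x < 1 -> x != b ->
  fejer_step n.+1 b x @[n --> \oo] --> (\1_(`[0, b[) x : R).
Proof.
move=> /andP[b0 b1] /andP[x0 x1] xb.
pose d := Num.min `|x - b| (Num.min x (1 - x)).
have d0 : 0 < d by rewrite !lt_min normr_gt0 subr_eq0 xb x0/= subr_gt0.
have [dxb [dx d1x]] : d <= `|x - b| /\ d <= x /\ d <= 1 - x.
  by rewrite /d !ge_min !lexx !orbT.
have K := cvg_invn_mul (4 / (2 - 2 * cos (2 * pi * d))).
pose u (n : nat) : R := n%:R^-1 * (4 / (2 - 2 * cos (2 * pi * d))).
have KS : u n.+1 @[n --> \oo] --> (0 : R) by rewrite (cvg_shiftS u).
case: (ltgtP x b) xb => // xb _.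
- rewrite indicE mem_set/=; last by rewrite in_itv/= ltW.
  apply/subr_cvg0/norm_cvg0P.
  apply: (squeeze_cvgr _ (cvg_cst 0) KS); apply: nearW => n.
  rewrite normr_ge0/= -(fejer_step_compl x (ltn0Sn n) (introT andP (conj b0 b1))).
  rewrite opprD addrA subrr add0r normrN.
  have [->|b1'] := eqVneq b 1.
    under eq_Rintegral do rewrite set_itv_ge ?bnd_simp ?ltxx// indic0 mulr0.
    rewrite /Rintegral integral0 normr0 mulr_ge0 ?invr_ge0// divr_ge0//.
  apply: fejer_far_integral; rewrite ?(ltW b0)//; first by rewrite lt_neqAle b1' b1.
  move=> y by_ y1; rewrite distrC ger0_norm; last by lra.
  by rewrite distrC ger0_norm in dxb; lra.
- rewrite indicE memNset/=; last by rewrite in_itv/= => /andP[_]; rewrite ltNge ltW.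
  apply/norm_cvg0P.
  apply: (squeeze_cvgr _ (cvg_cst 0) KS); apply: nearW => n.
  rewrite normr_ge0/=; apply: fejer_far_integral => //.
  move=> y y0 yb; rewrite ger0_norm; last by lra.
  by rewrite ger0_norm in dxb; lra.
Qed.

Lemma fejer_step_le1 N b x : (0 < N)%N -> 0 < b <= 1 -> `|fejer_step N b x| <= 1.
Proof.
move=> N0 b01; have h0 (a c : R) : 0 <= \int[mu]_y (fejer N (x - y) * \1_(`[a, c[) y).
  by apply: I_ge0 => y; rewrite mulr_ge0// ?fejer_ge0// indicE.
rewrite ger0_norm; last exact: h0.
by have := fejer_step_compl x N0 b01; have := h0 b 1; lra.
Qed.

(** A function orthogonal to the system is orthogonal to the Fejer averages
    of the indicator of [0, b[, which are trigonometric polynomials bounded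
    by 1 and converging to that indicator; so its primitive vanishes. *)
Lemma circle_total g : L2 g -> (forall n, inner2 g (circle n) = 0) ->
  {ae mu, forall x, 0 < x < 1 -> g x = 0}.
Proof.
move=> Lg g0.
pose G x := g x * \1_(`[0, 1[) x.
have iG : intble G by exact: L2_intble_itv.
have iGM f : measurable_fun setT f -> (forall x, `|f x| <= 1) -> intble (fun x => f x * G x).
  by move=> mf f1; exact: (intble_bounded mf f1).
have mcos (c : R) : measurable_fun setT (fun x => cos (2 * pi * x * c)).
  apply: continuous_measurable_fun; have := @continuous_cosM R (2 * pi * c) 0.
  by under eq_fun do rewrite addr0 mulrAC.
have msin (c : R) : measurable_fun setT (fun x => sin (2 * pi * x * c)).
  apply: continuous_measurable_fun; have := @continuous_sinM R (2 * pi * c) 0.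
  by under eq_fun do rewrite addr0 mulrAC.
have icos (n : int) : intble (fun x => cos (2 * pi * x * n%:~R) * G x).
  by apply: iGM => // x; exact: cos_max.
have isin (n : int) : intble (fun x => sin (2 * pi * x * n%:~R) * G x).
  by apply: iGM => // x; exact: sin_max.
have E (n : int) : \int[mu]_x (cos (2 * pi * x * n%:~R) * G x) +
    \int[mu]_x (sin (2 * pi * x * n%:~R) * G x) = 0.
  rewrite -ID// -[RHS](g0 n); apply: eq_Rintegral => x _.
  by rewrite /G /circle /cas; ring.
(* Comparing the frequencies n and - n separates cosines from sines. *)
have C0 (n : int) : \int[mu]_x (cos (2 * pi * x * n%:~R) * G x) = 0.
  have := E n; have := E (- n).
  under eq_Rintegral do rewrite mulrNz mulrN cosN.
  under [X in _ + X = _ -> _]eq_Rintegral do rewrite mulrNz mulrN sinN mulNr.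
  by rewrite IN//; lra.
have S0 (n : int) : \int[mu]_x (sin (2 * pi * x * n%:~R) * G x) = 0.
  by have := E n; rewrite C0 add0r.
apply: (@I_initial_eq0 _ g 1) => // b /andP[b0 b1].
have b01 : 0 < b <= 1 by rewrite b0 ltW.
have stp0 N : \int[mu]_x (fejer_step N b x * G x) = 0.
  under eq_Rintegral do rewrite fejer_stepE.
  pose A (n : int) := \int[mu]_y (cos (2 * pi * n%:~R * y + 0) * \1_(`[0, b[) y).
  pose B (n : int) := \int[mu]_y (sin (2 * pi * n%:~R * y + 0) * \1_(`[0, b[) y).
  pose F (j k : nat) x : R := N%:R^-1 *
   (A (j%:Z - k%:Z) * (cos (2 * pi * x * (j%:Z - k%:Z)%:~R) * G x) +
    B (j%:Z - k%:Z) * (sin (2 * pi * x * (j%:Z - k%:Z)%:~R) * G x)).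
  have iF j k : intble (F j k).
    by apply: intbleZ; apply: intbleD; apply: intbleZ.
  transitivity (\int[mu]_y (\sum_(0 <= j < N) \sum_(0 <= k < N) F j k y)).
    apply: eq_Rintegral => x _; rewrite mulr_suml; apply: eq_bigr => j _.
    rewrite mulr_suml; apply: eq_bigr => k _.
    by rewrite /F -/(A _) -/(B _); ring.
  rewrite I_sum => [|j]; last exact: intble_sum.
  rewrite big1// => j _; rewrite I_sum//; rewrite big1// => k _.
  rewrite IZ; last by apply: intbleD; apply: intbleZ.
  rewrite ID; [|by apply: intbleZ|by apply: intbleZ].
  by rewrite !IZ// C0 S0 !mulr0 addr0 mulr0.
have mstp N : measurable_fun setT (fejer_step N b).
  rewrite (funext (fejer_stepE N b)).
  apply: measurable_sum => j; apply: measurable_sum => k.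
  by apply: measurable_funM => //; apply: measurable_funD; apply: measurable_funM.
have [] := @dominated_convergence _ _ _ mu setT measurableT
  (fun n x => (fejer_step n.+1 b x * G x)%:E) (fun x => (g x * \1_(`[0, b[) x)%:E)
  (fun x => `|G x|%:E).
- by move=> n; apply: measurable_int; apply: iGM => // x; exact: fejer_step_le1.
- exact: measurable_int (L2_intble_itv 0 b Lg).
(* At the jumps 0 and b of the indicator there is no convergence to it. *)
- exists ([set 0] `|` [set b]); split.
  + by apply: measurableU; exact: measurable_set1.
  + by rewrite null_set_setU//; exact: lebesgue_measure_set1.
  + move=> x /=; apply: contra_notP => /not_orP[x0 xb] _.
    apply: cvg_EFin; first exact: nearW.
    case: (boolP (x \in `[0, 1[%classic)) => x01; last first.
      rewrite (_ : _ \o _ = fun=> 0); last first.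
        by apply/funext => n; rewrite /= /G indicE (negbTE x01) !mulr0.
      rewrite (_ : g x * _ = 0); first exact: cvg_cst.
      rewrite indicE memNset ?mulr0//= in_itv/= => /andP[h1 h2].
      by move: x01; rewrite mem_set//= in_itv/= h1 (lt_trans h2).
    have -> : g x * \1_(`[0, b[) x = \1_(`[0, b[) x * G x.
      rewrite /G mulrC; congr (_ * _).
      by rewrite indicE x01 mulr1.
    apply: cvgM; last exact: cvg_cst.
    move: x01; rewrite inE/= in_itv/= => /andP[h1 h2].
    apply: cvg_fejer_step => //; last exact/eqP.
    by rewrite h2 andbT lt_neqAle h1 andbT eq_sym; exact/eqP.
- exact: (intble_abs iG).
- apply: aeW => x n _; rewrite /= lee_fin normrM.
  by rewrite ler_piMl//; exact: fejer_step_le1.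
move=> _ _ h; apply: EFin_inj; rewrite EFin_I; last exact: L2_intble_itv.
rewrite -(cvg_lim _ h)//; apply: cvg_lim => //.
rewrite (_ : [sequence _]_n = fun=> 0%E); first exact: cvg_cst.
apply/funext => n /=; rewrite -EFin_I ?stp0//.
by apply: iGM => // x; exact: fejer_step_le1.
Qed.

End fejer.

(** * Parseval on the circle *)

Section sums_over_integers.
Context {R : realType}.
Local Notation mu := (@lebesgue_measure R).
Local Open Scope ereal_scope.
Implicit Types (a b : int -> \bar R).

(** 0, -1, 1, -2, 2, .. : the integers as a sequence, so that sums over the
    integers become series. *)
Definition int_enum (k : nat) : int := if odd k then Negz k./2 else Posz k./2.

Lemma int_enum_bij : set_bij [set: nat] [set: int] int_enum.
Proof.
split => //.
- move=> j k _ _; rewrite /int_enum.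
  case: (boolP (odd j)); case: (boolP (odd k)) => ok oj // [e];
  by rewrite -(odd_double_half j) -(odd_double_half k) e ?(negbTE oj) ?(negbTE ok) ?oj ?ok.
- move=> [k|k] _; [exists k.*2|exists k.*2.+1] => //; rewrite /int_enum/= odd_double/=.
    by rewrite doubleK.
  by rewrite uphalf_double.
Qed.

Lemma esum_int a : (forall n, 0 <= a n) ->
  \esum_(n in [set: int]) a n = \sum_(k <oo) a (int_enum k).
Proof.
move=> a0; rewrite (reindex_esum _ _ _ _ int_enum_bij).
by rewrite -nneseries_esumT// => k; exact: a0.
Qed.

Lemma opp_bij : set_bij [set: int] [set: int] (-%R : int -> int).
Proof.
split => //.
Qed.

Lemma shift_bij (k : int) : set_bij [set: int] [set: int] (fun n : int => (n + k)%R).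
Proof.
split => //; first by move=> x y _ _ /addIr.
by move=> x _; exists (x - k)%R => //; rewrite subrK.
Qed.

Lemma esum_int_opp a : \esum_(n in [set: int]) a (- n)%R = \esum_(n in [set: int]) a n.
Proof. by rewrite [RHS](reindex_esum _ _ _ _ opp_bij). Qed.

Lemma esum_int_shift a (k : int) :
  \esum_(n in [set: int]) a (n + k)%R = \esum_(n in [set: int]) a n.
Proof. by rewrite [RHS](reindex_esum _ _ _ _ (shift_bij k)). Qed.

(** A sum over the integers is invariant under n -> - n, hence depends only
    on the even part of the family. *)
Lemma esum_even_part a b : (forall n, 0 <= a n) -> (forall n, 0 <= b n) ->
  (forall n, a n + a (- n)%R = b n + b (- n)%R) ->
  \esum_(n in [set: int]) a n = \esum_(n in [set: int]) b n.
Proof.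
move=> a0 b0 ab.
have h : \esum_(n in [set: int]) a n + \esum_(n in [set: int]) a n =
    \esum_(n in [set: int]) b n + \esum_(n in [set: int]) b n.
  rewrite -[X in _ + X = _]esum_int_opp -[X in _ = _ + X]esum_int_opp -!esumD//.
  by apply: eq_esum => n _; exact: ab.
have A0 : 0 <= \esum_(n in [set: int]) a n by exact: esum_ge0.
have B0 : 0 <= \esum_(n in [set: int]) b n by exact: esum_ge0.
move: h A0 B0; case: (esum _ a) => [x| |]; case: (esum _ b) => [y| |] //.
by rewrite -!EFinD => -[] h _ _; congr EFin; lra.
Qed.

Lemma esum_intZl (c : R) a : (0 <= c)%R -> (forall n, 0 <= a n) ->
  \esum_(n in [set: int]) (c%:E * a n) = c%:E * \esum_(n in [set: int]) a n.
Proof.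
move=> c0 a0; rewrite !esum_int//; last by move=> n; rewrite mule_ge0.
by rewrite nneseriesZl.
Qed.

End sums_over_integers.

Section fourier_real.
Context {R : realType}.
Local Notation mu := (@lebesgue_measure R).
Implicit Types f g h : R -> R.

(** The cosine and the sine transform: the Fourier transform of f is FC f -
    i FS f. *)
Definition FC f (xi : R) : R := \int[mu]_x (f x * cos (2 * pi * x * xi)).
Definition FS f (xi : R) : R := \int[mu]_x (f x * sin (2 * pi * x * xi)).

(** The squared modulus of the Fourier transform. *)
Definition FQ f (xi : R) : R := FC f xi ^+ 2 + FS f xi ^+ 2.

Lemma FQ_ge0 f xi : 0 <= FQ f xi.
Proof. by rewrite addr_ge0// sqr_ge0. Qed.

Lemma measurable_cosM (c : R) : measurable_fun setT (fun x => cos (2 * pi * x * c)).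
Proof.
apply: continuous_measurable_fun; have := @continuous_cosM R (2 * pi * c) 0.
by under eq_fun do rewrite addr0 mulrAC.
Qed.

Lemma measurable_sinM (c : R) : measurable_fun setT (fun x => sin (2 * pi * x * c)).
Proof.
apply: continuous_measurable_fun; have := @continuous_sinM R (2 * pi * c) 0.
by under eq_fun do rewrite addr0 mulrAC.
Qed.

Lemma intble_cos f (c : R) : intble f -> intble (fun x => f x * cos (2 * pi * x * c)).
Proof.
move=> fi; under eq_fun do rewrite mulrC.
by apply: (intble_bounded (measurable_cosM c) _ fi) => x; exact: cos_max.
Qed.

Lemma intble_sin f (c : R) : intble f -> intble (fun x => f x * sin (2 * pi * x * c)).
Proof.
move=> fi; under eq_fun do rewrite mulrC.
by apply: (intble_bounded (measurable_sinM c) _ fi) => x; exact: sin_max.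
Qed.

Lemma L2_cos f (c : R) : L2 f -> L2 (fun x => f x * cos (2 * pi * x * c)).
Proof.
move=> fi; under eq_fun do rewrite mulrC.
by apply: (L2_bounded (measurable_cosM c) _ fi) => x; exact: cos_max.
Qed.

Lemma L2_sin f (c : R) : L2 f -> L2 (fun x => f x * sin (2 * pi * x * c)).
Proof.
move=> fi; under eq_fun do rewrite mulrC.
by apply: (L2_bounded (measurable_sinM c) _ fi) => x; exact: sin_max.
Qed.

Lemma FCN f xi : FC f (- xi) = FC f xi.
Proof. by apply: eq_Rintegral => x _; rewrite mulrN cosN. Qed.

Lemma FSN f xi : intble f -> FS f (- xi) = - FS f xi.
Proof.
move=> fi; rewrite /FS -IN; last exact: intble_sin.
by apply: eq_Rintegral => x _; rewrite mulrN sinN mulrN.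
Qed.

Lemma continuous_under f (k : R -> R -> R) : intble f ->
  (forall l x, `|k l x| <= 1) -> (forall x, continuous (k ^~ x)) ->
  (forall l, measurable_fun setT (k l)) ->
  continuous (fun l => \int[mu]_x (f x * k l x)).
Proof.
move=> fi k1 ck mk a.
have := @continuity_under_integral R _ _ mu (fun l x => f x * k l x) setT measurableT
  (a - 1) (a + 1).
move=> /(_ _ _ (fun x => `|f x|) _ _ a); apply.
- move=> l _; apply: (intble_le _ _ fi).
    by apply: measurable_funM => //; exact: intble_meas.
  by move=> x; rewrite normrM ler_piMr.
- apply: aeW => x _ l _; apply: cvgM; first exact: cvg_cst.
  exact: ck.
- exact: intble_abs.
- by move=> l _; apply: aeW => x _; rewrite normrM ler_piMr.
- by rewrite inE/= in_itv/=; apply/andP; split; lra.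
Qed.

Lemma continuous_FC f : intble f -> continuous (FC f).
Proof.
move=> fi; apply: (@continuous_under f (fun l x => cos (2 * pi * x * l))) => //.
- by move=> l x; exact: cos_max.
- move=> x; have := @continuous_cosM R (2 * pi * x) 0.
  by under eq_fun do rewrite addr0.
- by move=> l; exact: measurable_cosM.
Qed.

Lemma continuous_FS f : intble f -> continuous (FS f).
Proof.
move=> fi; apply: (@continuous_under f (fun l x => sin (2 * pi * x * l))) => //.
- by move=> l x; exact: sin_max.
- move=> x; have := @continuous_sinM R (2 * pi * x) 0.
  by under eq_fun do rewrite addr0.
- by move=> l; exact: measurable_sinM.
Qed.

Lemma measurable_FC f : intble f -> measurable_fun setT (FC f).
Proof. by move=> /continuous_FC; exact: continuous_measurable_fun. Qed.

Lemma measurable_FS f : intble f -> measurable_fun setT (FS f).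
Proof. by move=> /continuous_FS; exact: continuous_measurable_fun. Qed.

Lemma measurable_FQ f : intble f -> measurable_fun setT (FQ f).
Proof.
move=> fi; apply: measurable_funD; apply: measurable_funX.
  exact: measurable_FC.
exact: measurable_FS.
Qed.

Definition supported (A : set R) f := forall x, ~ A x -> f x = 0.

Lemma supportedE (A : set R) f : supported A f -> (fun x => f x * \1_A x) = f.
Proof.
move=> sf; apply/funext => x; rewrite indicE; case: (boolP (x \in A)) => xA.
  by rewrite mulr1.
by rewrite mulr0 sf// => /mem_set; exact/negP.
Qed.

Lemma supported_indic (A : set R) f : supported A (fun x => f x * \1_A x).
Proof. by move=> x nA; rewrite indicE memNset// mulr0. Qed.

Lemma intble_supported f (a b : R) : L2 f -> supported `[a, b[ f -> intble f.
Proof. by move=> Lf sf; rewrite -(supportedE sf); exact: L2_intble_itv. Qed.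

Lemma inner2_circle f (n : int) : intble f -> supported `[0, 1[ f ->
  inner2 f (circle n) = FC f n%:~R + FS f n%:~R.
Proof.
move=> fi sf; rewrite /FC /FS -ID; [|exact: intble_cos|exact: intble_sin].
apply: eq_Rintegral => x _; rewrite -[in RHS](supportedE sf) /circle /cas.
ring.
Qed.

(** The coefficients of f on the real system are FC f n + FS f n, whose
    squares have the same even part as FQ f n. *)
Lemma parseval_circle f : L2 f -> supported `[0, 1[ f ->
  \esum_(n in [set: int]) (FQ f n%:~R)%:E = (sqn f)%:E.
Proof.
move=> Lf sf; have fi := intble_supported Lf sf.
rewrite -(@esum_even_part _ (fun n => (inner2 f (circle n) ^+ 2)%:E)); last 3 first.
- by move=> n; rewrite lee_fin sqr_ge0.
- by move=> n; rewrite lee_fin FQ_ge0.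
- move=> n; rewrite !inner2_circle// /FQ mulrNz FCN FSN//.
  by rewrite -!EFinD; congr EFin; ring.
rewrite esum_int => [|n]; last by rewrite lee_fin sqr_ge0.
have := @parseval_nat R (fun k => circle (int_enum k)) f.
move=> /(_ _ _ Lf); rewrite -/(sqn f) => h.
have {}h : \sum_(0 <= i < n) inner2 f (circle (int_enum i)) ^+ 2 @[n --> \oo] --> sqn f.
  apply: h.
  - by move=> k; exact: L2_circle.
  - move=> i j; rewrite circle_orthonormal.
    suff -> : (int_enum i == int_enum j) = (i == j) by [].
    have [_ inj _] := int_enum_bij.
    have [->|ij] := eqVneq i j; first by rewrite eqxx.
    by apply/negbTE; apply: contra_neq ij => e; apply: inj e; rewrite inE.
  - move=> g Lg g0.
    have gc n : inner2 g (circle n) = 0.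
      have [_ _ surj] := int_enum_bij.
      by have [k _ <-] := surj n I; exact: g0.
    have g01 := circle_total Lg gc.
    rewrite /inner2 /Rintegral (_ : \int[mu]_x _ = 0)%E//.
    transitivity (\int[mu]_x (cst 0%E x))%E; last by rewrite integral0.
    apply: ae_eq_integral => //.
    + exact: measurable_int (L2M Lg Lf).
    + have g02 : {ae mu, forall x, x != 0}.
        exists [set 0]; split => //; first exact: lebesgue_measure_set1.
        by move=> x /= /negP; rewrite negbK => /eqP.
      apply: ae_mono (ae_and g01 g02) => x [gx x0] _ /=.
      have [x1|x1] := boolP (0 < x < 1); first by rewrite gx// mul0r.
      rewrite sf ?mulr0//= in_itv/= => /andP[h1 h2].
      by move: x1; rewrite h2 lt_neqAle eq_sym x0 h1.
apply/cvg_lim => //; under eq_fun do rewrite sumEFin.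
by apply: cvg_EFin; [exact: nearW|exact: h].
Qed.

End fourier_real.

(** * Plancherel *)

Section plancherel.
Context {R : realType}.
Local Notation mu := (@lebesgue_measure R).
Implicit Types f g h : R -> R.

Lemma FC_affine f (a b xi : R) : 0 < a -> intble f ->
  FC (fun x => f (a * x + b)) xi = a^-1 *
   (cos (2 * pi * b * (xi / a)) * FC f (xi / a) +
    sin (2 * pi * b * (xi / a)) * FS f (xi / a)).
Proof.
move=> a0 fi; have ic := intble_cos (xi / a) fi; have is_ := intble_sin (xi / a) fi.
rewrite /FC /FS -IZ// -IZ// -ID; [|exact: intbleZ..].
rewrite -(I_affine b a0); last by apply: intbleD; exact: intbleZ.
apply: eq_Rintegral => x _.
rewrite (_ : 2 * pi * x * xi = 2 * pi * (a * x + b) * (xi / a) - 2 * pi * b * (xi / a)).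
  by rewrite cosB; ring.
by field; rewrite gt_eqF.
Qed.

Lemma FS_affine f (a b xi : R) : 0 < a -> intble f ->
  FS (fun x => f (a * x + b)) xi = a^-1 *
   (cos (2 * pi * b * (xi / a)) * FS f (xi / a) -
    sin (2 * pi * b * (xi / a)) * FC f (xi / a)).
Proof.
move=> a0 fi; have ic := intble_cos (xi / a) fi; have is_ := intble_sin (xi / a) fi.
rewrite /FC /FS -IZ// -IZ// -IB; [|exact: intbleZ..].
rewrite -(I_affine b a0); last by apply: intbleB; exact: intbleZ.
apply: eq_Rintegral => x _.
rewrite (_ : 2 * pi * x * xi = 2 * pi * (a * x + b) * (xi / a) - 2 * pi * b * (xi / a)).
  by rewrite sinB; ring.
by field; rewrite gt_eqF.
Qed.

Lemma FQ_affine f (a b xi : R) : 0 < a -> intble f ->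
  FQ (fun x => f (a * x + b)) xi = a^-1 ^+ 2 * FQ f (xi / a).
Proof.
move=> a0 fi; rewrite /FQ FC_affine// FS_affine//.
have := cos2Dsin2 (2 * pi * b * (xi / a)).
move: (cos _) (sin _) (FC _ _) (FS _ _) => c s C S e.
transitivity (a^-1 ^+ 2 * ((c ^+ 2 + s ^+ 2) * (C ^+ 2 + S ^+ 2))); first by ring.
by rewrite e mul1r.
Qed.

(** Translating the frequencies by t amounts to modulating f, which splits
    it into the two functions f cos and f sin, the squares of which add up
    to f^2. *)
Lemma parseval_circle_shift f (t : R) : L2 f -> supported `[0, 1[ f ->
  \esum_(n in [set: int]) (FQ f (n%:~R + t))%:E = (sqn f)%:E.
Proof.
move=> Lf sf.
pose fc x := f x * cos (2 * pi * x * t).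
pose fs x := f x * sin (2 * pi * x * t).
have Lc : L2 fc by exact: L2_cos.
have Ls : L2 fs by exact: L2_sin.
have sc : supported `[0, 1[ fc by move=> x /sf h; rewrite /fc h mul0r.
have ss : supported `[0, 1[ fs by move=> x /sf h; rewrite /fs h mul0r.
have ic := intble_supported Lc sc; have is_ := intble_supported Ls ss.
have fi := intble_supported Lf sf.
have EC n : FC f (n + t) = FC fc n - FS fs n.
  rewrite /FC /FS -IB; [|exact: intble_cos|exact: intble_sin].
  by apply: eq_Rintegral => x _; rewrite mulrDr cosD /fc /fs; ring.
have ES n : FS f (n + t) = FS fc n + FC fs n.
  rewrite /FC /FS -ID; [|exact: intble_sin|exact: intble_cos].
  by apply: eq_Rintegral => x _; rewrite mulrDr sinD /fc /fs; ring.
rewrite (@esum_even_part _ _ (fun n => (FQ fc n%:~R)%:E + (FQ fs n%:~R)%:E)%E).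
- rewrite esumD; [|by move=> *; rewrite lee_fin FQ_ge0..].
  rewrite !parseval_circle// -EFinD; congr EFin; rewrite /sqn -ID; [|exact: Lc.2|exact: Ls.2].
  apply: eq_Rintegral => x _; rewrite /fc /fs !exprMn -mulrDr cos2Dsin2 mulr1//.
- by move=> n; rewrite lee_fin FQ_ge0.
- by move=> n; rewrite adde_ge0// lee_fin FQ_ge0.
- move=> n; rewrite -!EFinD; congr EFin.
  by rewrite /FQ !EC !ES !mulrNz !FCN !FSN//; ring.
Qed.

Lemma esum_unit_cells (x : R) (c : \bar R) : (0 <= c)%E ->
  \esum_(n in [set: int]) (c * (\1_(`[0, 1[) (x - n%:~R))%:E)%E = c.
Proof.
move=> c0; rewrite (esumID [set Num.floor x]); last first.
  by move=> n _; rewrite mule_ge0// lee_fin indicE.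
rewrite setTI esum_set1; last by rewrite mule_ge0// lee_fin indicE.
rewrite setTI esum1 => [|n /= nx].
  rewrite adde0 indicE mem_set ?mule1//= in_itv/=.
  by rewrite subr_ge0 floor_le_tmp/= ltrBlDl -[1]/(1%:~R) -intrD floorD1_gt.
rewrite indicE memNset ?mule0//= in_itv/= => /andP[h1 h2]; apply: nx.
by apply/esym/floor_def; rewrite -subr_ge0 h1/= intrD -ltrBlDl.
Qed.

(** Cut the line at the integers and translate each piece to the unit
    interval. *)
Lemma ge0_integral_cells (g : R -> \bar R) : measurable_fun setT g ->
  (forall x, 0 <= g x)%E ->
  (\int[mu]_x g x = \int[mu]_(t in `[0%R, 1%R[) \esum_(n in [set: int]) g (n%:~R + t)%R)%E.
Proof.
move=> mg g0.
have mD : measurable (`[0, 1[ : set R) by exact: measurable_itv.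
pose H (k : nat) (x : R) : \bar R := (g x * (\1_(`[0, 1[) (x - (int_enum k)%:~R))%:E)%E.
have H0 k x : (0 <= H k x)%E by rewrite mule_ge0// lee_fin indicE.
have mH k : measurable_fun setT (H k).
  apply: emeasurable_funM => //; apply/measurable_EFinP.
  have := @measurable_comp_affine R _ _ (\1_(`[0, 1[) : R -> R) 1 (- (int_enum k)%:~R)
    (measurable_fun_indic mD).
  by under eq_fun do rewrite mul1r.
transitivity (\int[mu]_x (\sum_(k <oo) H k x))%E.
  apply: eq_integral => x _; rewrite -[LHS](esum_unit_cells x (g0 x)) esum_int//.
  by move=> n; rewrite mule_ge0// lee_fin indicE.
rewrite integral_nneseries//.
transitivity (\int[mu]_(t in `[0%R, 1%R[) \sum_(k <oo) g ((int_enum k)%:~R + t)%R)%E; last first.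
  by apply: eq_integral => t _; rewrite esum_int.
have mg' k : measurable_fun setT (fun t : R => g ((int_enum k)%:~R + t)).
  have := @measurable_comp_affine R _ _ g 1 (int_enum k)%:~R mg.
  by under eq_fun do rewrite mul1r addrC.
rewrite integral_nneseries//; last by move=> k; exact: measurable_funS (mg' k).
apply: eq_eseriesr => k _.
have := @ge0_integral_affine R 1 (int_enum k)%:~R (H k) ltr01 (mH k) (H0 k).
rewrite invr1 mul1e => <-; rewrite [RHS]integral_mkcond.
apply: eq_integral => t _; rewrite /H patchE mul1r addrK addrC indicE.
by case: (_ \in _); rewrite ?mule1 ?mule0.
Qed.

(** For a function supported by the unit interval Parseval's identity holds
    on each translate of the integers; integrate it over the translation. *)
Lemma plancherel_unit f : L2 f -> supported `[0, 1[ f ->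
  (\int[mu]_xi (FQ f xi)%:E = (sqn f)%:E)%E.
Proof.
move=> Lf sf; have fi := intble_supported Lf sf.
rewrite ge0_integral_cells; last 2 first.
- by apply/measurable_EFinP; exact: measurable_FQ.
- by move=> x; rewrite lee_fin FQ_ge0.
under eq_integral do rewrite parseval_circle_shift//.
rewrite integral_cst//= lebesgue_measure_itv/= lte_fin ltr01 oppr0 adde0.
by rewrite mule1.
Qed.

Lemma plancherel_itv f (M : R) : 0 < M -> L2 f -> supported `[- M, M[ f ->
  (\int[mu]_xi (FQ f xi)%:E = (sqn f)%:E)%E.
Proof.
move=> M0 Lf sf; have fi := intble_supported Lf sf.
pose a := 2 * M; have a0 : 0 < a by rewrite mulr_gt0.
have := @plancherel_unit (fun x => f (a * x - M)) (L2_affine (- M) a0 Lf).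
rewrite sqn_affine// => h.
have {}h : (\int[mu]_xi (FQ (fun x => f (a * x - M)) xi)%:E = (a^-1 * sqn f)%:E)%E.
  apply: h => x xn; apply: sf => /=; rewrite in_itv/= => /andP[h1 h2]; apply: xn.
  rewrite /= in_itv/=; apply/andP; split.
    by rewrite -(pmulr_rge0 _ a0); lra.
  by rewrite -(ltr_pM2l a0) mulr1 /a; rewrite /a in h2; lra.
move: h; under eq_integral do rewrite FQ_affine// EFinM.
rewrite ge0_integralZl//; last 3 first.
- apply/measurable_EFinP; have := measurable_comp_affine a^-1 0 (measurable_FQ fi).
  by under eq_fun do rewrite addr0 mulrC.
- by move=> x _; rewrite lee_fin FQ_ge0.
- by rewrite lee_fin sqr_ge0.
have aV0 : 0 < a^-1 by rewrite invr_gt0.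
have -> : (\int[mu]_x (FQ f (x / a))%:E = \int[mu]_x (FQ f (a^-1 * x + 0)%R)%:E)%E.
  by apply: eq_integral => x _; rewrite addr0 mulrC.
rewrite (@ge0_integral_affine R a^-1 0 (fun x => (FQ f x)%:E))//; last 2 first.
- by apply/measurable_EFinP; exact: measurable_FQ.
- by move=> x; rewrite lee_fin FQ_ge0.
rewrite invrK muleA -EFinM expr2 -mulrA mulVf ?gt_eqF// mulr1 EFinM => /(congr1 (mule a%:E)).
by rewrite !muleA -EFinM mulfV ?gt_eqF// !mul1e.
Qed.

Lemma L2_FC f : intble f -> (\int[mu]_xi (FQ f xi)%:E < +oo)%E ->
  [/\ L2 (FC f), L2 (FS f) &
      (sqn (FC f) + sqn (FS f))%:E = (\int[mu]_xi (FQ f xi)%:E)%E].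
Proof.
move=> fi Qf.
have Qi : intble (FQ f).
  by apply/(ge0_intbleP (FQ_ge0 f)); split => //; exact: measurable_FQ.
have LC : L2 (FC f).
  split; first exact: measurable_FC.
  apply: intble_le Qi; first by apply: measurable_funX; exact: measurable_FC.
  by move=> x; rewrite !ger0_norm ?FQ_ge0 ?sqr_ge0// lerDl sqr_ge0.
have LS : L2 (FS f).
  split; first exact: measurable_FS.
  apply: intble_le Qi; first by apply: measurable_funX; exact: measurable_FS.
  by move=> x; rewrite !ger0_norm ?FQ_ge0 ?sqr_ge0// lerDr sqr_ge0.
split => //; rewrite /sqn -ID; [|exact: LC.2|exact: LS.2].
by rewrite EFin_I.
Qed.

Definition trunc f (n : nat) x : R := f x * \1_(`[- n.+1%:R, n.+1%:R[) x.

Lemma cvg_trunc f x : trunc f n x @[n --> \oo] --> f x.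
Proof.
apply: cvg_near_cst; near=> n.
rewrite /trunc indicE mem_set ?mulr1//= in_itv/=.
have h : `|x| < n.+1%:R.
  apply: (@lt_le_trans _ _ (Num.truncn `|x|).+1%:R); first exact: truncnS_gt.
  by rewrite ler_nat ltnS; near: n; exact: nbhs_infty_ge.
by move: h; rewrite ltr_norml => /andP[/ltW -> ->].
Unshelve. all: by end_near. Qed.

Lemma le_trunc f n x : `|trunc f n x| <= `|f x|.
Proof. by rewrite /trunc normrM ler_piMr// indic_norm_le1. Qed.

Lemma L2_trunc f n : L2 f -> L2 (trunc f n).
Proof. by move=> Lf; exact: L2_indic. Qed.

Lemma intble_trunc f n : L2 f -> intble (trunc f n).
Proof. by move=> Lf; exact: L2_intble_itv. Qed.

Lemma L2cvg_dominated (u : nat -> R -> R) f g : (forall n, L2 (u n)) -> L2 f -> L2 g ->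
  (forall x, u n x @[n --> \oo] --> f x) -> (forall n x, `|u n x - f x| <= `|g x|) ->
  L2cvg u f.
Proof.
move=> Lu Lf Lg uf ug.
have [|||n x|_ h _] := @I_dct R (fun n x => (u n x - f x) ^+ 2) (fun=> 0) (fun x => g x ^+ 2).
- by move=> n; apply: measurable_funX; apply: L2_meas; exact: L2B.
- move=> x; rewrite -[X in _ --> X](mulr0 0); under eq_fun do rewrite expr2.
  have h0 : u n x - f x @[n --> \oo] --> 0.
    by apply/subr_cvg0; exact: uf.
  exact: cvgM.
- exact: Lg.2.
- by rewrite normrX -(real_normK (num_real (g x))) lerXn2r// nnegrE.
by move: h; rewrite /Rintegral integral0.
Qed.

Lemma L2cvg_trunc f : L2 f -> L2cvg (trunc f) f.
Proof.
move=> Lf; apply: (L2cvg_dominated _ Lf Lf) => [n|x|n x].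
- exact: L2_trunc.
- exact: cvg_trunc.
- rewrite /trunc -[X in _ - X]mulr1 -mulrBr normrM ler_piMr// indicE.
  by case: (_ \in _); rewrite ?subrr ?normr0// sub0r normrN normr1.
Qed.

Lemma L2cvg_cauchy (u : nat -> R -> R) f : (forall n, L2 (u n)) -> L2 f -> L2cvg u f ->
  forall e : R, 0 < e -> exists N, forall m n, (N <= m)%N -> (N <= n)%N ->
     sqn (fun x => u m x - u n x) <= e.
Proof.
move=> Lu Lf uf e e0.
have e4 : 0 < e / 4 by rewrite divr_gt0.
have [N _ NP] := (cvgrPdist_le _ _).1 uf _ e4.
exists N => m n Nm Nn.
have hm := NP m Nm; have hn := NP n Nn.
rewrite /= sub0r normrN ger0_norm ?sqn_ge0// in hm.
rewrite /= sub0r normrN ger0_norm ?sqn_ge0// in hn.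
have := sqnD_le (L2B (Lu m) Lf) (L2N (L2B (Lu n) Lf)); rewrite sqnN => h.
apply: (@le_trans _ _ (2 * (e / 4 + e / 4))); last by lra.
apply: le_trans (le_trans h _); last by rewrite ler_wpM2l// lerD.
by rewrite le_eqVlt; apply/orP; left; apply/eqP; congr sqn; apply/funext => x; ring.
Qed.

Lemma FCB f g xi : intble f -> intble g ->
  FC (fun x => f x - g x) xi = FC f xi - FC g xi.
Proof.
move=> fi gi; rewrite /FC -IB; [|exact: intble_cos..].
by apply: eq_Rintegral => x _; rewrite mulrBl.
Qed.

Lemma FSB f g xi : intble f -> intble g ->
  FS (fun x => f x - g x) xi = FS f xi - FS g xi.
Proof.
move=> fi gi; rewrite /FS -IB; [|exact: intble_sin..].
by apply: eq_Rintegral => x _; rewrite mulrBl.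
Qed.

Lemma FCD f g xi : intble f -> intble g ->
  FC (fun x => f x + g x) xi = FC f xi + FC g xi.
Proof.
move=> fi gi; rewrite /FC -ID; [|exact: intble_cos..].
by apply: eq_Rintegral => x _; rewrite mulrDl.
Qed.

Lemma FSD f g xi : intble f -> intble g ->
  FS (fun x => f x + g x) xi = FS f xi + FS g xi.
Proof.
move=> fi gi; rewrite /FS -ID; [|exact: intble_sin..].
by apply: eq_Rintegral => x _; rewrite mulrDl.
Qed.

Lemma FC_cvg (u : nat -> R -> R) f xi : (forall n, intble (u n)) -> intble f ->
  (forall x, u n x @[n --> \oo] --> f x) -> (forall n x, `|u n x| <= `|f x|) ->
  FC (u n) xi @[n --> \oo] --> FC f xi /\ FS (u n) xi @[n --> \oo] --> FS f xi.
Proof.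
move=> iu fi uf ul; split.
- have [|||n x|_ h _] := @I_dct R (fun n x => u n x * cos (2 * pi * x * xi))
    (fun x => f x * cos (2 * pi * x * xi)) (fun x => `|f x|) => //.
  + by move=> n; apply: intble_meas; exact: intble_cos.
  + by move=> x; apply: cvgM => //; exact: cvg_cst.
  + exact: intble_abs.
  + by rewrite normrM (le_trans _ (ul n x))// ler_piMr// cos_max.
- have [|||n x|_ h _] := @I_dct R (fun n x => u n x * sin (2 * pi * x * xi))
    (fun x => f x * sin (2 * pi * x * xi)) (fun x => `|f x|) => //.
  + by move=> n; apply: intble_meas; exact: intble_sin.
  + by move=> x; apply: cvgM => //; exact: cvg_cst.
  + exact: intble_abs.
  + by rewrite normrM (le_trans _ (ul n x))// ler_piMr// sin_max.
Qed.

(** By truncation: the transforms of the truncations form a Cauchy sequence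
    and converge everywhere to the transform of f. *)
Theorem plancherel f : L2 f -> intble f ->
  [/\ L2 (FC f), L2 (FS f) & sqn (FC f) + sqn (FS f) = sqn f].
Proof.
move=> Lf fi.
have tP n m : let d := fun x => trunc f n x - trunc f m x in
    [/\ L2 (FC d), L2 (FS d) & sqn (FC d) + sqn (FS d) = sqn d].
  move=> d; have Ld : L2 d by apply: L2B; exact: L2_trunc.
  have id : intble d by apply: intbleB; exact: intble_trunc.
  have sd : supported `[- (maxn n m).+1%:R, (maxn n m).+1%:R[ d.
    move=> x; rewrite /= in_itv/= => xn; rewrite /d /trunc !indicE !memNset ?mulr0 ?subrr//=;
    rewrite in_itv/= => /andP[h1 h2]; apply: xn; apply/andP; split.
    + by apply: le_trans h1; rewrite lerN2 ler_nat ltnS leq_maxr.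
    + by apply: (lt_le_trans h2); rewrite ler_nat ltnS leq_maxr.
    + by apply: le_trans h1; rewrite lerN2 ler_nat ltnS leq_maxl.
    + by apply: (lt_le_trans h2); rewrite ler_nat ltnS leq_maxl.
  have P := plancherel_itv (ltr0Sn _ _) Ld sd.
  have [|h1 h2 h3] := @L2_FC d id; first by rewrite P ltry.
  by split => //; apply: EFin_inj; rewrite h3 P.
have tP1 n : [/\ L2 (FC (trunc f n)), L2 (FS (trunc f n)) &
    sqn (FC (trunc f n)) + sqn (FS (trunc f n)) = sqn (trunc f n)].
  have Lt : L2 (trunc f n) by exact: L2_trunc.
  have P := plancherel_itv (ltr0Sn _ _) Lt (@supported_indic R _ f).
  have [|h1 h2 h3] := @L2_FC (trunc f n) (intble_trunc n Lf); first by rewrite P ltry.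
  by split => //; apply: EFin_inj; rewrite h3 P.
have C n xi m : FC (fun x => trunc f n x - trunc f m x) xi = FC (trunc f n) xi - FC (trunc f m) xi.
  by rewrite FCB//; exact: intble_trunc.
have S n xi m : FS (fun x => trunc f n x - trunc f m x) xi = FS (trunc f n) xi - FS (trunc f m) xi.
  by rewrite FSB//; exact: intble_trunc.
have lim xi := @FC_cvg (trunc f) f xi (fun n => intble_trunc n Lf) fi (@cvg_trunc f) (@le_trunc f).
(* Fatou's lemma passes from the distance between two truncations to the
   distance between a truncation and f. *)
have main (e : R) : 0 < e -> exists N, forall n, (N <= n)%N ->
  (L2 (fun xi => FC (trunc f n) xi - FC f xi) /\
   sqn (fun xi => FC (trunc f n) xi - FC f xi) <= e) /\
  (L2 (fun xi => FS (trunc f n) xi - FS f xi) /\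
   sqn (fun xi => FS (trunc f n) xi - FS f xi) <= e).
  move=> e0; have [N NP] := L2cvg_cauchy (fun n => L2_trunc n Lf) Lf (L2cvg_trunc Lf) e0.
  exists N => n Nn; split.
  - apply: (@sqn_fatou _ (fun m xi => FC (trunc f n) xi - FC (trunc f m) xi)).
    + by move=> m; have [h _ _] := tP n m; rewrite -(funext (C n ^~ m)).
    + by apply: measurable_funB; apply: measurable_FC => //; exact: intble_trunc.
    + by apply: aeW => xi; apply: cvgB; [exact: cvg_cst|exact: (lim xi).1].
    + exists N => // m Nm /=; rewrite -(funext (C n ^~ m)).
      apply: le_trans (NP n m Nn Nm); have [_ _ <-] := tP n m.
      by rewrite lerDl sqn_ge0.
  - apply: (@sqn_fatou _ (fun m xi => FS (trunc f n) xi - FS (trunc f m) xi)).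
    + by move=> m; have [_ h _] := tP n m; rewrite -(funext (S n ^~ m)).
    + by apply: measurable_funB; apply: measurable_FS => //; exact: intble_trunc.
    + by apply: aeW => xi; apply: cvgB; [exact: cvg_cst|exact: (lim xi).2].
    + exists N => // m Nm /=; rewrite -(funext (S n ^~ m)).
      apply: le_trans (NP n m Nn Nm); have [_ _ <-] := tP n m.
      by rewrite lerDr sqn_ge0.
have [LC LS] : L2 (FC f) /\ L2 (FS f).
  have [N /(_ N (leqnn _)) [[hC _] [hS _]]] := main 1 ltr01.
  have [LC LS _] := tP1 N.
  split.
    by have := L2B LC hC; under eq_fun do rewrite opprB addrC subrK.
  by have := L2B LS hS; under eq_fun do rewrite opprB addrC subrK.
split => //.
have cC : L2cvg (fun n => FC (trunc f n)) (FC f).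
  apply/cvgrPdist_le => e e0; have [N NP] := main e e0; exists N => // n Nn /=.
  by rewrite sub0r normrN ger0_norm ?sqn_ge0//; have [[]] := NP n Nn.
have cS : L2cvg (fun n => FS (trunc f n)) (FS f).
  apply/cvgrPdist_le => e e0; have [N NP] := main e e0; exists N => // n Nn /=.
  by rewrite sub0r normrN ger0_norm ?sqn_ge0//; have [_ []] := NP n Nn.
have h1 : sqn (FC (trunc f n)) + sqn (FS (trunc f n)) @[n --> \oo] --> sqn (FC f) + sqn (FS f).
  apply: cvgD.
    by apply: (sqn_cvg _ LC cC) => n; have [] := tP1 n.
  by apply: (sqn_cvg _ LS cS) => n; have [] := tP1 n.
have h2 := sqn_cvg (fun n => L2_trunc n Lf) Lf (L2cvg_trunc Lf).
apply: (cvg_unique _ h1); first exact: Rhausdorff.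
rewrite (_ : (fun n => _) = (fun n => sqn (trunc f n)))//.
by apply/funext => n; have [] := tP1 n.
Qed.

End plancherel.

(** * Periodization and exponential weights *)

Section periodization.
Context {R : realType}.
Local Notation mu := (@lebesgue_measure R).
Implicit Types f g h : R -> R.

(** The periodization of f of period tau, restricted to one period; N terms
    are enough for a function supported by [0, N tau[. *)
Definition fold (N : nat) (tau : R) f x : R :=
  (\sum_(0 <= k < N) f (x + k%:R * tau)) * \1_(`[0, tau[) x.

Lemma L2_translate f (b : R) : L2 f -> L2 (fun x => f (x + b)).
Proof.
by move=> Lf; have := L2_affine b (@ltr01 R) Lf; under eq_fun do rewrite mul1r.
Qed.

Lemma L2_fold N (tau : R) f : L2 f -> L2 (fold N tau f).
Proof.
move=> Lf; apply: L2_indic => //; apply: L2_sum => k; exact: L2_translate.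
Qed.

Lemma sum_indic_cells (N : nat) (tau x : R) : 0 < tau ->
  \sum_(0 <= k < N) (\1_(`[0, tau[) (x - k%:R * tau) : R) = \1_(`[0, N%:R * tau[) x.
Proof.
move=> t0; elim: N => [|N ih].
  rewrite big_nil mul0r indicE memNset//= in_itv/= => /andP[h1 h2].
  by have := le_lt_trans h1 h2; rewrite ltxx.
rewrite big_nat_recr//= ih !indicE !mem_setE/= !in_itv/= subr_ge0 ltrBlDl.
rewrite -natr1 mulrDl mul1r.
have h0 : 0 <= N%:R * tau by rewrite mulr_ge0// ltW.
case: (ltP x (N%:R * tau)) => h1; rewrite ?andbT ?andbF/=.
  case: (leP 0 x) => h2 /=; last by rewrite addr0.
  by rewrite addr0 (lt_trans h1)// ltrDl.
by rewrite (le_trans h0 h1)/= add0r.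
Qed.

Lemma I_translate f (b : R) : intble f -> \int[mu]_x f (x + b) = \int[mu]_x f x.
Proof.
move=> fi; have := I_affine b (@ltr01 R) fi; rewrite invr1 mul1r => <-.
by apply: eq_Rintegral => x _; rewrite mul1r.
Qed.

Lemma intble_translate f (b : R) : intble f -> intble (fun x => f (x + b)).
Proof.
by move=> fi; have := intble_affine b (@ltr01 R) fi; under eq_fun do rewrite mul1r.
Qed.

(** The cells [k tau, (k + 1) tau[ tile the support. *)
Lemma I_fold (N : nat) (tau : R) f : 0 < tau -> intble f -> supported `[0, N%:R * tau[ f ->
  \int[mu]_x fold N tau f x = \int[mu]_x f x.
Proof.
move=> t0 fi sf.
pose H (k : nat) x := f x * \1_(`[0, tau[) (x - k%:R * tau).
have m1 (k : nat) : measurable_fun setT (fun x : R => \1_(`[0, tau[) (x - k%:R * tau) : R).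
  have := @measurable_comp_affine R _ _ (\1_(`[0, tau[) : R -> R) 1 (- (k%:R * tau))
    (measurable_fun_indic (measurable_itv _)).
  by under eq_fun do rewrite mul1r.
have iH k : intble (H k).
  rewrite /H; under eq_fun do rewrite mulrC.
  by apply: (@intble_bounded _ _ _ 1) => // x; exact: indic_norm_le1.
transitivity (\int[mu]_x (\sum_(0 <= k < N) H k (x + k%:R * tau))).
  apply: eq_Rintegral => x _; rewrite /fold mulr_suml; apply: eq_bigr => k _.
  by rewrite /H addrK.
rewrite I_sum => [|k]; last exact: intble_translate.
under eq_bigr do rewrite I_translate//.
rewrite -I_sum//; apply: eq_Rintegral => x _.
by rewrite /H -mulr_sumr sum_indic_cells// -[RHS](congr1 (fun g => g x) (supportedE sf)).
Qed.

(** At the frequencies n / tau the oscillating factors have period tau. *)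
Lemma FQ_fold (N : nat) (tau : R) f (n : int) : 0 < tau -> L2 f ->
  supported `[0, N%:R * tau[ f ->
  FQ (fold N tau f) (n%:~R / tau) = FQ f (n%:~R / tau).
Proof.
move=> t0 Lf sf; have fi := intble_supported Lf sf.
have ph x (k : nat) : 2 * pi * (x + k%:R * tau) * (n%:~R / tau) =
    2 * pi * x * (n%:~R / tau) + 2 * pi * (n * k%:Z)%:~R.
  by rewrite intrM; field; rewrite gt_eqF.
rewrite /FQ; congr (_ ^+ 2 + _ ^+ 2).
- rewrite /FC -[RHS](@I_fold N tau (fun x => f x * cos (2 * pi * x * (n%:~R / tau))))//.
  + apply: eq_Rintegral => x _; rewrite /fold mulrAC; congr (_ * _).
    rewrite mulr_suml; apply: eq_bigr => k _.
    by rewrite ph cosD cos_2pi_int sin_2pi_int mulr1 mulr0 subr0.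
  + exact: intble_cos.
  + by move=> x /sf ->; rewrite mul0r.
- rewrite /FS -[RHS](@I_fold N tau (fun x => f x * sin (2 * pi * x * (n%:~R / tau))))//.
  + apply: eq_Rintegral => x _; rewrite /fold mulrAC; congr (_ * _).
    rewrite mulr_suml; apply: eq_bigr => k _.
    by rewrite ph sinD cos_2pi_int sin_2pi_int mulr1 mulr0 addr0.
  + exact: intble_sin.
  + by move=> x /sf ->; rewrite mul0r.
Qed.

Lemma parseval_period (tau : R) f : 0 < tau -> L2 f -> supported `[0, tau[ f ->
  \esum_(n in [set: int]) (FQ f (n%:~R / tau))%:E = (tau * sqn f)%:E.
Proof.
move=> t0 Lf sf; have fi := intble_supported Lf sf.
have s1 : supported `[0, 1[ (fun x => f (tau * x + 0)).
  move=> x xn; apply: sf => /=; rewrite addr0 in_itv/= => /andP[h1 h2]; apply: xn.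
  by rewrite /= in_itv/= -(pmulr_rge0 _ t0) h1 -(ltr_pM2l t0) mulr1.
have := parseval_circle (L2_affine 0 t0 Lf) s1.
rewrite sqn_affine//; under eq_esum do rewrite FQ_affine// EFinM.
rewrite esum_intZl; [|exact: sqr_ge0|by move=> n; rewrite lee_fin FQ_ge0].
move=> /(congr1 (fun x => (tau ^+ 2)%:E * x)%E).
rewrite muleA -EFinM -exprMn mulfV ?gt_eqF// expr1n mul1e => ->.
by rewrite -EFinM; congr EFin; field; rewrite gt_eqF.
Qed.

(** The quadratic form of Poisson summation: the frequencies n / tau do not
    distinguish f from its periodization. *)
Lemma parseval_fold (N : nat) (tau : R) f : 0 < tau -> L2 f ->
  supported `[0, N%:R * tau[ f ->
  \esum_(n in [set: int]) (FQ f (n%:~R / tau))%:E = (tau * sqn (fold N tau f))%:E.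
Proof.
move=> t0 Lf sf; rewrite -parseval_period//.
- by apply: eq_esum => n _; rewrite FQ_fold.
- exact: L2_fold.
- exact: supported_indic.
Qed.

Lemma cauchy_schwarz_sum (a b : nat -> R) N :
  (\sum_(0 <= k < N) a k * b k) ^+ 2 <=
  (\sum_(0 <= k < N) a k ^+ 2) * (\sum_(0 <= k < N) b k ^+ 2).
Proof.
elim: N => [|N ih]; first by rewrite !big_nil expr0n mul0r.
rewrite !big_nat_recr//=.
have A0 : 0 <= \sum_(0 <= k < N) a k ^+ 2 by apply: sumr_ge0 => k _; exact: sqr_ge0.
have B0 : 0 <= \sum_(0 <= k < N) b k ^+ 2 by apply: sumr_ge0 => k _; exact: sqr_ge0.
move: ih A0 B0; set A := \sum_(0 <= k < N) a k ^+ 2.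
set B := \sum_(0 <= k < N) b k ^+ 2; set C := \sum_(0 <= k < N) _.
move: (a N) (b N) => x y CAB A0 B0.
have S0 : 0 <= A * y ^+ 2 + B * x ^+ 2 by rewrite addr_ge0// mulr_ge0// sqr_ge0.
have h : 2 * C * x * y <= A * y ^+ 2 + B * x ^+ 2.
  apply: (le_trans (ler_norm _)).
  rewrite -(@ler_pXn2r _ 2)// ?nnegrE// real_normK ?num_real//.
  apply: (@le_trans _ _ (4 * (A * B) * (x ^+ 2 * y ^+ 2))).
    rewrite (_ : (2 * C * x * y) ^+ 2 = 4 * C ^+ 2 * (x ^+ 2 * y ^+ 2)); last by ring.
    by apply: ler_wpM2r; [rewrite mulr_ge0 ?sqr_ge0|exact: ler_wpM2l].
  rewrite -subr_ge0 (_ : _ - _ = (A * y ^+ 2 - B * x ^+ 2) ^+ 2) ?sqr_ge0//.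
  by ring.
rewrite (_ : (C + x * y) ^+ 2 = C ^+ 2 + 2 * C * x * y + x ^+ 2 * y ^+ 2); last by ring.
rewrite (_ : _ * (B + _) = A * B + (A * y ^+ 2 + B * x ^+ 2) + x ^+ 2 * y ^+ 2); last by ring.
by rewrite lerD// lerD.
Qed.

End periodization.

Section weights.
Context {R : realType}.
Local Notation mu := (@lebesgue_measure R).
Implicit Types f g h u : R -> R.
Implicit Types x y Y tau : R.

(** Multiplying a spectrum by this weight evaluates the associated analytic
    function at height y. *)
Definition wgt y x : R := expR (- (2 * pi * y * x)).

Lemma wgt_gt0 y x : 0 < wgt y x. Proof. exact: expR_gt0. Qed.
Lemma wgt_ge0 y x : 0 <= wgt y x. Proof. exact: expR_ge0. Qed.

Lemma wgtD y z x : wgt (y + z) x = wgt y x * wgt z x.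
Proof. by rewrite /wgt -expRD; congr expR; ring. Qed.

Lemma wgtDx y x z : wgt y (x + z) = wgt y x * wgt y z.
Proof. by rewrite /wgt -expRD; congr expR; ring. Qed.

Lemma wgt_le1 y x : 0 <= y -> 0 <= x -> wgt y x <= 1.
Proof.
by move=> y0 x0; rewrite expR_le1 oppr_le0 !mulr_ge0// pi_ge0.
Qed.

Lemma wgt_lt1 y x : 0 < y -> 0 < x -> wgt y x < 1.
Proof.
by move=> y0 x0; rewrite expR_lt1 oppr_lt0 !mulr_gt0// pi_gt0.
Qed.

Lemma le_wgt y z x : y <= z -> 0 <= x -> wgt z x <= wgt y x.
Proof.
move=> yz x0; rewrite ler_expR lerN2 ler_wpM2r// ler_wpM2l//.
by rewrite mulr_ge0// pi_ge0.
Qed.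

Lemma measurable_wgt y : measurable_fun setT (wgt y).
Proof.
have h : measurable_fun setT (fun x => - (2 * pi * y * x)).
  have := @measurable_affine R (- (2 * pi * y)) 0.
  by under eq_fun do rewrite addr0 mulNr.
exact: (measurableT_comp (@measurable_expR R) h).
Qed.

Definition wmul y f x := f x * wgt y x.

Lemma measurable_wmul y f : measurable_fun setT f -> measurable_fun setT (wmul y f).
Proof. by move=> mf; apply: measurable_funM => //; exact: measurable_wgt. Qed.

Definition halfline : set R := `[0%R, +oo[.

Lemma wmul_abs_le y z f x : supported halfline f -> y <= z ->
  `|wmul z f x| <= `|wmul y f x|.
Proof.
move=> sf yz; case: (leP 0 x) => x0.
  by rewrite !normrM ler_wpM2l// !ger0_norm ?wgt_ge0// le_wgt.
rewrite /wmul (sf x) ?mul0r//.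
by rewrite /halfline/= in_itv/= andbT leNgt x0.
Qed.

Lemma wmul0 f : wmul 0 f = f.
Proof. by apply/funext => x; rewrite /wmul /wgt mulr0 mul0r oppr0 expR0 mulr1. Qed.

Lemma L2_wmul_le y z f : supported halfline f -> y <= z ->
  L2 (wmul y f) -> L2 (wmul z f).
Proof.
move=> sf yz Ly; apply: (L2_le _ _ Ly).
- rewrite (_ : wmul z f = wmul (z - y) (wmul y f)).
    by apply: measurable_wmul; exact: L2_meas.
  by apply/funext => x; rewrite /wmul -mulrA -wgtD addrC subrK.
- by move=> x; exact: wmul_abs_le.
Qed.

(** The squared norm, on the line of height y, of the analytic function of
    spectrum f. *)
Definition Hn y f : R := sqn (wmul y f).

Lemma Hn_le y z f : supported halfline f -> y <= z -> L2 (wmul y f) ->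
  Hn z f <= Hn y f.
Proof.
move=> sf yz Ly; apply: le_sqn => //; last by move=> x; exact: wmul_abs_le.
by apply: L2_meas; apply: L2_wmul_le Ly.
Qed.

Lemma wmulD y f g : wmul y (fun x => f x + g x) = fun x => wmul y f x + wmul y g x.
Proof. by apply/funext => x; rewrite /wmul mulrDl. Qed.

Lemma wmulB y f g : wmul y (fun x => f x - g x) = fun x => wmul y f x - wmul y g x.
Proof. by apply/funext => x; rewrite /wmul mulrBl. Qed.

Lemma wmulZ y k f : wmul y (fun x => k * f x) = fun x => k * wmul y f x.
Proof. by apply/funext => x; rewrite /wmul mulrA. Qed.

(** Spectra of bounded support: a dense class on which the division by a
    geometric series is a finite sum. *)
Definition bspec f := L2 f /\ exists L : R, supported `[0, L[ f.

Lemma bspec_half f : bspec f -> supported halfline f.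
Proof.
move=> [_ [L sf]] x xn; apply: sf => /=; rewrite in_itv/= => /andP[x0 _].
by apply: xn; rewrite /halfline/= in_itv/= x0.
Qed.

Lemma bspec_L2w y f : 0 <= y -> bspec f -> L2 (wmul y f).
Proof.
move=> y0 bf; apply: (L2_wmul_le (bspec_half bf) y0).
by rewrite wmul0; exact: bf.1.
Qed.

Lemma supported_wmul (A : set R) y f : supported A f -> supported A (wmul y f).
Proof. by move=> sf x /sf h; rewrite /wmul h mul0r. Qed.

Lemma bspec_iw y f : 0 <= y -> bspec f -> intble (wmul y f).
Proof.
move=> y0 bf; have [_ [L sf]] := bf.
by apply: (intble_supported (bspec_L2w y0 bf) (supported_wmul y sf)).
Qed.

Lemma supported_le (a b : R) f : a <= b -> supported `[0, a[ f -> supported `[0, b[ f.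
Proof.
move=> ab sf x xn; apply: sf => /=; rewrite in_itv/= => /andP[h1 h2].
by apply: xn; rewrite /= in_itv/= h1 (lt_le_trans h2).
Qed.

Lemma bspecN (tau : R) f : 0 < tau -> bspec f -> exists N, supported `[0, N%:R * tau[ f.
Proof.
move=> t0 [_ [L sf]]; exists (Num.truncn `|L / tau|).+1.
apply: supported_le sf; rewrite -ler_pdivrMr//.
by rewrite (le_trans (ler_norm _))// ltW// truncnS_gt.
Qed.

Lemma bspecD f g : bspec f -> bspec g -> bspec (fun x => f x + g x).
Proof.
move=> [Lf [L sf]] [Lg [M sg]]; split; first exact: L2D.
exists (Num.max L M) => x xn.
rewrite (supported_le _ sf xn) ?(supported_le _ sg xn) ?addr0//.
  by rewrite le_max lexx orbT.
by rewrite le_max lexx.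
Qed.

Lemma bspecZ k f : bspec f -> bspec (fun x => k * f x).
Proof.
move=> [Lf [L sf]]; split; first exact: L2Z.
by exists L => x /sf ->; rewrite mulr0.
Qed.

Lemma bspecB f g : bspec f -> bspec g -> bspec (fun x => f x - g x).
Proof.
move=> bf bg; have := bspecD bf (bspecZ (-1) bg).
by under eq_fun do rewrite mulN1r.
Qed.

(** The energy of the samples of the analytic function of spectrum f on the
    row of height Y and spacing beta Y. *)
Definition rowe (beta Y : R) f : \bar R :=
  \esum_(n in [set: int]) (FQ (wmul Y f) (n%:~R * (beta * Y)))%:E.

(** The frequency step beta Y of the row is dual to this period of the
    spectrum. *)
Definition period (beta Y : R) : R := (beta * Y)^-1.

Definition bessel_cst (beta Y h : R) : R :=
  period beta Y * (1 - wgt (Y - h) (period beta Y) ^+ 2)^-1.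

(** The samples on a row at height Y are those of the periodization of the
    spectrum; above the line of height h the weights decrease geometrically
    along the period, and the inequality of Cauchy-Schwarz bounds the
    periodization by the norm on that line. *)
Lemma bessel_row_bspec (beta Y h : R) f : 0 < beta -> 0 <= h -> h < Y -> bspec f ->
  (rowe beta Y f <= (bessel_cst beta Y h * Hn h f)%:E)%E.
Proof.
move=> be0 h0 hY bf; have Y0 : 0 < Y by exact: le_lt_trans hY.
pose tau := period beta Y.
have t0 : 0 < tau by rewrite invr_gt0 mulr_gt0.
have [N sN] := bspecN t0 bf.
have LY := bspec_L2w (ltW Y0) bf; have Lh := bspec_L2w h0 bf.
rewrite /rowe (eq_esum (fun n _ => _ : _ = (FQ (wmul Y f) (n%:~R / tau))%:E)); last first.
  by rewrite /tau /period invrK.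
rewrite (parseval_fold t0 LY (supported_wmul Y sN)) lee_fin /bessel_cst -mulrA -/tau.
rewrite ler_wpM2l ?(ltW t0)//.
pose q := wgt (Y - h) tau.
have q01 : 0 < q < 1 by rewrite wgt_gt0 wgt_lt1// subr_gt0.
pose F x := wmul h f x ^+ 2.
have iF : intble F by exact: Lh.2.
have sF : supported `[0, N%:R * tau[ F.
  by move=> x /sN h1; rewrite /F /wmul h1 mul0r expr0n.
rewrite [leRHS](_ : _ = \int[mu]_x ((1 - q ^+ 2)^-1 * fold N tau F x)); last first.
  rewrite IZ; first by rewrite I_fold.
  have -> : fold N tau F = (fun x => (\sum_(0 <= k < N) F (x + k%:R * tau)) * \1_(`[0, tau[) x) by [].
  by apply: intble_indic => //; apply: intble_sum => k; exact: intble_translate.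
apply: le_I.
- by have [] := L2_fold N tau LY.
- apply: intbleZ; rewrite /fold; apply: intble_indic => //.
  by apply: intble_sum => k; exact: intble_translate.
move=> x; rewrite /fold exprMn [X in _ * X]expr2 indic_sq mulrA.
rewrite indicE; case: (boolP (x \in _)) => [|_]; last by rewrite !mulr0.
rewrite inE/= in_itv/= => /andP[x0 xt]; rewrite !mulr1.
have EY z : wmul Y f z = wgt (Y - h) z * wmul h f z.
  by rewrite /wmul mulrCA -wgtD subrK.
under eq_bigr do rewrite EY.
apply: (le_trans (cauchy_schwarz_sum _ _ N)).
rewrite ler_wpM2r//; first by apply: sumr_ge0 => k _; exact: sqr_ge0.
have /andP[q0 q1] := q01.
have qq : 0 < q ^+ 2 < 1 by rewrite exprn_gt0// expr_lt1// ltW.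
have /andP[qq0 qq1] := qq.
apply: (@le_trans _ _ (series (geometric 1 (q ^+ 2)) N)).
  rewrite /series/=; apply: ler_sum => k _; rewrite mul1r -exprM mulnC exprM lerXn2r//.
  - by rewrite nnegrE wgt_ge0.
  - by rewrite nnegrE exprn_ge0// ltW.
  rewrite wgtDx -[leRHS]mul1r; apply: ler_pM; rewrite ?wgt_ge0//.
    by rewrite wgt_le1// subr_ge0 ltW.
  rewrite /q /wgt -expRM_natl ler_expR.
  by rewrite mulrN lerN2 le_eqVlt; apply/orP; left; apply/eqP; ring.
rewrite -[leRHS]mul1r; apply: geometric_le_lim => //.
by rewrite ger0_norm// ltW.
Qed.

End weights.

(** * Removal of a row of samples *)

Section row_removal.
Context {R : realType}.
Local Notation mu := (@lebesgue_measure R).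
Implicit Types f g phi u r : R -> R.
Implicit Types x y h Y tau lam beta : R.

(** The real value of the row energy, meaningful when the latter is finite. *)
Definition rowr beta Y f : R := fine (rowe beta Y f).

Lemma rowe_ge0 beta Y f : (0 <= rowe beta Y f)%E.
Proof. by apply: esum_ge0 => n _; rewrite lee_fin FQ_ge0. Qed.

Lemma rowr_ge0 beta Y f : 0 <= rowr beta Y f.
Proof. by rewrite fine_ge0// rowe_ge0. Qed.

Lemma EFin_rowr beta Y f : 0 < beta -> 0 < Y -> bspec f ->
  (rowr beta Y f)%:E = rowe beta Y f.
Proof.
move=> b0 Y0 bf; rewrite fineK// ge0_fin_numE ?rowe_ge0//.
apply: le_lt_trans (bessel_row_bspec b0 (lexx 0) Y0 bf) _; exact: ltry.
Qed.

Lemma bessel_rowr beta Y h f : 0 < beta -> 0 <= h -> h < Y -> bspec f ->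
  rowr beta Y f <= bessel_cst beta Y h * Hn h f.
Proof.
move=> b0 h0 hY bf; rewrite -lee_fin EFin_rowr//; last exact: le_lt_trans hY.
exact: bessel_row_bspec.
Qed.

Lemma rowe_fold beta Y N f : 0 < beta -> 0 < Y -> bspec f ->
  supported `[0, N%:R * period beta Y[ f ->
  rowr beta Y f = period beta Y * sqn (fold N (period beta Y) (wmul Y f)).
Proof.
move=> b0 Y0 bf sf; have t0 : 0 < period beta Y by rewrite invr_gt0 mulr_gt0.
have := parseval_fold t0 (bspec_L2w (ltW Y0) bf) (supported_wmul Y sf).
by rewrite /period invrK /rowr /rowe => ->.
Qed.

Lemma wmul_FQ_D Y f g xi : 0 <= Y -> bspec f -> bspec g ->
  FQ (wmul Y (fun x => f x + g x)) xi <= 2 * (FQ (wmul Y f) xi + FQ (wmul Y g) xi).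
Proof.
move=> Y0 bf bg; have fi := bspec_iw Y0 bf; have gi := bspec_iw Y0 bg.
have -> : FQ (wmul Y (fun x => f x + g x)) xi =
    (FC (wmul Y f) xi + FC (wmul Y g) xi) ^+ 2 + (FS (wmul Y f) xi + FS (wmul Y g) xi) ^+ 2.
  by rewrite wmulD /FQ FCD// FSD.
rewrite /FQ; have := sqr_ge0 (FC (wmul Y f) xi - FC (wmul Y g) xi).
have := sqr_ge0 (FS (wmul Y f) xi - FS (wmul Y g) xi); nra.
Qed.

Lemma rowr_le beta Y f g (K : R) : 0 < beta -> 0 < Y -> bspec f -> bspec g -> 0 <= K ->
  (forall xi, FQ (wmul Y f) xi <= K * FQ (wmul Y g) xi) ->
  rowr beta Y f <= K * rowr beta Y g.
Proof.
move=> b0 Y0 bf bg K0 fg; rewrite -lee_fin EFinM !EFin_rowr// /rowe -esum_intZl//.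
  by apply: le_esum => n _; rewrite -EFinM lee_fin.
by move=> n; rewrite lee_fin FQ_ge0.
Qed.

Lemma rowr_D beta Y f g : 0 < beta -> 0 < Y -> bspec f -> bspec g ->
  rowr beta Y (fun x => f x + g x) <= 2 * (rowr beta Y f + rowr beta Y g).
Proof.
move=> b0 Y0 bf bg; rewrite -lee_fin (EFinM 2) (EFinD (rowr _ _ _)) !EFin_rowr//; last exact: bspecD.
rewrite /rowe -esumD; [|by move=> *; rewrite lee_fin FQ_ge0..].
rewrite -esum_intZl//; last by move=> n; rewrite adde_ge0// lee_fin FQ_ge0.
apply: le_esum => n _; rewrite -EFinD -EFinM lee_fin.
by apply: wmul_FQ_D => //; exact: ltW.
Qed.

(** If s is t times the image of a under an isometry, then s - lam a and a
    - lam s are the numerator and the denominator of a Blaschke factor; at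
    distance t from the origin its modulus is at most (t + lam) / (1 + t
    lam). *)
Lemma blaschke_contraction a s (t lam : R) : 0 < t -> t <= 1 -> 0 <= lam -> lam <= 1 ->
  L2 a -> L2 s -> sqn s = t ^+ 2 * sqn a ->
  sqn (fun x => s x - lam * a x) <=
    ((t + lam) / (1 + t * lam)) ^+ 2 * sqn (fun x => a x - lam * s x).
Proof.
move=> t0 t1 l0 l1 La Ls sa.
(* The square norm of s + t a is nonnegative. *)
have c0 : - (t * sqn a) <= inner2 s a.
  have := sqn_ge0 (fun x => s x + t * a x).
  rewrite sqnD//; last exact: L2Z.
  rewrite (ipC s) ipZl// (ipC a) sqnZ// sa => h.
  have : 0 <= 2 * t * (t * sqn a + inner2 s a).
    by move: h; congr (_ <= _); ring.
  by rewrite pmulr_rge0 ?mulr_gt0// -lerBlDl sub0r.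
rewrite !sqnB//; try exact: L2Z.
rewrite (ipC s (fun x => _ * _)) ipZl// (ipC a s) (ipC a (fun x => _ * _)) ipZl// !sqnZ// sa.
set A := sqn a; set c := inner2 s a.
have d0 : 0 < 1 + t * lam by rewrite ltr_pwDl// mulr_ge0// ltW.
rewrite expr_div_n -subr_ge0.
have -> : (t + lam) ^+ 2 / (1 + t * lam) ^+ 2 *
    (A - 2 * (lam * c) + lam ^+ 2 * (t ^+ 2 * A)) -
    (t ^+ 2 * A - 2 * (lam * c) + lam ^+ 2 * A) =
  (1 + t * lam) ^- 2 * (2 * lam * ((1 - t ^+ 2) * (1 - lam ^+ 2)) * (c + t * A)).
  by field; rewrite gt_eqF.
apply: mulr_ge0; first by rewrite invr_ge0 sqr_ge0.
apply: mulr_ge0; last by rewrite -lerBlDr sub0r.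
rewrite !mulr_ge0// subr_ge0 expr_le1//; exact: ltW.
Qed.

Lemma sqn_translate f (b : R) : L2 f -> sqn (fun x => f (x + b)) = sqn f.
Proof.
move=> Lf; have := sqn_affine b (@ltr01 R) Lf; rewrite invr1 mul1r => <-.
by congr sqn; apply/funext => x; rewrite mul1r.
Qed.

Definition tshift tau f x := f (x - tau).

Lemma bspec_tshift tau f : 0 <= tau -> bspec f -> bspec (tshift tau f).
Proof.
move=> t0 [Lf [L sf]]; split; first exact: L2_translate.
exists (L + tau) => x xn; apply: sf => /=; rewrite in_itv/= => /andP[h1 h2].
apply: xn; rewrite /= in_itv/=; apply/andP; split; last by rewrite -ltrBlDr.
by rewrite (le_trans t0)// -subr_ge0.
Qed.

Lemma wmul_tshift y tau f :
  wmul y (tshift tau f) = fun x => wgt y tau * wmul y f (x - tau).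
Proof.
apply/funext => x; rewrite /wmul /tshift.
have -> : wgt y x = wgt y (x - tau) * wgt y tau by rewrite -wgtDx subrK.
by ring.
Qed.

Lemma Hn_tshift y tau f : 0 <= y -> bspec f ->
  Hn y (tshift tau f) = wgt y tau ^+ 2 * Hn y f.
Proof.
move=> y0 bf; rewrite /Hn wmul_tshift sqnZ; last by apply: L2_translate; exact: bspec_L2w.
by rewrite sqn_translate//; exact: bspec_L2w.
Qed.

Lemma FC_tshift y tau f xi : 0 <= y -> bspec f ->
  FC (wmul y (tshift tau f)) xi = wgt y tau *
   (cos (2 * pi * tau * xi) * FC (wmul y f) xi - sin (2 * pi * tau * xi) * FS (wmul y f) xi).
Proof.
move=> y0 bf; have fi := bspec_iw y0 bf.
have := FC_affine (- tau) xi (@ltr01 R) fi.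
rewrite invr1 mul1r !(divr1, invr1, mulr1) !mulrN !mulNr cosN sinN mulNr => <-.
rewrite wmul_tshift /FC -IZ; last first.
  by have := intble_cos xi (intble_affine (- tau) (@ltr01 R) fi).
by apply: eq_Rintegral => x _; rewrite mul1r mulrA.
Qed.

Lemma FS_tshift y tau f xi : 0 <= y -> bspec f ->
  FS (wmul y (tshift tau f)) xi = wgt y tau *
   (cos (2 * pi * tau * xi) * FS (wmul y f) xi + sin (2 * pi * tau * xi) * FC (wmul y f) xi).
Proof.
move=> y0 bf; have fi := bspec_iw y0 bf.
have := FS_affine (- tau) xi (@ltr01 R) fi.
rewrite invr1 mul1r !(divr1, invr1, mulr1) !mulrN !mulNr cosN sinN mulNr opprK => <-.
rewrite wmul_tshift /FS -IZ; last first.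
  by have := intble_sin xi (intble_affine (- tau) (@ltr01 R) fi).
by apply: eq_Rintegral => x _; rewrite mul1r mulrA.
Qed.

Lemma FC_lin y (k l : R) f g xi : 0 <= y -> bspec f -> bspec g ->
  FC (wmul y (fun x => k * f x - l * g x)) xi =
  k * FC (wmul y f) xi - l * FC (wmul y g) xi.
Proof.
move=> y0 bf bg; have fi := bspec_iw y0 bf; have gi := bspec_iw y0 bg.
rewrite /FC -!IZ; [|exact: intble_cos..]; rewrite -IB; [|by apply: intbleZ; exact: intble_cos..].
by apply: eq_Rintegral => x _; rewrite /wmul; ring.
Qed.

Lemma FS_lin y (k l : R) f g xi : 0 <= y -> bspec f -> bspec g ->
  FS (wmul y (fun x => k * f x - l * g x)) xi =
  k * FS (wmul y f) xi - l * FS (wmul y g) xi.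
Proof.
move=> y0 bf bg; have fi := bspec_iw y0 bf; have gi := bspec_iw y0 bg.
rewrite /FS -!IZ; [|exact: intble_sin..]; rewrite -IB; [|by apply: intbleZ; exact: intble_sin..].
by apply: eq_Rintegral => x _; rewrite /wmul; ring.
Qed.

(** Quotient and remainder of the division of a spectrum by (shift by tau)
    - lam, that is, of the analytic function by exp (- 2 i pi tau z) - lam,
    where z = x - i y. With lam the weight of tau at height Y this divisor
    vanishes on the row of height Y, and the remainder carries the samples
    on the row. *)
Definition shift_quotient N lam tau phi x : R :=
  (\sum_(0 <= k < N) lam ^+ k * phi (x + k.+1%:R * tau)) * \1_halfline x.

Definition shift_remainder N lam tau phi x : R :=
  (\sum_(0 <= k < N) lam ^+ k * phi (x + k%:R * tau)) * \1_(`[0, tau[) x.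

(** A telescoping geometric series. *)
Lemma shift_division N lam tau phi x : 0 < tau -> supported `[0, N%:R * tau[ phi ->
  phi x = tshift tau (shift_quotient N lam tau phi) x - lam * shift_quotient N lam tau phi x
          + shift_remainder N lam tau phi x.
Proof.
move=> t0 se; rewrite /tshift /shift_quotient /shift_remainder !indicE !mem_setE /halfline/= !in_itv/= !andbT.
pose v k := lam ^+ k * phi (x + k%:R * tau).
have tel : 0 <= x -> \sum_(0 <= k < N) v k -
    lam * \sum_(0 <= k < N) lam ^+ k * phi (x + k.+1%:R * tau) = phi x.
  move=> x0; rewrite mulr_sumr -sumrB.
  rewrite (eq_bigr (fun k => v k - v k.+1)) => [|k _]; last by rewrite /v exprS mulrA.
  rewrite (eq_bigr (fun k => - (v k.+1 - v k))) => [|k _]; last by rewrite opprB.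
  rewrite sumrN telescope_sumr// opprB /v expr0 mul1r mul0r addr0.
  rewrite (se (x + N%:R * tau)) ?mulr0 ?subr0//= in_itv/= => /andP[_].
  by rewrite -ltrBrDr subrr ltNge x0.
have shE : \sum_(0 <= k < N) lam ^+ k * phi (x - tau + k.+1%:R * tau) = \sum_(0 <= k < N) v k.
  by apply: eq_bigr => k _; congr (_ * phi _); rewrite -natr1; ring.
rewrite shE subr_ge0.
case: (leP 0 x) => x0 /=; last first.
  rewrite leNgt (lt_trans x0 t0)/= !mulr0 subrr addr0 se//= in_itv/=.
  by rewrite leNgt x0.
case: (leP tau x) => xt /=; rewrite !mulr1 !mulr0 ?addr0 ?sub0r.
  by rewrite tel.
by rewrite addrC tel.
Qed.

Lemma bspec_shift_quotient N lam tau phi : 0 < tau -> supported `[0, N%:R * tau[ phi ->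
  bspec phi -> bspec (shift_quotient N lam tau phi).
Proof.
move=> t0 se be; split.
  apply: L2_indic; first exact: measurable_itv.
  apply: L2_sum => k; apply: L2Z; apply: L2_translate; exact: be.1.
exists (N%:R * tau) => x xn; rewrite /shift_quotient indicE mem_setE /halfline/= in_itv/= andbT.
case: (leP 0 x) => x0; last by rewrite mulr0.
rewrite mulr1 big1// => k _; rewrite se ?mulr0//= in_itv/= => /andP[_ h].
apply: xn; rewrite /= in_itv/= x0/=; apply: le_lt_trans h.
by rewrite lerDl mulr_ge0// ltW.
Qed.

Lemma bspec_shift_remainder N lam tau phi : bspec phi -> bspec (shift_remainder N lam tau phi).
Proof.
move=> be; split.
  apply: L2_indic => //.
  apply: L2_sum => k; apply: L2Z; apply: L2_translate; exact: be.1.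
by exists tau; exact: supported_indic.
Qed.

(** Up to the exponential weight, the remainder is the periodization of the
    spectrum, the norm of which is the energy of the row. *)
Lemma Hn_shift_remainder beta Y h N phi : 0 < beta -> 0 <= h -> h < Y -> bspec phi ->
  supported `[0, N%:R * period beta Y[ phi ->
  Hn h (shift_remainder N (wgt Y (period beta Y)) (period beta Y) phi) <=
   (wgt (h - Y) (period beta Y) ^+ 2 / period beta Y) * rowr beta Y phi.
Proof.
move=> b0 h0 hY be se; have Y0 : 0 < Y := le_lt_trans h0 hY.
set tau := period beta Y; have t0 : 0 < tau by rewrite invr_gt0 mulr_gt0.
rewrite (rowe_fold b0 Y0 be se) -/tau mulrA divfK ?gt_eqF//.
have LF := L2_fold N tau (bspec_L2w (ltW Y0) be).
rewrite -sqnZ//.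
have br := bspec_shift_remainder N (wgt Y tau) tau be.
apply: le_sqn; [by apply: L2_meas; exact: bspec_L2w| |exact: L2Z].
move=> x; rewrite /wmul /shift_remainder /fold indicE; case: (boolP (x \in _)) => [|_]; last first.
  by rewrite !mulr0 mul0r normr0.
rewrite inE/= in_itv/= => /andP[x0 xt]; rewrite !mulr1.
have -> : \sum_(0 <= k < N) phi (x + k%:R * tau) * wgt Y (x + k%:R * tau) =
    wgt Y x * \sum_(0 <= k < N) wgt Y tau ^+ k * phi (x + k%:R * tau).
  rewrite mulr_sumr; apply: eq_bigr => k _; rewrite wgtDx mulrC -mulrA; congr (_ * (_ * _)).
  by rewrite /wgt -expRM_natl; congr expR; ring.
rewrite mulrC [X in _ <= `|X|]mulrA !normrM ler_wpM2r// !ger0_norm ?mulr_ge0 ?wgt_ge0//.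
have -> : wgt h x = wgt (h - Y) x * wgt Y x by rewrite -wgtD subrK.
rewrite ler_wpM2r ?wgt_ge0// ler_expR lerN2.
have : (Y - h) * x <= (Y - h) * tau by rewrite ler_wpM2l ?subr_ge0 ?ltW.
have := pi_gt0 R; nra.
Qed.

(** The bound of the Blaschke factor of the row Y, normalized on the line
    of height h, on the line of height y. *)
Definition blaschke_bound beta h y Y : R :=
  (wgt (y - h) (period beta Y) + wgt (Y - h) (period beta Y)) /
  (1 + wgt (y - h) (period beta Y) * wgt (Y - h) (period beta Y)).

(** Removal of a row: up to a remainder r controlled by the samples on the
    row, the function phi is the product u of a Blaschke factor, unimodular
    on the line of height h and vanishing on the row Y, with a function
    phi1. So phi1 has the norm of u on the line of height h, and its
    samples on the other rows are comparable with those of u, because the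
    Blaschke factor is bounded below there. *)
Lemma row_step beta Y h y : 0 < beta -> 0 <= h -> h < Y -> h <= y ->
  exists2 K : R, 0 <= K & exists2 K2 : R -> R, (forall Y', 0 <= K2 Y') &
  forall phi, bspec phi -> exists u r phi1 : R -> R,
   [/\ bspec u, bspec r, bspec phi1 & phi = fun x => u x + r x] /\
   [/\ Hn h r <= K * rowr beta Y phi, Hn h phi1 = Hn h u,
       Hn y u <= blaschke_bound beta h y Y ^+ 2 * Hn y phi1 &
       forall Y' xi, 0 < Y' -> Y' != Y ->
         FQ (wmul Y' phi1) xi <= K2 Y' * FQ (wmul Y' u) xi].
Proof.
move=> b0 h0 hY hy; have Y0 : 0 < Y := le_lt_trans h0 hY.
pose tau := period beta Y; have t0 : 0 < tau by rewrite invr_gt0 mulr_gt0.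
exists (wgt (h - Y) tau ^+ 2 / tau); first by rewrite divr_ge0 ?sqr_ge0// ltW.
pose lam := wgt (Y - h) tau; pose q := wgt h tau.
have q0 : 0 < q by exact: wgt_gt0.
have l0 : 0 < lam by exact: wgt_gt0.
have l1 : lam < 1 by rewrite wgt_lt1// subr_gt0.
have lq : wgt Y tau = lam * q by rewrite /lam /q -wgtD subrK.
exists (fun Y' => ((1 + lam * wgt (Y' - h) tau) / (wgt (Y' - h) tau - lam)) ^+ 2).
  by move=> Y'; exact: sqr_ge0.
move=> phi be; have [N sN] := bspecN t0 be.
pose g := shift_quotient N (wgt Y tau) tau phi.
pose r := shift_remainder N (wgt Y tau) tau phi.
have bg : bspec g by exact: bspec_shift_quotient.
have br : bspec r by exact: bspec_shift_remainder.
(* The normalization by q makes s the image of g under an isometry on the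
   line of height h. *)
pose s x := q^-1 * tshift tau g x.
have bs : bspec s by apply: bspecZ; apply: bspec_tshift => //; exact: ltW.
pose u x := q * s x - (q * lam) * g x.
pose phi1 x := q * g x - (q * lam) * s x.
have bu : bspec u by apply: bspecB; exact: bspecZ.
have be1 : bspec phi1 by apply: bspecB; exact: bspecZ.
exists u, r, phi1; split; [split => //|].
  apply/funext => x; rewrite (shift_division (wgt Y tau) x t0 sN) -/g -/r lq /u /s.
  have E : forall v w z : R, v - lam * q * w + z = q * (q^-1 * v) - q * lam * w + z.
    by move=> v w z; field; rewrite gt_eqF.
  exact: E.
have Hs z : 0 <= z -> sqn (wmul z s) = wgt (z - h) tau ^+ 2 * sqn (wmul z g).
  move=> z0; rewrite /s wmulZ sqnZ; last first.
    by apply: bspec_L2w => //; apply: bspec_tshift => //; exact: ltW.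
  rewrite -[X in _ * X]/(Hn z (tshift tau g)) Hn_tshift// mulrA -exprMn.
  congr (_ ^+ 2 * _); rewrite -[in LHS](subrK h z) wgtD mulrCA -/q mulVf ?gt_eqF// mulr1//.
have ufac z : wmul z u = fun x => q * (wmul z s x - lam * wmul z g x).
  by apply/funext => x; rewrite /wmul /u; ring.
have efac z : wmul z phi1 = fun x => q * (wmul z g x - lam * wmul z s x).
  by apply/funext => x; rewrite /wmul /phi1; ring.
have LB z f1 f2 : 0 <= z -> bspec f1 -> bspec f2 -> L2 (fun x => wmul z f1 x - lam * wmul z f2 x).
  by move=> z0 b1 b2; apply: L2B; [|apply: L2Z]; exact: bspec_L2w.
have y0 : 0 <= y by exact: le_trans hy.
split.
- exact: Hn_shift_remainder.
- rewrite /Hn efac ufac !sqnZ; [|exact: LB..].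
  congr (_ * _); rewrite !sqnB; try (by apply: L2Z; exact: bspec_L2w); try exact: bspec_L2w.
  rewrite !sqnZ; try exact: bspec_L2w.
  have -> : sqn (wmul h s) = sqn (wmul h g).
    by rewrite Hs// subrr /wgt mulr0 mul0r oppr0 expR0 expr1n mul1r.
  rewrite (ipC (wmul h g) (fun x => _ * _)) (ipC (wmul h s) (fun x => _ * _)) !ipZl; try exact: bspec_L2w.
  by rewrite (ipC (wmul h s)); ring.
- rewrite /Hn efac ufac !sqnZ; [|exact: LB..].
  rewrite mulrCA ler_wpM2l ?sqr_ge0//.
  apply: blaschke_contraction; rewrite ?wgt_gt0 ?wgt_ge0//.
  + by rewrite wgt_le1 ?subr_ge0// ltW.
  + exact: ltW.
  + exact: bspec_L2w.
  + exact: bspec_L2w.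
  + exact: Hs.
- move=> Y' xi Y'0 Y'Y; have Y'0' := ltW Y'0.
  set rho := wgt (Y' - h) tau.
  have rl : rho - lam != 0.
    rewrite subr_eq0; apply: contra_neq Y'Y => /expR_inj/oppr_inj.
    have p0 : 2 * pi * tau != 0 :> R by rewrite !mulf_neq0// gt_eqF// pi_gt0.
    rewrite (mulrAC _ (Y' - h)) (mulrAC _ (Y - h)) => /(mulfI p0) /addIr//.
  have FCs : FC (wmul Y' s) xi = rho * (cos (2 * pi * tau * xi) * FC (wmul Y' g) xi -
      sin (2 * pi * tau * xi) * FS (wmul Y' g) xi).
    have := @FC_lin Y' q^-1 0 (tshift tau g) g xi Y'0' (bspec_tshift (ltW t0) bg) bg.
    rewrite mul0r subr0 FC_tshift// mulrA.
    have -> : q^-1 * wgt Y' tau = rho.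
      by rewrite -[in LHS](subrK h Y') wgtD mulrCA -/q mulVf ?gt_eqF// mulr1.
    by move=> <-; congr FC; congr wmul; apply/funext => x; rewrite mul0r subr0.
  have FSs : FS (wmul Y' s) xi = rho * (cos (2 * pi * tau * xi) * FS (wmul Y' g) xi +
      sin (2 * pi * tau * xi) * FC (wmul Y' g) xi).
    have := @FS_lin Y' q^-1 0 (tshift tau g) g xi Y'0' (bspec_tshift (ltW t0) bg) bg.
    rewrite mul0r subr0 FS_tshift// mulrA.
    have -> : q^-1 * wgt Y' tau = rho.
      by rewrite -[in LHS](subrK h Y') wgtD mulrCA -/q mulVf ?gt_eqF// mulr1.
    by move=> <-; congr FS; congr wmul; apply/funext => x; rewrite mul0r subr0.
  rewrite {1 2}/FQ /phi1 /u !FC_lin// !FS_lin// FCs FSs.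
  have cs := cos2Dsin2 (2 * pi * tau * xi).
  have cN := cos_geN1 (2 * pi * tau * xi); have c1 := cos_le1 (2 * pi * tau * xi).
  have rho0 : 0 < rho by exact: wgt_gt0.
  move: (cos _) (sin _) (FC _ _) (FS _ _) cs cN c1 => c sn C S cs cN c1.
  (* With z = rho e^(i theta), these are |1 - lam z|^2 and |z - lam|^2; the
     first is at most (1 + lam rho)^2, the second at least (rho - lam)^2. *)
  have e1 : (q * C - q * lam * (rho * (c * C - sn * S))) ^+ 2 +
      (q * S - q * lam * (rho * (c * S + sn * C))) ^+ 2 =
      q ^+ 2 * (C ^+ 2 + S ^+ 2) * (1 - 2 * lam * rho * c + lam ^+ 2 * rho ^+ 2 * (c ^+ 2 + sn ^+ 2)).
    by ring.
  have e2 : (q * (rho * (c * C - sn * S)) - q * lam * C) ^+ 2 +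
      (q * (rho * (c * S + sn * C)) - q * lam * S) ^+ 2 =
      q ^+ 2 * (C ^+ 2 + S ^+ 2) * (rho ^+ 2 * (c ^+ 2 + sn ^+ 2) - 2 * lam * rho * c + lam ^+ 2).
    by ring.
  rewrite e1 e2 cs !mulr1 [X in _ <= X]mulrCA.
  have Q0 : 0 <= q ^+ 2 * (C ^+ 2 + S ^+ 2).
    by apply: mulr_ge0; [exact: sqr_ge0|apply: addr_ge0; exact: sqr_ge0].
  rewrite ler_wpM2l//.
  have lr : 0 < lam * rho by rewrite mulr_gt0.
  apply: (@le_trans _ _ ((1 + lam * rho) ^+ 2)); first by nra.
  rewrite expr_div_n mulrAC ler_pdivlMr; last by rewrite lt_neqAle sqr_ge0 andbT eq_sym sqrf_eq0.
  by rewrite ler_wpM2l ?sqr_ge0//; nra.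
Qed.

End row_removal.

(** * Spectra with exponential weights *)

Section limits.
Context {R : realType}.

Lemma cvgn_le_cst (u : nat -> R) (l c : R) : u n @[n --> \oo] --> l ->
  (forall n, u n <= c) -> l <= c.
Proof.
move=> ul uc; have <- := cvg_lim (@Rhausdorff R) ul.
apply: limr_le; first by apply/cvg_ex; exists l.
exact: nearW.
Qed.

Lemma cvgn_sum (T : Type) (s : seq T) (u : T -> nat -> R) (l : T -> R) :
  (forall i, u i n @[n --> \oo] --> l i) ->
  \sum_(i <- s) u i n @[n --> \oo] --> \sum_(i <- s) l i.
Proof.
move=> ul; elim: s => [|i s ih].
  by rewrite big_nil; under eq_fun do rewrite big_nil; exact: cvg_cst.
by rewrite big_cons; under eq_fun do rewrite big_cons; exact: cvgD.
Qed.

End limits.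

Section exponential_weights.
Context {R : realType}.
Local Notation mu := (@lebesgue_measure R).
Implicit Types f g : R -> R.
Implicit Types x y h Y d : R.

Lemma wgt_sq d x : wgt d x ^+ 2 = wgt (d + d) x.
Proof. by rewrite wgtD expr2. Qed.

Lemma is_derive_wgt d x : 0 < d ->
  is_derive x (1:R) (fun x => - (2 * pi * d)^-1 * wgt d x) (wgt d x).
Proof.
move=> d0; rewrite /wgt.
have c0 : 2 * pi * d != 0 by rewrite !mulf_neq0// gt_eqF// pi_gt0.
have D : is_derive x (1:R) (fun x : R => - (2 * pi * d * x)) (- (2 * pi * d)).
  have -> : (fun x : R => - (2 * pi * d * x)) = (- (2 * pi * d)) \*: @id R.
    by apply/funext => z; rewrite -mulNr.
  by apply: is_derive_eq; rewrite /GRing.scale/= mulr1.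
have D2 := is_deriveZ (- (2 * pi * d)^-1)
  (@is_derive1_comp R expR _ x _ _ (is_derive_expR (- (2 * pi * d * x))) D).
apply: (is_derive_eq D2).
by rewrite /GRing.scale/= mulrCA mulrNN mulVf// mulr1.
Qed.

Lemma continuous_wgt d : continuous (wgt d : R -> R).
Proof.
move=> x; apply: (@continuous_comp _ _ _ (fun x : R => - (2 * pi * d * x)) expR).
  by apply: cvgN; apply: cvgMr; exact: cvg_id.
exact: continuous_expR.
Qed.

(** The bound matters as well as the finiteness: its growth for small d is
    one power of 1 / d. *)
Lemma L2_halfwgt d : 0 < d -> L2 (fun x => wgt d x * \1_halfline x) /\
  sqn (fun x => wgt d x * \1_halfline x) <= (4 * pi * d)^-1.
Proof.
move=> d0; pose v (n : nat) x : R := wgt d x * \1_(`[0, n.+1%:R[) x.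
have Lv n : L2 (v n).
  rewrite /v; apply: (L2_le (g := fun x => \1_(`[0%R, n.+1%:R[) x : R)).
  - apply: measurable_funM; first exact: measurable_wgt.
    exact: measurable_fun_indic.
  - move=> x; rewrite indicE; case: (boolP (x \in _)); last by rewrite mulr0 normr0.
    rewrite inE/= in_itv/= => /andP[x0 _]; rewrite mulr1 normr1 ger0_norm ?wgt_ge0//.
    by rewrite wgt_le1// ltW.
  - exact: L2_1_itv.
apply: (@sqn_fatou R v) => //.
- apply: measurable_funM; first exact: measurable_wgt.
  apply: measurable_fun_indic; exact: measurable_itv.
- apply: aeW => x; apply: (@cvg_near_cst _ _ _ _ _).
  near=> n; rewrite /v /= !indicE; congr (_ * _%:R).
  rewrite /halfline !mem_setE !in_itv/= andbT.
  case: (leP 0 x) => //= x0.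
  suff -> : x < n.+1%:R by [].
  apply: (@lt_le_trans _ _ n%:R); last by rewrite ler_nat.
  by near: n; exact: nbhs_infty_gtr.
- near=> n; rewrite /sqn.
  have -> : (fun x => v n x ^+ 2) = fun x => wgt (d + d) x * \1_(`[0, n.+1%:R[) x.
    by apply/funext => x; rewrite /v exprMn wgt_sq expr2 indic_sq.
  have dd : 0 < d + d by rewrite addr_gt0.
  have dF x : is_derive x (1:R) (fun x => - (2 * pi * (d + d))^-1 * wgt (d + d) x)
    (wgt (d + d) x) by exact: is_derive_wgt.
  have nn : (0:R) < n.+1%:R by rewrite ltr0n.
  rewrite (I_FTC nn (@continuous_wgt (d + d)) dF) !mulNr opprK addrC.
  set w := wgt _ n.+1%:R; rewrite /wgt mulr0 oppr0 expR0 mulr1.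
  have -> : 2 * pi * (d + d) = 4 * pi * d by ring.
  by rewrite gerBl mulr_ge0 ?wgt_ge0// invr_ge0 !mulr_ge0 ?pi_ge0// ltW.
Unshelve. all: by end_near. Qed.

(** Spectra on the half-line for which the analytic function is square
    integrable on the line of height h, hence on all lines above. *)
Definition hspec h f := supported halfline f /\ L2 (wmul h f).

Lemma wmul_add y z f : wmul (y + z) f = fun x => wmul y f x * wgt z x.
Proof. by apply/funext => x; rewrite /wmul wgtD mulrA. Qed.

Lemma hspec_L2 h Y f : h <= Y -> hspec h f -> L2 (wmul Y f).
Proof. by move=> hY [sf Lf]; exact: L2_wmul_le Lf. Qed.

Lemma hspec_le h Y f : h <= Y -> hspec h f -> hspec Y f.
Proof. by move=> hY hf; split; [case: hf|exact: hspec_L2 hf]. Qed.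

Lemma bspec_hspec h f : 0 <= h -> bspec f -> hspec h f.
Proof. by move=> h0 bf; split; [exact: bspec_half|exact: bspec_L2w]. Qed.

(** Strictly above the line of height h there remains a decreasing
    exponential, which is itself square integrable on the half-line. *)
Lemma hspec_intble h Y f : h < Y -> hspec h f -> intble (wmul Y f).
Proof.
move=> hY [sf Lf]; have d0 : 0 < Y - h by rewrite subr_gt0.
have := L2M Lf (L2_halfwgt d0).1; congr intble; apply/funext => x.
rewrite -[in RHS](subrK h Y) addrC wmul_add.
rewrite -[in RHS](supportedE sf) /wmul; ring.
Qed.

Lemma hspecD h f g : hspec h f -> hspec h g -> hspec h (fun x => f x + g x).
Proof.
move=> [sf Lf] [sg Lg]; split; last by rewrite wmulD; exact: L2D.
by move=> x xn; rewrite sf// sg// addr0.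
Qed.

Lemma hspecZ h k f : hspec h f -> hspec h (fun x => k * f x).
Proof.
move=> [sf Lf]; split; last by rewrite wmulZ; exact: L2Z.
by move=> x xn; rewrite sf// mulr0.
Qed.

Lemma hspecB h f g : hspec h f -> hspec h g -> hspec h (fun x => f x - g x).
Proof.
move=> [sf Lf] [sg Lg]; split; last by rewrite wmulB; exact: L2B.
by move=> x xn; rewrite sf// sg// subr0.
Qed.

Lemma wmul_trunc y f n : wmul y (trunc f n) = trunc (wmul y f) n.
Proof. by apply/funext => x; rewrite /wmul /trunc mulrAC. Qed.

Lemma bspec_trunc h f n : 0 <= h -> hspec h f -> bspec (trunc f n).
Proof.
move=> h0 [sf Lf]; split; last first.
  exists n.+1%:R => x xn; rewrite /trunc indicE mem_setE in_itv/=.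
  case: (boolP (_ <= x < _)) => [/andP[_ x1]|_]; last by rewrite mulr0.
  rewrite sf ?mul0r// /halfline/= in_itv/= andbT => x0.
  by apply: xn; rewrite /= in_itv/= x0.
have fE : f = fun x => wmul h f x * wgt (- h) x.
  by apply/funext => x; rewrite /wmul -mulrA -wgtD subrr /wgt mulr0 mul0r oppr0 expR0 mulr1.
apply: (L2_le (g := fun x => wgt (- h) n.+1%:R * trunc (wmul h f) n x)); last first.
- by apply: L2Z; exact: L2_trunc.
- move=> x; rewrite /trunc [in leLHS]fE mulrAC indicE mem_setE in_itv/=.
  case: (boolP (_ <= x < _)) => [/andP[_ x1]|_]; last by rewrite !(mulr0, mul0r).
  rewrite !mulr1 mulrC !normrM ler_wpM2r// !ger0_norm ?wgt_ge0// ler_expR.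
  rewrite lerN2 !mulrN !mulNr lerN2 ler_wpM2l//; last exact: ltW.
  by rewrite !mulr_ge0 ?pi_ge0.
- rewrite /trunc fE; apply: measurable_funM; last first.
    by apply: measurable_fun_indic; exact: measurable_itv.
  by apply: measurable_funM; [exact: L2_meas|exact: measurable_wgt].
Qed.

Lemma Hn_trunc_le h f n : hspec h f -> Hn h (trunc f n) <= Hn h f.
Proof.
move=> [sf Lf]; rewrite /Hn wmul_trunc; apply: le_sqn => //.
- by apply: L2_meas; exact: L2_trunc.
- by move=> x; exact: le_trunc.
Qed.

(** By truncation of the spectrum. *)
Lemma bessel_row beta Y h f : 0 < beta -> 0 <= h -> h < Y -> hspec h f ->
  (rowe beta Y f <= (bessel_cst beta Y h * Hn h f)%:E)%E.
Proof.
move=> b0 h0 hY hf; rewrite /rowe esum_int; last by move=> n; rewrite lee_fin FQ_ge0.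
apply: lime_le; first by apply: is_cvg_nneseries => n _ _; rewrite lee_fin FQ_ge0.
apply: nearW => N; rewrite sumEFin lee_fin.
set c := bessel_cst _ _ _.
have c0 : 0 <= c.
  rewrite /c /bessel_cst; have t0 : 0 < period beta Y.
    by rewrite invr_gt0 mulr_gt0// (le_lt_trans h0).
  rewrite mulr_ge0 ?ltW// invr_gt0 subr_gt0 expr_lt1// ?wgt_ge0//.
  by rewrite wgt_lt1// subr_gt0.
pose S g := \sum_(0 <= k < N) FQ (wmul Y g) ((int_enum k)%:~R * (beta * Y)).
have fi := hspec_intble hY hf.
have wlt n x : `|wmul Y (trunc f n) x| <= `|wmul Y f x|.
  by rewrite wmul_trunc; exact: le_trunc.
have cvw x : wmul Y (trunc f n) x @[n --> \oo] --> wmul Y f x.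
  by under eq_fun do rewrite wmul_trunc; exact: cvg_trunc.
have cv : S (trunc f n) @[n --> \oo] --> S f.
  apply: cvgn_sum => k.
  have [cC cS] := @FC_cvg R (fun n => wmul Y (trunc f n)) (wmul Y f)
    ((int_enum k)%:~R * (beta * Y))
    (fun n => bspec_iw (le_trans h0 (ltW hY)) (bspec_trunc n h0 hf)) fi
    cvw (fun n x => wlt n x).
  by rewrite /FQ; apply: cvgD; rewrite expr2; under eq_fun do rewrite expr2; exact: cvgM.
apply: (cvgn_le_cst cv) => n.
have bt := bspec_trunc n h0 hf.
apply: (@le_trans _ _ (rowr beta Y (trunc f n))); last first.
  apply: le_trans (bessel_rowr b0 h0 hY bt) _.
  by rewrite ler_wpM2l// Hn_trunc_le.
rewrite -lee_fin EFin_rowr//; last exact: le_lt_trans hY.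
rewrite /rowe esum_int; last by move=> k; rewrite lee_fin FQ_ge0.
rewrite /S -sumEFin; apply: nneseries_lim_ge => k _ _; by rewrite lee_fin FQ_ge0.
Qed.

Lemma hspec_EFin_rowr beta Y h f : 0 < beta -> 0 <= h -> h < Y -> hspec h f ->
  (rowr beta Y f)%:E = rowe beta Y f.
Proof.
move=> b0 h0 hY hf; rewrite fineK// ge0_fin_numE ?rowe_ge0//.
apply: le_lt_trans (bessel_row b0 h0 hY hf) _; exact: ltry.
Qed.

End exponential_weights.

(** * Norm estimates from several rows *)

Section rows_bound.
Context {R : realType}.
Local Notation mu := (@lebesgue_measure R).
Implicit Types f g phi : R -> R.
Implicit Types x y h Y d beta : R.

Lemma blaschke_bound_ge0 beta h y Y : 0 <= blaschke_bound beta h y Y.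
Proof. by rewrite divr_ge0 ?addr_ge0 ?mulr_ge0 ?wgt_ge0. Qed.

Lemma blaschke_bound_le1 beta h y Y : 0 < beta -> h < Y -> 0 <= h -> h <= y -> blaschke_bound beta h y Y <= 1.
Proof.
move=> b0 hY h0 hy; have t0 : 0 <= period beta Y.
  by rewrite invr_ge0 mulr_ge0 ?ltW// (le_lt_trans h0).
rewrite ler_pdivrMr ?mul1r; last by rewrite ltr_pwDl ?mulr_ge0 ?wgt_ge0.
have t1 : wgt (y - h) (period beta Y) <= 1 by rewrite wgt_le1// subr_ge0.
have l1 : wgt (Y - h) (period beta Y) <= 1 by rewrite wgt_le1// subr_ge0 ltW.
rewrite -subr_ge0; set t := wgt _ _ in t1 *; set l := wgt _ _ in l1 *.
have -> : 1 + t * l - (t + l) = (1 - t) * (1 - l) by ring.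
by rewrite mulr_ge0// subr_ge0.
Qed.

Lemma blaschke_bound_le beta h y Y : blaschke_bound beta h y Y <=
  wgt (y - h) (period beta Y) + wgt (Y - h) (period beta Y).
Proof.
rewrite ler_pdivrMr; last by rewrite ltr_pwDl ?mulr_ge0 ?wgt_ge0.
by rewrite ler_peMr ?addr_ge0 ?wgt_ge0// lerDl mulr_ge0 ?wgt_ge0.
Qed.

Lemma bessel_cst_ge0 beta Y h : 0 < beta -> 0 <= h -> h < Y -> 0 <= bessel_cst beta Y h.
Proof.
move=> b0 h0 hY; have t0 : 0 < period beta Y.
  by rewrite invr_gt0 mulr_gt0// (le_lt_trans h0).
rewrite mulr_ge0 ?ltW// invr_gt0 subr_gt0 expr_lt1// ?wgt_ge0//.
by rewrite wgt_lt1// subr_gt0.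
Qed.

Lemma HnN y f : Hn y (fun x => -1 * f x) = Hn y f.
Proof. by rewrite /Hn -[RHS]sqnN; congr sqn; apply/funext => x; rewrite /wmul mulN1r mulNr. Qed.

(** With b and d at most 1, (1 + d)^2 b (P + d) exceeds b P by at most d (3
    P + 4). *)
Lemma choose_slack (b P E : R) : 0 <= b -> b <= 1 -> 0 <= P -> b * P < E ->
  exists2 d : R, 0 < d & (1 + d) ^+ 2 * b * (P + d) <= E.
Proof.
move=> b0 b1 P0 bE; pose d0 := (E - b * P) / (3 * P + 4).
have D0 : 0 < 3 * P + 4 by rewrite ltr_wpDl// mulr_ge0.
have d00 : 0 < d0 by rewrite divr_gt0// subr_gt0.
exists (Num.min 1 d0); first by rewrite lt_min ltr01 d00.
set d := Num.min 1 d0.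
have d1 : d <= 1 by rewrite ge_min lexx.
have dd0 : d <= d0 by rewrite ge_min lexx orbT.
have dpos : 0 < d by rewrite lt_min ltr01 d00.
have h : d * (3 * P + 4) <= E - b * P by rewrite -ler_pdivlMr.
apply: (@le_trans _ _ (b * P + d * (3 * P + 4))); last by rewrite -lerBrDl.
have h1 : (1 + d) ^+ 2 <= 1 + 3 * d by nra.
have bPd : 0 <= b * (P + d) by rewrite mulr_ge0// addr_ge0// ltW.
rewrite -mulrA; apply: le_trans (ler_wpM2r bPd h1) _.
have h2 : b * (P * d) <= P * d by rewrite ler_piMl// mulr_ge0// ltW.
have h3 : b * d <= d by rewrite ler_piMl// ltW.
have h4 : b * d * d <= d by apply: le_trans h3; rewrite ler_piMr// mulr_ge0// ltW.
nra.
Qed.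

(** The rows are removed one at a time by row_step. Each splitting into
    product and remainder costs a factor (1 + d), with d as small as
    needed, so that the factor in front of the norm on the line of height h
    is any number larger than the product of the Blaschke bounds. *)
Lemma rows_bound beta h y (Ys : seq R) : 0 < beta -> 0 <= h -> h <= y ->
  all (fun Y => h < Y) Ys -> uniq Ys ->
  forall E : R, \prod_(Y <- Ys) blaschke_bound beta h y Y ^+ 2 < E ->
  exists2 C : R, 0 <= C & forall phi, bspec phi ->
    Hn y phi <= C * \sum_(Y <- Ys) rowr beta Y phi + E * Hn h phi.
Proof.
move=> b0 h0 hy; elim: Ys => [_ _ E|Y Ys ih /= /andP[hY hYs] /andP[YYs uYs] E].
  rewrite big_nil => E1; exists 0 => // phi bp; rewrite mul0r add0r.
  apply: (@le_trans _ _ (Hn h phi)).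
    by apply: Hn_le => //; [exact: bspec_half|exact: bspec_L2w].
  by apply: ler_peMl; [exact: sqn_ge0|exact: ltW].
rewrite big_cons; set b := blaschke_bound _ _ _ _ ^+ 2; set P := \prod_(_ <- _) _ => bPE.
have bb0 : 0 <= b by exact: sqr_ge0.
have bb1 : b <= 1 by rewrite expr_le1 ?blaschke_bound_ge0// blaschke_bound_le1.
have P0 : 0 <= P by apply: prodr_ge0 => *; exact: sqr_ge0.
have [d d0 dE] := choose_slack bb0 bb1 P0 bPE.
have [|C' C'0 HC'] := ih hYs uYs (P + d); first by rewrite ltrDl.
have [K K0 [K2 K20 step]] := row_step b0 h0 hY hy.
have Y0 : 0 < Y := le_lt_trans h0 hY.
(* M bounds the samples of the quotient phi1 on the remaining rows: they
   are comparable with those of u = phi - r, and Bessel's inequality bounds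
   those of r. *)
pose M := \sum_(Y' <- Ys) K2 Y' * (2 * (1 + bessel_cst beta Y' h * K)).
have Bc Y' : Y' \in Ys -> 0 <= bessel_cst beta Y' h.
  by move=> /(allP hYs) h'; exact: bessel_cst_ge0.
have M0 : 0 <= M.
  rewrite /M big_seq; apply: sumr_ge0 => Y' /Bc B0.
  by rewrite !mulr_ge0// addr_ge0// mulr_ge0.
have di0 : 0 <= 1 + d^-1 by rewrite addr_ge0// invr_ge0 ltW.
have d1 : 0 <= 1 + d by rewrite addr_ge0// ltW.
pose C := (1 + d) * (b * (C' * M + (P + d) * ((1 + d^-1) * K))) + (1 + d^-1) * K.
have Pd : 0 <= P + d by rewrite addr_ge0// ltW.
have C0 : 0 <= C.
  apply: addr_ge0; last exact: mulr_ge0.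
  by do 2 apply: mulr_ge0 => //; apply: addr_ge0; apply: mulr_ge0 => //; exact: mulr_ge0.
exists C => // phi bp.
have [u [r [phi1 [[bu br bp1 phiE] [Hr Hp1 Hu rows]]]]] := step _ bp.
set S := \sum_(_ <- _) _.
have SE : S = rowr beta Y phi + \sum_(Y' <- Ys) rowr beta Y' phi by rewrite /S big_cons.
have YS : rowr beta Y phi <= S.
  by rewrite SE lerDl sumr_ge0// => *; exact: rowr_ge0.
have S0 : 0 <= S by apply: le_trans YS; exact: rowr_ge0.
have Y'S Y' : Y' \in Ys -> rowr beta Y' phi <= S.
  move=> Y'Ys; rewrite SE (big_rem Y')//= addrCA lerDl addr_ge0 ?rowr_ge0//.
  by apply: sumr_ge0 => *; exact: rowr_ge0.
have Hr' : Hn h r <= K * S by apply: le_trans Hr _; rewrite ler_wpM2l.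
have Hyr : Hn y r <= K * S.
  apply: le_trans Hr'; apply: Hn_le => //; [exact: bspec_half|exact: bspec_L2w].
have y0 : 0 <= y := le_trans h0 hy.
have Hyphi : Hn y phi <= (1 + d) * Hn y u + (1 + d^-1) * Hn y r.
  rewrite {1}phiE /Hn wmulD; apply: sqnD_young => //; exact: bspec_L2w.
have Hhu : Hn h u <= (1 + d) * Hn h phi + (1 + d^-1) * Hn h r.
  have -> : u = fun x => phi x + (-1) * r x.
    by apply/funext => x; rewrite phiE mulN1r addrK.
  rewrite /Hn wmulD; apply: le_trans (sqnD_young d0 _ _) _; try exact: bspec_L2w.
    by apply: bspec_L2w => //; exact: bspecZ.
  have -> : sqn (wmul h r) = sqn (wmul h (fun x => -1 * r x)) by exact/esym/HnN.
  exact: lexx.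
have rowsS : \sum_(Y' <- Ys) rowr beta Y' phi1 <= M * S.
  rewrite /M mulr_suml big_seq [X in _ <= X]big_seq; apply: ler_sum => Y' Y'Ys.
  have hY' : h < Y' by exact: (allP hYs).
  have Y'0 : 0 < Y' := le_lt_trans h0 hY'.
  have Y'Y : Y' != Y by apply: contraNneq YYs => <-.
  apply: le_trans (rowr_le b0 Y'0 bp1 bu (K20 Y') _) _.
    by move=> xi; exact: rows.
  rewrite -mulrA ler_wpM2l//.
  have -> : u = fun x => phi x + (-1) * r x.
    by apply/funext => x; rewrite phiE mulN1r addrK.
  have bNr := bspecZ (-1) br.
  apply: le_trans (rowr_D b0 Y'0 bp bNr) _.
  rewrite -mulrA ler_wpM2l// mulrDl mul1r lerD//; first exact: Y'S.
  apply: le_trans (bessel_rowr b0 h0 hY' bNr) _.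
  by rewrite -mulrA (HnN h r); apply: ler_wpM2l; [exact: Bc|exact: Hr'].
have Hyu : Hn y u <= b * (C' * (M * S) + (P + d) * ((1 + d) * Hn h phi + (1 + d^-1) * (K * S))).
  apply: le_trans Hu _; rewrite ler_wpM2l//.
  apply: le_trans (HC' _ bp1) _; apply: lerD; first by rewrite ler_wpM2l.
  rewrite ler_wpM2l// Hp1; apply: le_trans Hhu _.
  by rewrite lerD2l; apply: ler_wpM2l; [exact: di0|exact: Hr'].
apply: le_trans Hyphi _.
apply: (@le_trans _ _ ((1 + d) * (b * (C' * (M * S) + (P + d) *
    ((1 + d) * Hn h phi + (1 + d^-1) * (K * S)))) + (1 + d^-1) * (K * S))).
  by apply: lerD; rewrite ler_wpM2l.
rewrite (_ : _ + _ = C * S + (1 + d) ^+ 2 * b * (P + d) * Hn h phi); last by rewrite /C; ring.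
by rewrite lerD2l ler_wpM2r// sqn_ge0.
Qed.

End rows_bound.

Section geometric_rows.
Context {R : realType}.
Variables (beta a : R).
Hypotheses (b0 : 0 < beta) (a1 : 1 < a).

Let a0 : 0 < a. Proof. exact: lt_trans a1. Qed.

(** Bernoulli's inequality. *)
Lemma expr_ge_linear i : i%:R * (a - 1) <= a ^+ i - 1.
Proof.
elim: i => [|i ih]; first by rewrite mul0r expr0 subrr.
have a11 : 0 <= a - 1 by rewrite subr_ge0 ltW.
rewrite -natr1 mulrDl mul1r exprS.
have -> : a * a ^+ i - 1 = (a ^+ i - 1) + (a - 1) + (a - 1) * (a ^+ i - 1) by ring.
rewrite -[X in X <= _]addr0 lerD//; first by rewrite lerD2r.
by rewrite mulr_ge0// (le_trans _ ih)// mulr_ge0.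
Qed.

Lemma sum_geometric_le (q : R) j : 0 <= q -> q < 1 ->
  \sum_(0 <= i < j) q ^+ i <= (1 - q)^-1.
Proof.
move=> q0 q1; have q1' : 0 < 1 - q by rewrite subr_gt0.
rewrite -[X in _ <= X]mul1r ler_pdivlMr// mulrC.
have -> : (1 - q) * (\sum_(0 <= i < j) q ^+ i) = 1 - q ^+ j.
  elim: j => [|j ih]; first by rewrite big_nil mulr0 expr0 subrr.
  by rewrite big_nat_recr//= mulrDr ih exprS; ring.
by rewrite gerBl exprn_ge0.
Qed.

Let c : R := 2 * pi / beta.
Let c0 : 0 < c. Proof. by rewrite divr_gt0 ?mulr_gt0// pi_gt0. Qed.
Let q : R := expR (- (c * (a - 1))).
Let q1 : q < 1.
Proof. by rewrite expR_lt1 oppr_lt0 mulr_gt0// subr_gt0. Qed.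

(** The main factor exp (- c) is the limit of the weight of the row a^-i
    when h = a^-j becomes small; the two corrections are summable over i. *)
Lemma blaschke_bound_geometric i j : (i < j)%N ->
  blaschke_bound beta (a ^- j) 1 (a ^- i) <=
    expR (- c + c * (a ^- j * a ^+ i) + q ^+ i).
Proof.
move=> ij; apply: le_trans (blaschke_bound_le _ _ _ _) _.
have ai : a ^+ i != 0 by rewrite gt_eqF// exprn_gt0.
have pE : period beta (a ^- i) = a ^+ i / beta.
  by rewrite /period invfM invrK mulrC.
rewrite pE.
set l := wgt (a ^- i - _) _.
have lE : l = expR (- c + c * (a ^- j * a ^+ i)).
  rewrite /l /wgt; congr expR; rewrite /c; field.
  by rewrite ai !gt_eqF// exprn_gt0.
have tE : wgt (1 - a ^- j) (a ^+ i / beta) = l * expR (- (c * (a ^+ i - 1))).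
  rewrite lE /wgt -expRD; congr expR; rewrite /c; field.
  by rewrite !gt_eqF// exprn_gt0.
rewrite tE expRD -lE.
rewrite -[X in _ + X]mulr1 -mulrDr ler_wpM2l ?wgt_ge0//.
apply: (@le_trans _ _ (1 + q ^+ i)); last exact: expR_ge1Dx.
rewrite addrC lerD2l /q -expRM_natl ler_expR mulrN lerN2 mulrCA.
by apply: ler_wpM2l; [exact: ltW|exact: expr_ge_linear].
Qed.

Lemma prod_blaschke_bound_geometric j :
  \prod_(0 <= i < j) blaschke_bound beta (a ^- j) 1 (a ^- i) <=
    expR ((1 - q)^-1 + c / (a - 1)) * expR (- c * j%:R).
Proof.
apply: (@le_trans _ _ (\prod_(0 <= i < j) expR (- c + c * (a ^- j * a ^+ i) + q ^+ i))).
  rewrite big_nat_cond [X in _ <= X]big_nat_cond; apply: ler_prod => i.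
  by rewrite andbT => /andP[_ ij]; rewrite blaschke_bound_ge0/= blaschke_bound_geometric.
rewrite -expR_sum -expRD ler_expR !big_split/= sumr_const_nat subn0 -mulr_sumr -mulr_sumr.
rewrite -[_ *+ j]mulr_natr.
have h1 := sum_geometric_le j (expR_ge0 _) q1.
have h2 : a ^- j * (\sum_(0 <= i < j) a ^+ i) <= (a - 1)^-1.
  have a10 : 0 < a - 1 by rewrite subr_gt0.
  have aj : 0 < a ^+ j by rewrite exprn_gt0.
  have e : (a - 1) * (\sum_(0 <= i < j) a ^+ i) = a ^+ j - 1.
    elim: (j) => [|k ih]; first by rewrite big_nil mulr0 expr0 subrr.
    by rewrite big_nat_recr//= mulrDr ih exprS; ring.
  rewrite -[X in _ <= X]mul1r ler_pdivlMr// -mulrA mulrC ler_pdivrMr// mul1r mulrC e.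
  by rewrite gerBl.
have := ler_wpM2l (ltW c0) h2; rewrite -/q in h1; lra.
Qed.

(** Between the heights a^-j and 1 the rows shrink the energy by the square
    of the product of their Blaschke bounds, which is of the order of exp
    (- 2 pi j / beta). Truncating the spectrum extends the estimate from
    bounded support. *)
Lemma rows_decay : exists2 K : R, 0 < K & forall j : nat,
  exists2 C : R, 0 <= C & forall phi, hspec (a ^- j) phi ->
    Hn 1 phi <= C * \sum_(0 <= i < j) rowr beta (a ^- i) phi +
      K * expR (- (4 * pi / beta) * j%:R) * Hn (a ^- j) phi.
Proof.
pose K0 := expR ((1 - q)^-1 + c / (a - 1)).
exists (K0 ^+ 2 + 1); first by rewrite ltr_wpDl// sqr_ge0.
move=> j; set E := _ * expR _.
pose Ys := [seq a ^- i | i <- index_iota 0 j].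
have h0 : 0 <= a ^- j by rewrite invr_ge0 exprn_ge0// ltW.
have h1 : a ^- j <= 1 by rewrite invf_le1 ?exprn_gt0// exprn_ege1// ltW.
have hi i : (i < j)%N -> a ^- j < a ^- i.
  by move=> ij; rewrite ltf_pV2 ?posrE ?exprn_gt0// ltr_eXn2l.
have aYs : all (fun Y => a ^- j < Y) Ys.
  by rewrite all_map; apply/allP => i; rewrite mem_index_iota => /andP[_ ij]; exact: hi.
have uYs : uniq Ys.
  rewrite map_inj_in_uniq ?iota_uniq// => i k _ _ /invr_inj.
  by apply: ieexprIn => //; rewrite gt_eqF.
have PE : \prod_(Y <- Ys) blaschke_bound beta (a ^- j) 1 Y ^+ 2 < E.
  rewrite big_map prodrXl.
  have := prod_blaschke_bound_geometric j; rewrite -/K0; set P := \prod_(_ <- _) _ => hP.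
  have P0 : 0 <= P by apply: prodr_ge0 => i _; exact: blaschke_bound_ge0.
  apply: (@le_lt_trans _ _ (K0 ^+ 2 * expR (- (4 * pi / beta) * j%:R))).
    have -> : expR (- (4 * pi / beta) * j%:R) = expR (- c * j%:R) ^+ 2.
      by rewrite -expRM_natl; congr expR; rewrite /c; field; rewrite gt_eqF.
    by rewrite -exprMn lerXn2r// nnegrE mulr_ge0 ?expR_ge0.
  by rewrite /E ltr_pM2r ?expR_gt0// ltrDl.
have [C C0 HC] := rows_bound b0 h0 h1 aYs uYs PE.
exists (C * 2) => [|phi hp]; first by rewrite mulr_ge0.
have E0 : 0 <= E by rewrite mulr_ge0 ?expR_ge0// addr_ge0// sqr_ge0.
pose B := \sum_(0 <= i < j) bessel_cst beta (a ^- i) (a ^- j).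
pose e n := Hn (a ^- j) (fun x => trunc phi n x - phi x).
have Lt y n : a ^- j <= y -> L2 (wmul y (trunc phi n)).
  move=> hy; apply: bspec_L2w; [exact: le_trans hy|exact: bspec_trunc h0 hp].
have cvt y : a ^- j <= y -> L2cvg (fun n => wmul y (trunc phi n)) (wmul y phi).
  move=> hy; under eq_fun do rewrite wmul_trunc.
  by apply: L2cvg_trunc; exact: hspec_L2 hp.
have ecv : e n @[n --> \oo] --> 0.
  by have := cvt _ (lexx _); rewrite /L2cvg /e /Hn; under [in X in _ -> X]eq_fun do rewrite wmulB.
have key n : Hn 1 (trunc phi n) <=
    C * 2 * (\sum_(0 <= i < j) rowr beta (a ^- i) phi) + E * Hn (a ^- j) phi + C * 2 * B * e n.
  have bt := bspec_trunc n h0 hp.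
  apply: le_trans (HC _ bt) _; rewrite big_map addrAC; apply: lerD; last first.
    by rewrite ler_wpM2l// Hn_trunc_le.
  rewrite -!mulrA -mulrDr ler_wpM2l// -mulrDr mulr_suml -big_split/= mulr_sumr.
  rewrite big_nat_cond [X in _ <= X]big_nat_cond; apply: ler_sum => i.
  rewrite andbT => /andP[_ ij]; have Yi := hi _ ij.
  have Yi0 : 0 < a ^- i by exact: le_lt_trans Yi.
  have hd := hspecB (bspec_hspec h0 bt) hp.
  have ht := bspec_hspec h0 bt.
  apply: (@le_trans _ _ (2 * (rowr beta (a ^- i) phi +
     rowr beta (a ^- i) (fun x => trunc phi n x - phi x)))); last first.
    rewrite ler_wpM2l// lerD2l -lee_fin (hspec_EFin_rowr b0 h0 Yi hd).
    exact: bessel_row.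
  have hDi := hspec_intble Yi hd; have hfi := hspec_intble Yi hp.
  have hti := hspec_intble Yi ht.
  rewrite -lee_fin EFinM (EFinD (rowr _ _ _)) (hspec_EFin_rowr b0 h0 Yi hd).
  rewrite (hspec_EFin_rowr b0 h0 Yi hp) (hspec_EFin_rowr b0 h0 Yi ht).
  rewrite /rowe -esumD; [|by move=> *; rewrite lee_fin FQ_ge0..].
  rewrite -esum_intZl//; last by move=> m; rewrite adde_ge0// lee_fin FQ_ge0.
  apply: le_esum => m _; rewrite -EFinD -EFinM lee_fin /FQ wmulB FCB// FSB//.
  set A := FC _ _; set A' := FC _ _; set S := FS _ _; set S' := FS _ _.
  have := sqr_ge0 (A - 2 * A'); have := sqr_ge0 (S - 2 * S'); nra.
have L1 : Hn 1 (trunc phi n) @[n --> \oo] --> Hn 1 phi.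
  apply: sqn_cvg; [by move=> n; exact: Lt|exact: hspec_L2 hp|exact: cvt].
have L2 : C * 2 * (\sum_(0 <= i < j) rowr beta (a ^- i) phi) + E * Hn (a ^- j) phi
   + C * 2 * B * e n @[n --> \oo] -->
   C * 2 * (\sum_(0 <= i < j) rowr beta (a ^- i) phi) + E * Hn (a ^- j) phi + C * 2 * B * 0.
  by apply: cvgD; [exact: cvg_cst|apply: cvgMr].
rewrite mulr0 addr0 in L2.
rewrite -(cvg_lim (@Rhausdorff R) L1) -(cvg_lim (@Rhausdorff R) L2).
apply: ler_lim; [by apply/cvg_ex; eexists; exact: L1|by apply/cvg_ex; eexists; exact: L2|].
exact: nearW.
Qed.

End geometric_rows.

(** * The spectral frame inequality *)

Section power_weights.
Context {R : realType}.
Local Notation mu := (@lebesgue_measure R).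
Implicit Types A f g psi : R -> R.
Implicit Types x y p r c s : R.

(** The maximum of s^r exp (- c s) is attained at s = r / c, where it is at
    most this value. *)
Lemma powR_expR_le r c s : 0 < r -> 0 < c -> 0 <= s ->
  s `^ r * expR (- (c * s)) <= (r / c) `^ r.
Proof.
move=> r0 c0; rewrite le_eqVlt => /predU1P[<-|s0].
  by rewrite powR0 ?gt_eqF// mul0r powR_ge0.
have rc0 : 0 < r / c by rewrite divr_gt0.
rewrite /powR !gt_eqF// -expRD ler_expR.
have t0 : 0 < s / (r / c) by rewrite divr_gt0.
have := ln_sublinear t0; rewrite ln_div ?posrE// => h.
have -> : c * s = r * (s / (r / c)) by field; rewrite !gt_eqF.
by rewrite -mulrBr ler_wpM2l ?(ltW r0)// lerBlDr -lerBlDl ltW.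
Qed.

(** The factor x^p comes from the Fourier transform of the Poisson wavelet. *)
Definition pspec p A x := x `^ p * A x.

Definition posline : set R := `]0%R, +oo[.

Lemma supported_pos_half A : supported posline A -> supported halfline A.
Proof.
move=> sA x xn; apply: sA => h; apply: xn; move: h.
by rewrite /posline /halfline /= !in_itv/= !andbT; exact: ltW.
Qed.

Lemma hspec_pspec p y A : 0 < p -> 0 < y -> L2 A -> supported posline A ->
  hspec y (pspec p A).
Proof.
move=> p0 y0 LA sA; have c0 : 0 < 2 * pi * y by rewrite !mulr_gt0// pi_gt0.
split; first by move=> x xn; rewrite /pspec (supported_pos_half sA)// mulr0.
apply: (L2_le (g := fun x => (p / (2 * pi * y)) `^ p * A x)); last exact: L2Z.
  apply: measurable_wmul; apply: measurable_funM; last exact: L2_meas.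
  exact: measurable_powR.
move=> x; have [x0|x0] := leP 0 x; last first.
  rewrite /wmul /pspec sA ?mulr0 ?mul0r// /posline/= in_itv/= andbT => x0'.
  by have := lt_trans x0 x0'; rewrite ltxx.
rewrite /wmul /pspec mulrAC !normrM ler_wpM2r//.
rewrite -normrM !ger0_norm ?mulr_ge0 ?powR_ge0 ?wgt_ge0//.
exact: powR_expR_le.
Qed.

(** The weighted energy at height theta a is the integral of A^2 against
    this density, see Hn_gker. *)
Definition gker p (theta : R) (a x : R) : R := (a * x) `^ (2 * p) * wgt (theta + theta) (a * x).

Lemma gker_ge0 p theta a x : 0 <= gker p theta a x.
Proof. by rewrite mulr_ge0 ?powR_ge0 ?wgt_ge0. Qed.

Lemma measurable_gker p theta a : measurable_fun setT (gker p theta a).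
Proof.
have m : measurable_fun setT (fun x : R => a * x) by exact: mulrl_measurable.
apply: measurable_funM; first exact: (measurableT_comp (measurable_powR _)).
exact: (measurableT_comp (measurable_wgt _)).
Qed.

Lemma Hn_gker p theta a A : 0 < p -> 0 < theta -> 0 < a -> L2 A -> supported posline A ->
  (a `^ (2 * p) * Hn (theta * a) (pspec p A))%:E =
  (\int[mu]_x (gker p theta a x * A x ^+ 2)%:E)%E.
Proof.
move=> p0 t0 a0 LA sA.
have [sf Lf] := hspec_pspec p0 (mulr_gt0 t0 a0) LA sA.
rewrite /Hn /sqn -IZ; last exact: Lf.2.
rewrite EFin_I; last by apply: intbleZ; exact: Lf.2.
apply: eq_integral => x _; congr EFin; rewrite /gker /wmul /pspec.
have [x0|x0] := ltP 0 x; last first.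
  by rewrite sA ?(mulr0, mul0r, expr0n)// /posline/= in_itv/= andbT => /(le_lt_trans x0); rewrite ltxx.
rewrite powRM ?(ltW a0) ?(ltW x0)// !exprMn wgt_sq.
have -> : x `^ p ^+ 2 = x `^ (2 * p).
  by rewrite -powR_mulrn ?powR_ge0// -powRrM mulrC.
have -> : wgt (theta * a + theta * a) x = wgt (theta + theta) (a * x).
  by rewrite /wgt; congr expR; ring.
ring.
Qed.

Lemma gker_le_small p theta s : 0 < theta -> 0 < s -> s `^ (2 * p) * wgt (theta + theta) s <= s `^ (2 * p).
Proof.
by move=> t0 s0; rewrite ler_piMr ?powR_ge0// wgt_le1// ltW// addr_gt0.
Qed.

Lemma gker_le_large p theta s : 0 < p -> 0 < theta -> 0 < s ->
  s `^ (2 * p) * wgt (theta + theta) s <=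
  (4 * p / (2 * pi * (theta + theta))) `^ (4 * p) * s `^ (- (2 * p)).
Proof.
move=> p0 t0 s0; have q0 : 0 < 4 * p by rewrite mulr_gt0.
have c0 : 0 < 2 * pi * (theta + theta) by rewrite !mulr_gt0 ?pi_gt0// addr_gt0.
have -> : s `^ (2 * p) = s `^ (4 * p) * s `^ (- (2 * p)).
  rewrite -powRD; last by rewrite (gt_eqF s0) implybT.
  by have -> : 4 * p + - (2 * p) = 2 * p by ring.
by rewrite mulrAC ler_wpM2r ?powR_ge0// powR_expR_le// ltW.
Qed.

Lemma esum_ge_term (T : choiceType) (k : T) (a : T -> \bar R) : (forall n, 0 <= a n)%E ->
  (a k <= \esum_(n in [set: T]) a n)%E.
Proof.
move=> a0; apply: esum_ge; exists [set k]; first by split.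
by rewrite fsbig_set1.
Qed.

(** The exponent 2 |k| is at least the index of k in the enumeration of the
    integers, which gives a plain geometric series. *)
Lemma esum_int_geometric (u : int -> R) (C s : R) : 0 <= s -> s < 1 -> 0 <= C ->
  (forall k, 0 <= u k) -> (forall k, u k <= C * (s ^+ 2) ^+ `|k|%N) ->
  (\esum_(k in [set: int]) (u k)%:E <= (C / (1 - s))%:E)%E.
Proof.
move=> s0 s1 C0 u0 uC; rewrite esum_int; last by move=> k; rewrite lee_fin.
apply: lime_le; first by apply: is_cvg_nneseries => n _ _; rewrite lee_fin.
apply: nearW => N; rewrite sumEFin lee_fin.
apply: (@le_trans _ _ (\sum_(0 <= k < N) C * s ^+ k)).
  apply: ler_sum => k _; apply: le_trans (uC _) _; rewrite ler_wpM2l// -exprM.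
  rewrite ler_wiXn2l ?(ltW s1)// /int_enum.
  by have := odd_double_half k; case: odd => /=; lia.
rewrite -mulr_sumr ler_wpM2l//; exact: sum_geometric_le.
Qed.

Lemma exprz_expR (a : R) (m : int) : 0 < a -> a ^ m = expR (m%:~R * ln a).
Proof. by move=> a0; rewrite -powR_intmul ?(ltW a0)// /powR gt_eqF. Qed.

(** The powers of a move each point into the fundamental domain [1, a[. *)
Lemma geometric_cell (a x : R) : 1 < a -> 0 < x ->
  exists m : int, 1 <= x * a ^ m /\ x * a ^ m < a.
Proof.
move=> a1 x0; have a0 : 0 < a by exact: lt_trans a1.
have l0 : 0 < ln a by rewrite ln_gt0.
exists (- Num.floor (ln x / ln a)).
set m := Num.floor _; rewrite exprz_expR// mulrNz.
have -> : x * expR (- m%:~R * ln a) = expR (ln x - m%:~R * ln a).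
  by rewrite expRD lnK ?posrE// mulNr.
have /andP[h1 h2] : m%:~R <= ln x / ln a < (m + 1)%:~R.
  by rewrite floor_le lt_succ_floor.
rewrite ler_pdivlMr// in h1; rewrite ltr_pdivrMr// in h2.
split; first by rewrite -[X in X <= _]expR0 ler_expR subr_ge0.
by rewrite -[X in _ < X]lnK ?posrE// ltr_expR ltrBlDr; move: h2; rewrite intrD mulrDl mul1r addrC.
Qed.

Lemma gker_shift p theta (a x : R) (k m : int) : 0 < a ->
  gker p theta (a ^ (k + m)) x = gker p theta (a ^ k) (x * a ^ m).
Proof.
move=> a0; rewrite /gker expfzDr ?gt_eqF//.
by have -> : a ^ k * a ^ m * x = a ^ k * (x * a ^ m) by ring.
Qed.

(** The sum over the heights a^k is invariant under x -> a x, so that x may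
    be assumed in the fundamental domain [1, a[; there the terms decrease
    geometrically on both sides. *)
Lemma gker_sum p theta (a : R) : 0 < p -> 0 < theta -> 1 < a ->
  exists c1 c2 : R, [/\ 0 < c1, 0 < c2 & forall x, 0 < x ->
   (c1%:E <= \esum_(k in [set: int]) (gker p theta (a ^ k) x)%:E)%E /\
   (\esum_(k in [set: int]) (gker p theta (a ^ k) x)%:E <= c2%:E)%E].
Proof.
move=> p0 t0 a1; have a0 : 0 < a by exact: lt_trans a1.
pose s := a `^ (- p); have s0 : 0 < s by exact: powR_gt0.
have s1 : s < 1 by rewrite /s powRN invf_lt1 ?powR_gt0// /powR gt_eqF// expR_gt1 mulr_gt0// ln_gt0.
pose C1 := (4 * p / (2 * pi * (theta + theta))) `^ (4 * p).
pose C := C1 + a `^ (2 * p).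
have C0 : 0 < C by rewrite ltr_wpDl ?powR_ge0// powR_gt0.
exists (wgt (theta + theta) a), (C / (1 - s)); split; [exact: wgt_gt0|by rewrite divr_gt0// subr_gt0|].
move=> x x0; have [m [T1 Ta]] := geometric_cell a1 x0.
set T := x * a ^ m in T1 Ta.
have T0 : 0 < T by exact: lt_le_trans T1.
rewrite -(esum_int_shift (fun k => (gker p theta (a ^ k) x)%:E) m).
under eq_esum do rewrite gker_shift//.
rewrite -/T; split.
  apply: (@le_trans _ _ (gker p theta (a ^ 0) T)%:E).
    rewrite lee_fin /gker expr0z mul1r -[X in X <= _]mul1r ler_pM ?wgt_ge0//.
      rewrite /powR (gt_eqF T0) -[X in X <= _]expR0 ler_expR mulr_ge0 ?ln_ge0//.
      by rewrite mulr_ge0// ltW.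
    by rewrite ler_expR lerN2 ler_wpM2l ?(ltW Ta)// !mulr_ge0 ?pi_ge0// addr_ge0// ltW.
  apply: (esum_ge_term (0:int) (a := fun k : int => (gker p theta (a ^ k) T)%:E)) => k;
  by rewrite lee_fin gker_ge0.
apply: esum_int_geometric => //; try exact: ltW; first by move=> k; exact: gker_ge0.
pose L := ln a; pose t := ln T.
have t00 : 0 <= t by rewrite ln_ge0.
have tL : t <= L by rewrite ler_ln ?posrE// ltW.
have aE k : a ^ k * T = expR (k%:~R * L + t).
  by rewrite exprz_expR// expRD /t (lnK T0).
have sE n : (s ^+ 2) ^+ n = expR (n%:R * (2%:R * (- p * L))).
  by rewrite !expRM_natl /s /powR gt_eqF.
case=> n.
  rewrite absz_nat; apply: (@le_trans _ _ (C1 * (a ^ n * T) `^ (- (2 * p)))).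
    by apply: gker_le_large => //; rewrite mulr_gt0// exprz_gt0.
  apply: (@le_trans _ _ (C1 * (s ^+ 2) ^+ n)); last first.
    by apply: ler_wpM2r; [rewrite exprn_ge0// sqr_ge0|rewrite /C lerDl powR_ge0].
  rewrite ler_wpM2l ?powR_ge0// sE aE -expRM ler_expR -subr_ge0.
  rewrite (_ : _ - _ = 2 * (p * t)); last by rewrite -pmulrn; ring.
  by rewrite !mulr_ge0// ltW.
rewrite NegzE abszN absz_nat.
apply: (@le_trans _ _ ((a ^ (- n.+1%:Z) * T) `^ (2 * p))).
  by apply: gker_le_small => //; rewrite mulr_gt0// exprz_gt0.
apply: (@le_trans _ _ (a `^ (2 * p) * (s ^+ 2) ^+ n.+1)); last first.
  by apply: ler_wpM2r; [rewrite exprn_ge0// sqr_ge0|rewrite /C lerDr powR_ge0].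
rewrite sE aE -expRM [a `^ _]/powR gt_eqF// -expRD ler_expR -subr_ge0 -/L.
rewrite (_ : _ - _ = 2 * (p * (L - t))); last by rewrite mulrNz -pmulrn; ring.
by rewrite !mulr_ge0// ?subr_ge0// ltW.
Qed.


(** Exchange the sum over the heights with the integral and use gker_sum
    under the integral sign. *)
Lemma sum_energy p theta (a : R) : 0 < p -> 0 < theta -> 1 < a ->
  exists c1 c2 : R, [/\ 0 < c1, 0 < c2 & forall A, L2 A -> supported posline A ->
   ((c1 * sqn A)%:E <= \esum_(k in [set: int])
      ((a ^ k) `^ (2 * p) * Hn (theta * a ^ k) (pspec p A))%:E)%E /\
   (\esum_(k in [set: int])
      ((a ^ k) `^ (2 * p) * Hn (theta * a ^ k) (pspec p A))%:E <= (c2 * sqn A)%:E)%E].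
Proof.
move=> p0 t0 a1; have a0 : 0 < a by exact: lt_trans a1.
have [c1 [c2 [c10 c20 cS]]] := gker_sum p0 t0 a1.
exists c1, c2; split => // A LA sA.
pose F (n : nat) x : \bar R := (gker p theta (a ^ int_enum n) x * A x ^+ 2)%:E.
have mF n : measurable_fun setT (F n).
  apply/measurable_EFinP; apply: measurable_funM; first exact: measurable_gker.
  by apply: measurable_funX; exact: L2_meas.
have F0 n x : (0 <= F n x)%E by rewrite lee_fin; apply: mulr_ge0; [exact: gker_ge0|exact: sqr_ge0].
have -> : \esum_(k in [set: int]) ((a ^ k) `^ (2 * p) * Hn (theta * a ^ k) (pspec p A))%:E =
    (\int[mu]_x (\sum_(n <oo) F n x))%E.
  rewrite esum_int; last by move=> k; rewrite lee_fin mulr_ge0 ?powR_ge0 ?sqn_ge0.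
  rewrite integral_nneseries//; apply: eq_eseriesr => n _.
  by rewrite Hn_gker// exprz_gt0.
have FE x : (\sum_(n <oo) F n x = (A x ^+ 2)%:E *
    \esum_(k in [set: int]) (gker p theta (a ^ k) x)%:E)%E.
  rewrite -esum_intZl ?sqr_ge0//; last by move=> k; rewrite lee_fin gker_ge0.
  rewrite esum_int; last by move=> k; rewrite -EFinM lee_fin; apply: mulr_ge0; [exact: sqr_ge0|exact: gker_ge0].
  by apply: eq_eseriesr => n _; rewrite -EFinM mulrC.
have mS : measurable_fun setT (fun x => (\sum_(n <oo) F n x)%E).
  exact: ge0_emeasurable_sum.
have S0 x : (0 <= \sum_(n <oo) F n x)%E by exact: nneseries_ge0.
have mA c : measurable_fun setT (fun x => (c * A x ^+ 2)%:E).
  apply/measurable_EFinP; apply: measurable_funM => //.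
  by apply: measurable_funX; exact: L2_meas.
have eA c : (c * sqn A)%:E = (\int[mu]_x (c * A x ^+ 2)%:E)%E.
  by rewrite /sqn -IZ; [rewrite EFin_I//; apply: intbleZ; exact: LA.2|exact: LA.2].
have A0 x : ~ 0 < x -> A x = 0.
  by move=> x0; apply: sA; rewrite /posline/= in_itv/= andbT.
rewrite !eA; split; apply: ge0_le_integral => //.
- by move=> x _; rewrite lee_fin; apply: mulr_ge0; [exact: ltW|exact: sqr_ge0].
- exact: mA.
- move=> x _; rewrite FE; have [x0|x0] := ltP 0 x.
    by rewrite (mulrC c1) (EFinM (A x ^+ 2)) lee_wpmul2l ?lee_fin ?sqr_ge0// (cS _ x0).1.
  by rewrite A0 ?expr0n ?mulr0 ?mul0e// => /(le_lt_trans x0); rewrite ltxx.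
- exact: mA.
- move=> x _; rewrite FE; have [x0|x0] := ltP 0 x.
    by rewrite (mulrC c2) (EFinM (A x ^+ 2)) lee_wpmul2l ?lee_fin ?sqr_ge0// (cS _ x0).2.
  by rewrite A0 ?expr0n ?mulr0 ?mul0e// => /(le_lt_trans x0); rewrite ltxx.
Qed.

(** The terms of a convergent series; here by dominated convergence. *)
Lemma energy_vanish p (a : R) A : 0 < p -> 1 < a -> L2 A -> supported posline A ->
  (a ^- j) `^ (2 * p) * Hn (a ^- j) (pspec p A) @[j --> \oo] --> 0.
Proof.
move=> p0 a1 LA sA; have a0 : 0 < a by exact: lt_trans a1.
have q0 : 0 < 2 * p by rewrite mulr_gt0.
pose u (j : nat) x := gker p 1 (a ^- j) x * A x ^+ 2.
have aj j : 0 < a ^- j by rewrite invr_gt0 exprn_gt0.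
pose M : R := (2 * p / (2 * pi * (1 + 1))) `^ (2 * p).
have M0 : 0 <= M by exact: powR_ge0.
have A0 x : ~ 0 < x -> A x = 0.
  by move=> x0; apply: sA; rewrite /posline/= in_itv/= andbT.
have um j : measurable_fun setT (u j).
  apply: measurable_funM; first exact: measurable_gker.
  by apply: measurable_funX; exact: L2_meas.
have u0 j x : 0 <= u j x by apply: mulr_ge0; [exact: gker_ge0|exact: sqr_ge0].
have ub j x : `|u j x| <= M * A x ^+ 2.
  rewrite ger0_norm//.
  have [x0|x0] := ltP 0 x; last first.
    by rewrite /u A0 ?expr0n ?mulr0// => /(le_lt_trans x0); rewrite ltxx.
  rewrite ler_wpM2r ?sqr_ge0//; apply: powR_expR_le => //.
    by rewrite !mulr_gt0 ?pi_gt0// addr_gt0.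
  by rewrite mulr_ge0// ltW.
have ucv x : u j x @[j --> \oo] --> 0.
  have [x0|x0] := ltP 0 x; last first.
    have -> : u ^~ x = fun=> 0.
      by apply/funext => j; rewrite /u A0 ?expr0n ?mulr0// => /(le_lt_trans x0); rewrite ltxx.
    exact: cvg_cst.
  pose r := expR (- (2 * p * ln a)).
  have r1 : `|r| < 1 by rewrite ger0_norm ?expR_ge0// expR_lt1 oppr_lt0 mulr_gt0// ln_gt0.
  have gl : (x `^ (2 * p) * A x ^+ 2) * r ^+ j @[j --> \oo] --> 0.
    rewrite -[X in _ --> X](mulr0 (x `^ (2 * p) * A x ^+ 2)); apply: cvgMr; exact: cvg_expr.
  apply: (squeeze_cvgr _ (cvg_cst 0) gl); apply: nearW => j /=.
  rewrite u0/= /u (mulrAC (x `^ _)) ler_wpM2r ?sqr_ge0//.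
  rewrite /gker; apply: le_trans (gker_le_small _ ltr01 _) _; first by rewrite mulr_gt0.
  rewrite powRM ?(ltW x0) ?(ltW (aj j))// mulrC ler_wpM2l ?powR_ge0//.
  rewrite /powR gt_eqF ?aj// lnV ?posrE ?exprn_gt0// lnXn// -expRM_natl ler_expR.
  by rewrite -subr_ge0 (_ : _ - _ = 0)// -mulr_natl; ring.
have [_ h _] := I_dct um ucv (intbleZ M LA.2) ub.
have -> : (fun j : nat => (a ^- j) `^ (2 * p) * Hn (a ^- j) (pspec p A)) =
    (fun j => \int[mu]_x u j x).
  apply/funext => j; apply: EFin_inj.
  have := Hn_gker p0 ltr01 (aj j) LA sA; rewrite mul1r => ->.
  rewrite EFin_I//.
  exact: (intble_le (um j) (fun x => le_trans (ub j x) (ler_norm _)) (intbleZ M LA.2)).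
by move: h; rewrite {2}/Rintegral integral0.
Qed.

End power_weights.

Section scaling.
Context {R : realType}.
Local Notation mu := (@lebesgue_measure R).
Implicit Types A f g psi : R -> R.
Implicit Types x y h Y beta : R.

(** Dilations move the line of height y to the line of height 1. *)
Definition sdil y psi x := psi (y^-1 * x).

Lemma wmul_sdil Y y psi : 0 < y ->
  wmul Y (sdil y psi) = fun x => wmul (Y * y) psi (y^-1 * x + 0).
Proof.
move=> y0; apply/funext => x; rewrite /wmul /sdil addr0 /wgt; congr (_ * expR _).
by field; rewrite gt_eqF.
Qed.

Lemma hspec_sdil h y psi : 0 < y -> hspec (h * y) psi -> hspec h (sdil y psi).
Proof.
move=> y0 [sf Lf]; split; last by rewrite wmul_sdil//; apply: L2_affine => //; rewrite invr_gt0.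
move=> x xn; apply: sf => h0; apply: xn; move: h0; rewrite /halfline/= !in_itv/= !andbT.
by rewrite pmulr_rge0// invr_gt0.
Qed.

Lemma Hn_sdil h y psi : 0 < y -> hspec (h * y) psi -> Hn h (sdil y psi) = y * Hn (h * y) psi.
Proof.
by move=> y0 [sf Lf]; rewrite /Hn wmul_sdil// sqn_affine ?invr_gt0// invrK.
Qed.

Lemma rowr_sdil beta Y h y psi : 0 < beta -> 0 <= h -> h < Y -> 0 < y ->
  hspec (h * y) psi ->
  rowr beta Y (sdil y psi) = y ^+ 2 * rowr beta (Y * y) psi.
Proof.
move=> b0 h0 hY y0 hp; apply: EFin_inj.
have hy : h * y < Y * y by rewrite ltr_pM2r.
have hd := hspec_sdil y0 hp; have hi := hspec_intble hy hp.
rewrite EFinM (hspec_EFin_rowr b0 h0 hY hd) (hspec_EFin_rowr b0 (mulr_ge0 h0 (ltW y0)) hy hp).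
rewrite /rowe -esum_intZl ?sqr_ge0//; last by move=> n; rewrite lee_fin FQ_ge0.
apply: eq_esum => n _; rewrite -EFinM wmul_sdil// FQ_affine ?invr_gt0// !invrK.
by congr (_ * FQ _ _)%:E; ring.
Qed.

(** The estimate is invariant under dilations, which move the rows of a
    lattice to those of a lattice with the same parameter beta. *)
Lemma rows_decay_at beta (a : R) : 0 < beta -> 1 < a ->
  exists2 K : R, 0 < K & forall j : nat,
  exists2 C : R, 0 <= C & forall y psi, 0 < y -> hspec (a ^- j * y) psi ->
    Hn y psi <= C * \sum_(0 <= i < j) y * rowr beta (a ^- i * y) psi +
      K * expR (- (4 * pi / beta) * j%:R) * Hn (a ^- j * y) psi.
Proof.
move=> b0 a1; have a0 : 0 < a by exact: lt_trans a1.
have [K K0 HK] := rows_decay b0 a1; exists K => // j.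
have [C C0 HC] := HK j; exists C => // y psi y0 hp.
have aj : 0 < a ^- j by rewrite invr_gt0 exprn_gt0.
have aj1 : a ^- j <= 1 by rewrite invf_le1 ?exprn_gt0// exprn_ege1// ltW.
have h1 : hspec (1 * y) psi by apply: hspec_le hp; rewrite ler_wpM2r// ltW.
have := HC _ (hspec_sdil y0 hp).
rewrite (Hn_sdil y0 hp) (Hn_sdil y0 h1) mul1r.
rewrite -(ler_pM2l (_ : 0 < y^-1)) ?invr_gt0// mulKf ?gt_eqF// => h.
apply: le_trans h _; rewrite mulrDr; apply: lerD; last first.
  by rewrite [X in y^-1 * X]mulrCA mulKf ?gt_eqF.
rewrite mulrCA ler_wpM2l// mulr_sumr.
rewrite big_nat_cond [X in _ <= X]big_nat_cond; apply: ler_sum => i.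
rewrite andbT => /andP[_ ij].
have hi : a ^- j < a ^- i by rewrite ltf_pV2 ?posrE ?exprn_gt0// ltr_eXn2l.
by rewrite (rowr_sdil b0 (ltW aj) hi y0 hp) expr2 -mulrA mulKf ?gt_eqF.
Qed.

End scaling.

(** Bessel's inequality needs the norm on a strictly lower line; half the
    height is invariant under dilations. *)
Lemma bessel_half {R : realType} (p beta y : R) A : 0 < p -> 0 < beta -> 0 < y ->
  L2 A -> supported posline A ->
  y `^ (2 * p + 1) * rowr beta y (pspec p A) <=
  ((1 - expR (- (pi / beta)) ^+ 2)^-1 / beta) * (y `^ (2 * p) * Hn (2^-1 * y) (pspec p A)).
Proof.
move=> p0 b0 y0 LA sA; have h2 : (0:R) < 2^-1 by rewrite invr_gt0.
have hs := hspec_pspec p0 (mulr_gt0 h2 y0) LA sA.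
have hh : 2^-1 * y < y by rewrite gtr_pMl// invf_lt1// ltr1n.
have hh0 : 0 <= 2^-1 * y by rewrite mulr_ge0// ltW.
have := bessel_row b0 hh0 hh hs; rewrite -(hspec_EFin_rowr b0 hh0 hh hs) lee_fin => h.
have pk : 0 < y `^ (2 * p + 1) by rewrite powR_gt0.
apply: le_trans (ler_wpM2l (ltW pk) h) _; rewrite le_eqVlt; apply/orP; left; apply/eqP.
have -> : y `^ (2 * p + 1) = y `^ (2 * p) * y.
  by rewrite powRD ?powRr1 ?(ltW y0)// (gt_eqF y0) implybT.
rewrite /bessel_cst; have -> : wgt (y - 2^-1 * y) (period beta y) = expR (- (pi / beta)).
  by rewrite /wgt /period; congr expR; field; rewrite !gt_eqF.
rewrite /period invfM; set z := (1 - _)^-1; set w := _ `^ (2 * p); set H := Hn _ _.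
by field; rewrite !gt_eqF.
Qed.

Section recurrence.
Context {R : realType}.
Variables (X D : int -> R).
Hypotheses (X0 : forall k, 0 <= X k) (D0 : forall k, 0 <= D k).

Lemma esum_shifts j : (\esum_(k in [set: int]) (\sum_(0 <= i < j) D (k - i%:Z))%:E =
  j%:R%:E * \esum_(k in [set: int]) (D k)%:E)%E.
Proof.
elim: j => [|j ih].
  by rewrite mul0e; under eq_esum do rewrite big_nil; rewrite esum1.
under eq_esum do rewrite big_nat_recr//= EFinD.
rewrite esumD; [|by move=> k _; rewrite lee_fin sumr_ge0// => *; exact: D0|
  by move=> k _; rewrite lee_fin D0].
rewrite ih (esum_int_shift (fun k => (D k)%:E) (- j%:Z)).
by rewrite -natr1 EFinD ge0_muleDl ?mul1e// lee_fin.
Qed.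

End recurrence.

(** Summing the recurrence over all indices leaves half of the sum of X on
    the right-hand side, and that sum is finite. *)
Lemma recurrence_sum {R : realType} (X D : int -> R) (C e M : R) (j : nat) : 0 <= C ->
  (forall k, 0 <= X k) -> (forall k, 0 <= D k) ->
  (forall k, X k <= C * \sum_(0 <= i < j) D (k - i%:Z) + 2^-1 * X (k - j%:Z)) ->
  (\esum_(k in [set: int]) (X k)%:E <= M%:E)%E ->
  (e%:E <= \esum_(k in [set: int]) (X k)%:E)%E ->
  ((e / (2 * (C * j%:R + 1)))%:E <= \esum_(k in [set: int]) (D k)%:E)%E.
Proof.
move=> C0 X0 D0 HC.
set SX := \esum_(k in _) (X k)%:E; set SD := \esum_(k in _) _ => hE2 hE1.
have K0 : 0 < 2 * (C * j%:R + 1) by rewrite mulr_gt0// ltr_wpDl// mulr_ge0.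
have SX0 : (0 <= SX)%E by apply: esum_ge0 => k _; rewrite lee_fin X0.
have SD0 : (0 <= SD)%E by apply: esum_ge0 => k _; rewrite lee_fin D0.
have SXf : SX \is a fin_num.
  by rewrite ge0_fin_numE//; apply: le_lt_trans hE2 _; exact: ltry.
have h2 : (0:R) <= 2^-1 by rewrite invr_ge0.
have key : (SX <= (C * j%:R)%:E * SD + (2^-1)%:E * SX)%E.
  rewrite EFinM -muleA -esum_shifts//.
  rewrite -(esum_intZl C0); last first.
    by move=> k; rewrite lee_fin sumr_ge0// => *; exact: D0.
  rewrite {2}/SX -[X in (_ + _ * X)%E](esum_int_shift (fun k => (X k)%:E) (- j%:Z)).
  rewrite -(esum_intZl h2); last by move=> k; rewrite lee_fin X0.
  rewrite -esumD; last 2 first.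
  - move=> k _; rewrite -EFinM lee_fin mulr_ge0// sumr_ge0// => *; exact: D0.
  - by move=> k _; rewrite -EFinM lee_fin mulr_ge0 ?X0.
  by apply: le_esum => k _; rewrite -!EFinM -EFinD lee_fin; exact: HC.
move: key hE1; rewrite -(fineK SXf); set x := fine SX.
case: SD SD0 => [d| |] //; rewrite ?lee_fin => d0.
  move=> key h1.
  rewrite ler_pdivrMr//; apply: le_trans h1 _.
  have : x <= 2 * (C * j%:R * d) by lra.
  by move=> h; apply: le_trans h _; rewrite mulrA mulrC ler_wpM2l// ler_wpM2l// lerDl.
by move=> _ _; rewrite leey.
Qed.

Section spectral_frame.
Context {R : realType}.
Local Notation mu := (@lebesgue_measure R).
Variables (p a beta : R).
Hypotheses (p0 : 0 < p) (a1 : 1 < a) (b0 : 0 < beta).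
Hypothesis pab : beta * ln a < 2 * pi / p.
Implicit Types A : R -> R.

Let a0 : 0 < a. Proof. exact: lt_trans a1. Qed.
Let az (k : int) : 0 < a ^ k. Proof. exact: exprz_gt0. Qed.

(** This is where the density of the lattice enters: over j rows the gain
    exp (- 4 pi j / beta) beats the growth a^(2 p j) of the weights. *)
Lemma exists_decay (K : R) : exists j : nat,
  K * expR (- (4 * pi / beta) * j%:R) * (a ^+ j) `^ (2 * p) <= 2^-1.
Proof.
pose r := expR (- (4 * pi / beta) + 2 * p * ln a).
have r1 : `|r| < 1.
  rewrite ger0_norm ?expR_ge0// expR_lt1 addrC subr_lt0.
  by move: pab; rewrite !ltr_pdivlMr//; lra.
have cv : K * r ^+ j @[j --> \oo] --> 0.
  by rewrite -[X in _ --> X](mulr0 K); apply: cvgMr; exact: cvg_expr.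
have h2 : (0:R) < 2^-1 by rewrite invr_gt0.
have [N _ HN] := cvgr_le 0 cv _ h2.
have rE : expR (- (4 * pi / beta) * N%:R) * (a ^+ N) `^ (2 * p) = r ^+ N; last first.
  by exists N; rewrite -mulrA rE; exact: (HN N (leqnn N)).
rewrite /powR gt_eqF ?exprn_gt0// lnXn// -expRD -expRM_natl; congr expR.
by rewrite -mulr_natl; ring.
Qed.

Let q := 2 * p.
Let X A (k : int) := (a ^ k) `^ q * Hn (a ^ k) (pspec p A).
Let D A (k : int) := (a ^ k) `^ (q + 1) * rowr beta (a ^ k) (pspec p A).

(** The estimate on j rows below the height a^k, with j chosen so that the
    norm on the lowest line enters with a factor at most 1/2. *)
Lemma energy_step : exists2 C : R, 0 < C & exists j : nat, forall A k,
  L2 A -> supported posline A ->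
  X A k <= C * \sum_(0 <= i < j) D A (k - i%:Z) + 2^-1 * X A (k - j%:Z).
Proof.
have [K K0 HK] := rows_decay_at b0 a1.
have [j Hj] := exists_decay K; have [C C0 HC] := HK j.
have q0 : 0 < q by rewrite mulr_gt0.
have q10 : 0 <= q + 1 by rewrite addr_ge0 ?(ltW q0).
pose G := (a ^+ j) `^ (q + 1); have G0 : 0 < G by rewrite powR_gt0// exprn_gt0.
exists (C * G + 1); first by rewrite ltr_wpDl// mulr_ge0// ltW.
exists j => A k LA sA.
have aB i : a ^- i * a ^ k = a ^ (k - i%:Z) by rewrite expfzDr ?gt_eqF// mulrC exprnN.
have hs : hspec (a ^- j * a ^ k) (pspec p A).
  by apply: hspec_pspec => //; rewrite mulr_gt0// invr_gt0 exprn_gt0.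
have pk : 0 < (a ^ k) `^ q by exact: powR_gt0.
have := HC _ _ (az k) hs; rewrite -(ler_pM2l pk) => h; apply: le_trans h _; rewrite mulrDr; apply: lerD.
  have S0 : 0 <= \sum_(0 <= i < j) D A (k - i%:Z).
    by apply: sumr_ge0 => i _; rewrite mulr_ge0 ?powR_ge0 ?rowr_ge0.
  apply: (@le_trans _ _ (C * G * \sum_(0 <= i < j) D A (k - i%:Z))); last first.
    by rewrite ler_wpM2r// lerDl.
  rewrite mulrCA -mulrA ler_wpM2l// !mulr_sumr.
  rewrite big_nat_cond [leRHS]big_nat_cond; apply: ler_sum => i; rewrite andbT => /andP[_ ij].
  rewrite aB /D [in leRHS]mulrA mulrA ler_wpM2r ?rowr_ge0//.
  have -> : (a ^ k) `^ q * a ^ k = (a ^ k) `^ (q + 1).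
    by rewrite powRD ?powRr1 ?(ltW (az k))// (gt_eqF (az k)) implybT.
  have -> : a ^ k = a ^+ i * a ^ (k - i%:Z) by rewrite expfzDr ?gt_eqF// -exprnN mulrCA mulfV ?mulr1// gt_eqF// exprn_gt0.
  rewrite powRM ?(ltW (az _)) ?exprn_ge0 ?(ltW a0)//.
  rewrite ler_wpM2r ?powR_ge0// ge0_ler_powR ?nnegrE ?exprn_ge0 ?(ltW a0)//.
  by rewrite ler_weXn2l ?(ltW a1)// ltnW.
rewrite aB /X.
have -> : a ^ k = a ^+ j * a ^ (k - j%:Z) by rewrite expfzDr ?gt_eqF// -exprnN mulrCA mulfV ?mulr1// gt_eqF// exprn_gt0.
rewrite powRM ?(ltW (az _)) ?exprn_ge0 ?(ltW a0)//.
set w := _ `^ q; set v := _ `^ q; set H := Hn _ _.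
rewrite (_ : w * v * _ = K * expR (- (4 * pi / beta) * j%:R) * w * (v * H)); last by ring.
by apply: ler_wpM2r => //; apply: mulr_ge0; [exact: powR_ge0|exact: sqn_ge0].
Qed.

(** Upper bound: Bessel's inequality on each row, then the sum of the
    energies at half heights. Lower bound: the recurrence between the
    energies at the heights a^k. *)
Lemma spectral_frame : exists c1 c2 : R, [/\ 0 < c1, 0 < c2 & forall A,
  L2 A -> supported posline A ->
   ((c1 * sqn A)%:E <= \esum_(k in [set: int]) (D A k)%:E)%E /\
   (\esum_(k in [set: int]) (D A k)%:E <= (c2 * sqn A)%:E)%E].
Proof.
have q0 : 0 < q by rewrite mulr_gt0.
have [e1 [e2 [e10 e20 HE]]] := sum_energy p0 ltr01 a1.
have h2 : (0:R) < 2^-1 by rewrite invr_gt0.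
have [f1 [f2 [f10 f20 HF]]] := sum_energy p0 h2 a1.
have [C C0 [j HC]] := energy_step.
pose kap := (1 - expR (- (pi / beta)) ^+ 2)^-1 / beta.
have kap0 : 0 < kap.
  rewrite divr_gt0// invr_gt0 subr_gt0 expr_lt1// ?expR_ge0// expR_lt1 oppr_lt0.
  by rewrite divr_gt0// pi_gt0.
have K0 : 0 < 2 * (C * j%:R + 1) by rewrite mulr_gt0// ltr_wpDl// mulr_ge0// ltW.
exists (e1 / (2 * (C * j%:R + 1))), (kap * f2); split; [exact: divr_gt0|exact: mulr_gt0|].
move=> A LA sA; have [hE1 hE2] := HE A LA sA; have [_ hF2] := HF A LA sA.
have XE : \esum_(k in [set: int]) ((a ^ k) `^ (2 * p) * Hn (1 * a ^ k) (pspec p A))%:E =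
    \esum_(k in [set: int]) (X A k)%:E.
  by apply: eq_esum => k _; rewrite mul1r.
rewrite XE in hE1 hE2; rewrite -mulrAC; split; last first.
  pose Y k := (a ^ k) `^ (2 * p) * Hn (2^-1 * a ^ k) (pspec p A).
  have Y0 k : (0 <= (Y k)%:E)%E.
    by rewrite lee_fin; apply: mulr_ge0; [exact: powR_ge0|exact: sqn_ge0].
  have k0 : (0 <= kap%:E)%E by rewrite lee_fin; exact: ltW.
  rewrite -mulrA (EFinM kap); apply: le_trans (lee_wpmul2l k0 hF2).
  rewrite -(esum_intZl (ltW kap0) Y0).
  apply: le_esum => k _; rewrite -EFinM lee_fin /D.
  exact: bessel_half.
apply: (recurrence_sum (C := C) (j := j) (ltW C0) _ _ _ hE2 hE1).
- by move=> k; apply: mulr_ge0; [exact: powR_ge0|exact: sqn_ge0].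
- by move=> k; apply: mulr_ge0; [exact: powR_ge0|exact: rowr_ge0].
- by move=> k; exact: HC.
Qed.

End spectral_frame.

(** * Convolution *)

Section convolution.
Context {R : realType}.
Local Notation mu := (@lebesgue_measure R).
Implicit Types F G f g : R -> R.
Implicit Types x y h t : R.

Definition convolve F G x : R := \int[mu]_t (F t * G (x - t)).

Lemma measurable_opp_comp f : measurable_fun setT f -> measurable_fun setT (fun x => f (- x)).
Proof. by move=> mf; apply: (measurableT_comp mf); exact: oppr_measurable. Qed.

Lemma intble_opp f : intble f -> intble (fun x => f (- x)).
Proof.
move=> fi; have mf := intble_meas fi; apply/intbleP; split; first exact: measurable_opp_comp.
rewrite (@ge0_integral_opp R (fun x => (`|f x|)%:E)); last by move=> x; rewrite lee_fin.
  by have /intbleP[] := fi.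
by apply/measurable_EFinP; exact: measurableT_comp.
Qed.

Lemma L2_opp f : L2 f -> L2 (fun x => f (- x)).
Proof. by move=> [mf i2]; split; [exact: measurable_opp_comp|exact: intble_opp i2]. Qed.

Lemma sqn_opp f : L2 f -> sqn (fun x => f (- x)) = sqn f.
Proof. by move=> Lf; exact: (I_opp (intble_meas Lf.2)). Qed.

Lemma L2_reflect f x : L2 f -> L2 (fun t => f (x - t)).
Proof.
move=> Lf; have := L2_opp (L2_translate x Lf); congr L2.
by apply/funext => t; rewrite addrC.
Qed.

Lemma conv_intble F G x : L2 F -> L2 G -> intble (fun t => F t * G (x - t)).
Proof. by move=> LF LG; apply: L2M => //; exact: L2_reflect. Qed.

Lemma measurable_conv_kernel F G : measurable_fun setT F -> measurable_fun setT G ->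
  measurable_fun setT (fun z : R * R => F z.2 * G (z.1 - z.2)).
Proof.
move=> mF mG; apply: measurable_funM.
  exact: (measurableT_comp mF measurable_snd).
apply: (measurableT_comp mG); apply: measurable_funB; [exact: measurable_fst|exact: measurable_snd].
Qed.

Lemma measurable_Rintegral (K : R * R -> R) : measurable_fun setT K ->
  measurable_fun setT (fun x => \int[mu]_t K (x, t)).
Proof.
move=> mK; rewrite /Rintegral.
apply: (measurableT_comp (fine_measurable measurableT)).
pose Kp x := (\int[mu]_t ((EFin \o K)^\+ (x, t)))%E.
pose Kn x := (\int[mu]_t ((EFin \o K)^\- (x, t)))%E.
have -> : (fun x => \int[mu]_t (K (x, t))%:E)%E = (fun x => Kp x - Kn x)%E.
  apply/funext => x; rewrite [LHS]integralE /Kp /Kn.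
  by congr (_ - _)%E; apply: eq_integral => t _; rewrite ?funeposE ?funenegE.
have mE : measurable_fun setT (EFin \o K) by apply/measurable_EFinP.
apply: emeasurable_funB.
  apply: (@measurable_fun_fubini_tonelli_F _ _ _ _ R mu); first exact: measurable_funepos.
  by move=> z; exact: funepos_ge0.
apply: (@measurable_fun_fubini_tonelli_F _ _ _ _ R mu); first exact: measurable_funeneg.
by move=> z; exact: funeneg_ge0.
Qed.

Lemma measurable_conv F G : measurable_fun setT F -> measurable_fun setT G ->
  measurable_fun setT (convolve F G).
Proof.
by move=> mF mG; have := measurable_Rintegral (measurable_conv_kernel mF mG).
Qed.

(** The inequality of Cauchy-Schwarz for the measure of density |F|. *)
Lemma conv_sq_le F G x (M : R) : 0 < M -> L2 F -> L2 G -> intble F ->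
  \int[mu]_t `|F t| <= M ->
  ((convolve F G x ^+ 2)%:E <= M%:E * \int[mu]_t (`|F t| * G (x - t) ^+ 2)%:E)%E.
Proof.
move=> M0 LF LG iF FM; set c := convolve F G x.
have mS : measurable_fun setT (fun t => `|F t| * G (x - t) ^+ 2).
  apply: measurable_funM; first by apply: measurableT_comp => //; exact: L2_meas.
  by apply: measurable_funX; apply: L2_meas; exact: L2_reflect.
have S0 t : 0 <= `|F t| * G (x - t) ^+ 2.
  by apply: mulr_ge0; [exact: normr_ge0|exact: sqr_ge0].
have [Sfin|] := ltP (\int[mu]_t (`|F t| * G (x - t) ^+ 2)%:E)%E +oo%E; last first.
  by rewrite leye_eq => /eqP ->; rewrite gt0_muley ?lte_fin// leey.
have iS : intble (fun t => `|F t| * G (x - t) ^+ 2) by apply/ge0_intbleP.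
rewrite -EFin_I// -EFinM lee_fin.
set S := \int[mu]_t _.
(* The best constant l in 2 l v <= l^2 + v^2. *)
pose l := `|c| / M.
have l0 : 0 <= l by rewrite divr_ge0// ltW.
have iFG := conv_intble x LF LG.
have key : 2 * l * `|c| <= l ^+ 2 * M + S.
  apply: (@le_trans _ _ (\int[mu]_t (2 * l * `|F t * G (x - t)|))).
    rewrite IZ; last exact: intble_abs.
    by apply: ler_wpM2l; [rewrite mulr_ge0|exact: (abs_I iFG)].
  apply: (@le_trans _ _ (\int[mu]_t (l ^+ 2 * `|F t| + `|F t| * G (x - t) ^+ 2))).
    apply: le_I.
    - by apply: intbleZ; exact: intble_abs.
    - by apply: intbleD => //; apply: intbleZ; exact: intble_abs.
    move=> t; rewrite normrM -[G (x - t) ^+ 2]real_normK ?num_real//.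
    have := normr_ge0 (F t); have := sqr_ge0 (l - `|G (x - t)|).
    move: `|F t| `|G (x - t)| => u v h1 h2.
    rewrite -subr_ge0 (_ : _ - _ = u * (l - v) ^+ 2); last by ring.
    exact: mulr_ge0.
  rewrite ID//; last by apply: intbleZ; exact: intble_abs.
  rewrite IZ; last exact: intble_abs.
  by rewrite lerD2r ler_wpM2l ?sqr_ge0.
have cM : `|c| = l * M by rewrite /l divfK// gt_eqF.
rewrite -[c ^+ 2]real_normK ?num_real// cM exprMn [M ^+ 2]expr2 mulrCA ler_wpM2l ?(ltW M0)//.
by move: key; rewrite cM; nra.
Qed.

(** Integrate the pointwise bound and use Tonelli's theorem. *)
Lemma young F G (M : R) : 0 < M -> L2 F -> L2 G -> intble F ->
  \int[mu]_t `|F t| <= M ->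
  L2 (convolve F G) /\ sqn (convolve F G) <= M ^+ 2 * sqn G.
Proof.
move=> M0 LF LG iF FM.
pose K (z : R * R) : \bar R := (`|F z.2| * G (z.1 - z.2) ^+ 2)%:E.
have mK : measurable_fun setT K.
  apply/measurable_EFinP.
  apply: (@measurable_conv_kernel (fun t => `|F t|) (fun t => G t ^+ 2)).
    by apply: measurableT_comp => //; exact: L2_meas.
  by apply: measurable_funX; exact: L2_meas.
have K0 z : (0 <= K z)%E.
  by rewrite lee_fin; apply: mulr_ge0; [exact: normr_ge0|exact: sqr_ge0].
have mc : measurable_fun setT (convolve F G) by apply: measurable_conv; exact: L2_meas.
have mF1 : measurable_fun setT (fun x => \int[mu]_t K (x, t))%E.
  exact: (@measurable_fun_fubini_tonelli_F _ _ _ _ R mu).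
have bound : (\int[mu]_x (convolve F G x ^+ 2)%:E <= (M ^+ 2 * sqn G)%:E)%E.
  apply: (@le_trans _ _ (\int[mu]_x (M%:E * \int[mu]_t K (x, t)))%E).
    apply: ge0_le_integral => //.
    - by move=> x _; rewrite lee_fin sqr_ge0.
    - by apply/measurable_EFinP; exact: measurable_funX.
    - by apply: emeasurable_funM => //; exact: measurable_cst.
    - by move=> x _; exact: conv_sq_le.
  rewrite ge0_integralZl//; last 2 first.
  - by move=> x _; exact: integral_ge0.
  - by rewrite lee_fin ltW.
  rewrite (@fubini_tonelli _ _ _ _ R mu mu K mK K0).
  have inner t : (\int[mu]_x K (x, t) = (sqn G * `|F t|)%:E)%E.
    rewrite /K/=; have iGt := intble_translate (- t) LG.2.
    rewrite -EFin_I; last exact: intbleZ.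
    by rewrite (IZ _ iGt) (I_translate (- t) LG.2) mulrC.
  under eq_integral do rewrite inner.
  rewrite -EFin_I; last by apply: intbleZ; exact: intble_abs.
  rewrite -EFinM lee_fin IZ; last exact: intble_abs.
  by rewrite expr2 -mulrA ler_wpM2l ?(ltW M0)// mulrC ler_wpM2r// sqn_ge0.
have Lc : L2 (convolve F G).
  split => //; apply/ge0_intbleP; first by move=> x; exact: sqr_ge0.
  by split; [exact: measurable_funX|apply: le_lt_trans bound _; exact: ltry].
by split => //; rewrite -lee_fin EFin_sqn.
Qed.

(** Tonelli's theorem: the integral over x of |G (x - t)| does not depend
    on t. *)
Lemma integrable_conv_kernel F G (c : R -> R) (B : R) : intble F -> intble G ->
  measurable_fun setT c -> (forall x, `|c x| <= B) ->
  (mu \x mu)%E.-integrable setT (fun z : R * R => (F z.2 * G (z.1 - z.2) * c z.1)%:E).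
Proof.
move=> iF iG mc cB; have B0 : 0 <= B by apply: le_trans (cB 0).
have mF := intble_meas iF; have mG := intble_meas iG.
have mK : measurable_fun setT (fun z : R * R => (F z.2 * G (z.1 - z.2) * c z.1)%:E).
  apply/measurable_EFinP; apply: measurable_funM; first exact: measurable_conv_kernel.
  exact: (measurableT_comp mc measurable_fst).
have mA : measurable_fun setT (fun z : R * R => `|(F z.2 * G (z.1 - z.2) * c z.1)%:E|)%E.
  exact: measurableT_comp.
apply/(integrable21ltyP mu mu mK).
apply: (@le_lt_trans _ _ (\int[mu]_t (B * (\int[mu]_s `|G s|) * `|F t|)%:E)%E); last first.
  rewrite -EFin_I; last by apply: intbleZ; exact: intble_abs.
  exact: ltry.
apply: ge0_le_integral => //.
- by move=> t _; exact: integral_ge0.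
- by apply: (@measurable_fun_fubini_tonelli_G _ _ _ _ R mu _ mA) => z; exact: abse_ge0.
- by apply/measurable_EFinP; apply: measurable_funM => //; exact: measurableT_comp.
move=> t _.
have mk : measurable_fun setT (fun x => F t * G (x - t) * c x).
  apply: measurable_funM => //; apply: measurable_funM; first exact: measurable_cst.
  exact: intble_meas (intble_translate (- t) iG).
have iGt := intble_abs (intble_translate (- t) iG).
apply: (@le_trans _ _ (\int[mu]_x (B * `|F t| * `|G (x - t)|)%:E)%E).
  apply: ge0_le_integral => //.
  - apply: measurableT_comp => //; apply/measurable_EFinP.
    exact: mk.
  - by apply/measurable_EFinP; exact: intble_meas (intbleZ _ iGt).
  move=> x _; rewrite /= lee_fin !normrM -[B * _ * _]mulrA [X in X <= _]mulrC.
  by apply: ler_wpM2r; [exact: mulr_ge0|exact: cB].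
rewrite -EFin_I; last exact: intbleZ.
rewrite lee_fin (IZ _ iGt) (I_translate (- t) (intble_abs iG)) le_eqVlt; apply/orP; left; apply/eqP.
by ring.
Qed.

(** Fubini, tested against a bounded factor; with cosines and sines as
    factors it gives the product formulas for the transforms. *)
Lemma I_conv F G (c : R -> R) (B : R) : L2 F -> L2 G -> intble F -> intble G ->
  measurable_fun setT c -> (forall x, `|c x| <= B) ->
  intble (convolve F G) /\
  \int[mu]_x (convolve F G x * c x) = \int[mu]_t (F t * \int[mu]_s (G s * c (s + t))).
Proof.
move=> LF LG iF iG mc cB.
have inner (d : R -> R) x : (\int[mu]_t (F t * G (x - t) * d x)%:E = (convolve F G x * d x)%:E)%E.
  have iK := conv_intble x LF LG.
  have -> : (fun t => (F t * G (x - t) * d x)%:E) = (fun t => (d x * (F t * G (x - t)))%:E).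
    by apply/funext => t; rewrite mulrC.
  by rewrite -EFin_I ?IZ ?(mulrC (d x))//; exact: intbleZ.
have ic : intble (convolve F G).
  have m1 : measurable_fun setT (fun _ : R => 1 : R) by exact: measurable_cst.
  have n1 (x : R) : `|1 : R| <= 1 by rewrite normr1.
  have := integrable_fubini_F (integrable_conv_kernel iF iG m1 n1).
  apply: eq_integrable => // x _ /=; rewrite /fubini_F/=.
  by rewrite (inner (fun=> 1)) mulr1.
split => //.
have icc : intble (fun x => convolve F G x * c x).
  have := intble_bounded mc cB ic; congr intble; apply/funext => x; exact: mulrC.
have mc' (t : R) : measurable_fun setT (fun s : R => c (s + t)).
  have := measurable_comp_affine 1 t mc; congr measurable_fun.
  by apply/funext => s; rewrite mul1r.
have iGc t : intble (fun s => G s * c (s + t)).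
  have := intble_bounded (mc' t) (fun s => cB (s + t)) iG; congr intble.
  by apply/funext => s; exact: mulrC.
have := Fubini (integrable_conv_kernel iF iG mc cB); rewrite /=.
under eq_integral do rewrite inner.
rewrite -EFin_I// => E; apply: EFin_inj; rewrite E.
have inner2 t : (\int[mu]_x (F t * G (x - t) * c x)%:E =
    (F t * \int[mu]_s (G s * c (s + t)))%:E)%E.
  have h : (fun x => F t * G (x - t) * c x) = (fun x => (fun s => F t * (G s * c (s + t))) (x - t)).
    by apply/funext => x; rewrite subrK mulrA.
  rewrite (_ : (fun x => (F t * G (x - t) * c x)%:E) =
     EFin \o (fun x => (fun s => F t * (G s * c (s + t))) (x - t))); last first.
    by apply/funext => x /=; rewrite subrK mulrA.
  rewrite -(EFin_I (intble_translate (- t) (intbleZ (F t) (iGc t)))).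
  by rewrite (I_translate (- t) (intbleZ (F t) (iGc t))) IZ.
under eq_integral do rewrite inner2.
have iO : intble (fun t => F t * \int[mu]_s (G s * c (s + t))).
  have mm : measurable_fun setT (fun t => \int[mu]_s (G s * c (s + t))).
    apply: (@measurable_Rintegral (fun z : R * R => G z.2 * c (z.2 + z.1))).
    apply: measurable_funM; first exact: (measurableT_comp (intble_meas iG) measurable_snd).
    apply: (measurableT_comp mc).
    by apply: measurable_funD; [exact: measurable_snd|exact: measurable_fst].
  have mb t : `|\int[mu]_s (G s * c (s + t))| <= B * \int[mu]_s `|G s|.
    apply: le_trans (abs_I (iGc t)) _; rewrite -IZ; last exact: intble_abs.
    apply: le_I; [exact: intble_abs|by apply: intbleZ; exact: intble_abs|].
    by move=> s; rewrite normrM mulrC ler_wpM2r.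
  by have := intble_bounded mm mb iF; congr intble; apply/funext => t; exact: mulrC.
by rewrite EFin_I.
Qed.

Lemma FC_conv F G xi : L2 F -> L2 G -> intble F -> intble G ->
  FC (convolve F G) xi = FC F xi * FC G xi - FS F xi * FS G xi.
Proof.
move=> LF LG iF iG.
rewrite [LHS]/FC; have [_ ->] := I_conv LF LG iF iG (measurable_cosM xi) (fun x => cos_max _).
have iC := intble_cos xi iG; have iS := intble_sin xi iG.
have inner t : \int[mu]_s (G s * cos (2 * pi * (s + t) * xi)) =
    cos (2 * pi * t * xi) * FC G xi - sin (2 * pi * t * xi) * FS G xi.
  rewrite /FC /FS -IZ// -IZ// -IB; [|exact: intbleZ..].
  apply: eq_Rintegral => s _.
  rewrite (_ : 2 * pi * (s + t) * xi = 2 * pi * s * xi + 2 * pi * t * xi); last by ring.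
  by rewrite cosD; ring.
under eq_Rintegral do rewrite inner.
have jC := intble_cos xi iF; have jS := intble_sin xi iF.
transitivity (\int[mu]_t (FC G xi * (F t * cos (2 * pi * t * xi)) -
    FS G xi * (F t * sin (2 * pi * t * xi)))).
  by apply: eq_Rintegral => t _; ring.
by rewrite IB ?IZ//; [rewrite -/(FC F xi) -/(FS F xi); ring|exact: intbleZ..].
Qed.

Lemma FS_conv F G xi : L2 F -> L2 G -> intble F -> intble G ->
  FS (convolve F G) xi = FS F xi * FC G xi + FC F xi * FS G xi.
Proof.
move=> LF LG iF iG.
rewrite [LHS]/FS; have [_ ->] := I_conv LF LG iF iG (measurable_sinM xi) (fun x => sin_max _).
have iC := intble_cos xi iG; have iS := intble_sin xi iG.
have inner t : \int[mu]_s (G s * sin (2 * pi * (s + t) * xi)) =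
    sin (2 * pi * t * xi) * FC G xi + cos (2 * pi * t * xi) * FS G xi.
  rewrite /FC /FS -IZ// -IZ// -ID; [|exact: intbleZ..].
  apply: eq_Rintegral => s _.
  rewrite (_ : 2 * pi * (s + t) * xi = 2 * pi * s * xi + 2 * pi * t * xi); last by ring.
  by rewrite sinD; ring.
under eq_Rintegral do rewrite inner.
have jC := intble_cos xi iF; have jS := intble_sin xi iF.
transitivity (\int[mu]_t (FC G xi * (F t * sin (2 * pi * t * xi)) +
    FS G xi * (F t * cos (2 * pi * t * xi)))).
  by apply: eq_Rintegral => t _; ring.
by rewrite ID ?IZ//; [rewrite -/(FC F xi) -/(FS F xi); ring|exact: intbleZ..].
Qed.

(** Exponentials turn sums into products: the weight of t times the weight
    of x - t is the weight of x. *)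
Lemma wmul_conv y h F G : L2 (wmul h F) -> L2 (wmul h G) ->
  wmul y (convolve F G) = convolve (wmul y F) (wmul y G).
Proof.
move=> LF LG; apply/funext => x.
have wE z t : wgt z t * wgt z (x - t) = wgt z x by rewrite -wgtDx addrC subrK.
have wK z t : wgt z t * wgt (- z) t = 1.
  by rewrite -wgtD subrr /wgt mulr0 mul0r oppr0 expR0.
have i1 : intble (fun t => F t * G (x - t)).
  have := intbleZ (wgt (- h) x) (conv_intble x LF LG); congr intble.
  apply/funext => t; rewrite /wmul mulrACA wE mulrCA (mulrC (wgt (- h) x)) wK mulr1 //.
rewrite /wmul {1}/convolve mulrC -IZ//; apply: eq_Rintegral => t _.
by rewrite mulrACA wE mulrC.
Qed.

Lemma supported_conv F G : supported halfline F -> supported halfline G ->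
  supported halfline (convolve F G).
Proof.
move=> sF sG x xn; rewrite /convolve; suff -> : (fun t => F t * G (x - t)) = fun=> 0.
  by rewrite /Rintegral integral0.
apply/funext => t.
have [t0|t0] := ltP t 0.
  by rewrite sF ?mul0r// /halfline/= in_itv/= andbT leNgt t0.
rewrite sG ?mulr0// /halfline/= in_itv/= andbT subr_ge0 => tx.
by apply: xn; rewrite /halfline/= in_itv/= andbT; exact: le_trans tx.
Qed.

Lemma hspec_conv h F G (M : R) : 0 < M -> hspec h F -> hspec h G ->
  intble (wmul h F) -> \int[mu]_t `|wmul h F t| <= M ->
  hspec h (convolve F G) /\ Hn h (convolve F G) <= M ^+ 2 * Hn h G.
Proof.
move=> M0 [sF LF] [sG LG] iF FM.
have [L S] := young M0 LF LG iF FM.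
by rewrite /hspec /Hn (wmul_conv h LF LG); do 2?split => //; exact: supported_conv.
Qed.

End convolution.

(** * Uniqueness for products on the lattice *)

Section half_plane_transform.
Context {R : realType}.
Local Notation mu := (@lebesgue_measure R).
Implicit Types A B F G f g phi : R -> R.
Implicit Types x y h : R.

(** Real and imaginary part of the integral of (A + i B) (t) exp (- 2 i pi
    t x - 2 pi t y). *)
Definition Ure A B y x : R := FC (wmul y A) x + FS (wmul y B) x.
Definition Uim A B y x : R := FC (wmul y B) x - FS (wmul y A) x.

(** Real and imaginary part of the convolution of A1 + i B1 and A2 + i B2. *)
Definition convr A1 B1 A2 B2 x := convolve A1 A2 x - convolve B1 B2 x.
Definition convi A1 B1 A2 B2 x := convolve A1 B2 x + convolve B1 A2 x.

(** The analytic function is square integrable on every horizontal line of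
    the upper half-plane. *)
Definition allspec f := forall y, 0 < y -> hspec y f.

Lemma allspec_intble f y : allspec f -> 0 < y -> intble (wmul y f).
Proof.
move=> hf y0; have y2 : 0 < y / 2 by rewrite divr_gt0.
by apply: hspec_intble (hf _ y2); rewrite ltr_pdivrMr// ltr_pMr// ltr1n.
Qed.

Lemma allspec_conv f g : allspec f -> allspec g -> allspec (convolve f g).
Proof.
move=> hf hg y y0; have fi := allspec_intble hf y0.
have M0 : 0 < \int[mu]_t `|wmul y f t| + 1 by rewrite ltr_wpDl// I_ge0.
have M1 : \int[mu]_t `|wmul y f t| <= \int[mu]_t `|wmul y f t| + 1 by rewrite lerDl.
by have [] := hspec_conv M0 (hf _ y0) (hg _ y0) fi M1.
Qed.

Lemma FC_wmul_conv f g y x : allspec f -> allspec g -> 0 < y ->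
  FC (wmul y (convolve f g)) x = FC (wmul y f) x * FC (wmul y g) x - FS (wmul y f) x * FS (wmul y g) x.
Proof.
move=> hf hg y0; have [_ Lf] := hf _ y0; have [_ Lg] := hg _ y0.
by rewrite (wmul_conv y Lf Lg) FC_conv//; exact: allspec_intble.
Qed.

Lemma FS_wmul_conv f g y x : allspec f -> allspec g -> 0 < y ->
  FS (wmul y (convolve f g)) x = FS (wmul y f) x * FC (wmul y g) x + FC (wmul y f) x * FS (wmul y g) x.
Proof.
move=> hf hg y0; have [_ Lf] := hf _ y0; have [_ Lg] := hg _ y0.
by rewrite (wmul_conv y Lf Lg) FS_conv//; exact: allspec_intble.
Qed.

Section product.
Variables A1 B1 A2 B2 : R -> R.
Hypotheses (hA1 : allspec A1) (hB1 : allspec B1) (hA2 : allspec A2) (hB2 : allspec B2).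

Lemma allspec_convr : allspec (convr A1 B1 A2 B2).
Proof. by move=> y y0; apply: hspecB; apply: allspec_conv. Qed.

Lemma allspec_convi : allspec (convi A1 B1 A2 B2).
Proof. by move=> y y0; apply: hspecD; apply: allspec_conv. Qed.

Lemma Ure_mul y x : 0 < y ->
  Ure (convr A1 B1 A2 B2) (convi A1 B1 A2 B2) y x =
  Ure A1 B1 y x * Ure A2 B2 y x - Uim A1 B1 y x * Uim A2 B2 y x.
Proof.
move=> y0; have i f g : allspec f -> allspec g -> intble (wmul y (convolve f g)).
  by move=> hf hg; apply: allspec_intble => //; exact: allspec_conv.
rewrite {1}/Ure /convr /convi wmulB wmulD FCB ?FSD; try exact: i.
by rewrite !FC_wmul_conv// !FS_wmul_conv// /Ure /Uim; ring.
Qed.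

Lemma Uim_mul y x : 0 < y ->
  Uim (convr A1 B1 A2 B2) (convi A1 B1 A2 B2) y x =
  Ure A1 B1 y x * Uim A2 B2 y x + Uim A1 B1 y x * Ure A2 B2 y x.
Proof.
move=> y0; have i f g : allspec f -> allspec g -> intble (wmul y (convolve f g)).
  by move=> hf hg; apply: allspec_intble => //; exact: allspec_conv.
rewrite {1}/Uim /convr /convi wmulB wmulD FSB ?FCD; try exact: i.
by rewrite !FC_wmul_conv// !FS_wmul_conv// /Ure /Uim; ring.
Qed.

End product.

(** A and B are real, so that the values at x and - x separate their
    contributions. *)
Lemma FQ_eq0_of_U A B y x : intble (wmul y A) -> intble (wmul y B) ->
  Ure A B y x = 0 -> Uim A B y x = 0 -> Ure A B y (- x) = 0 -> Uim A B y (- x) = 0 ->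
  FQ (wmul y A) x = 0 /\ FQ (wmul y B) x = 0.
Proof.
move=> iA iB; rewrite /Ure /Uim !FCN !FSN// opprK => h1 h2 h3 h4.
have a1 : FC (wmul y A) x = 0 by lra.
have a2 : FS (wmul y B) x = 0 by lra.
have a3 : FC (wmul y B) x = 0 by lra.
have a4 : FS (wmul y A) x = 0 by lra.
by rewrite /FQ a1 a2 a3 a4 expr0n/= addr0.
Qed.

Lemma FC_FS_null f x : intble f -> L2 f -> sqn f = 0 -> FC f x = 0 /\ FS f x = 0.
Proof.
move=> fi Lf f0; have ae := sqn_eq0 Lf f0.
have gen (g : R -> R) : intble (fun x => f x * g x) -> \int[mu]_x (f x * g x) = 0.
  move=> fg; have -> : 0 = \int[mu]_(x in setT) (fun=> 0 : R) x by rewrite /Rintegral integral0.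
  rewrite /Rintegral; congr fine; apply: ae_eq_integral => //.
  - by apply/measurable_EFinP; exact: intble_meas.
  - by apply: ae_mono ae => z /= -> _; rewrite mul0r.
by split; apply: gen; [exact: intble_cos|exact: intble_sin].
Qed.

End half_plane_transform.

Section lattice_uniqueness.
Context {R : realType}.
Local Notation mu := (@lebesgue_measure R).
Implicit Types A B F G f g phi : R -> R.
Implicit Types x y h : R.
Variables (p a beta : R).
Hypotheses (p0 : 0 < p) (a1 : 1 < a) (b0 : 0 < beta).
Hypothesis pab : beta * ln a * (1 + 4 * p) <= 4 * pi.

Let a0 : 0 < a. Proof. exact: lt_trans a1. Qed.

Lemma allspec_pspec A : L2 A -> supported posline A -> allspec (pspec p A).
Proof. by move=> LA sA y y0; exact: hspec_pspec. Qed.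

(** The norms near the real line grow more slowly than the gain provided by
    the rows. *)
Definition decaying phi :=
  expR (- (4 * pi / beta) * j%:R) * Hn (a ^- j) phi @[j --> \oo] --> 0.

(** When all the samples vanish, only the norm on the lowest line remains
    in rows_decay; let that line tend to the real axis. *)
Lemma vanishing_rows phi : allspec phi -> decaying phi ->
  (forall i, rowr beta (a ^- i) phi = 0) -> Hn 1 phi = 0.
Proof.
move=> hp dp rp; have [K K0 HK] := rows_decay b0 a1.
apply/eqP; rewrite eq_le sqn_ge0 andbT.
have le j : Hn 1 phi <= K * (expR (- (4 * pi / beta) * j%:R) * Hn (a ^- j) phi).
  have [C C0 HC] := HK j; have aj : 0 < a ^- j by rewrite invr_gt0 exprn_gt0.
  apply: le_trans (HC _ (hp _ aj)) _; rewrite big1 => [|i _]; last exact: rp.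
  by rewrite mulr0 add0r mulrA.
have cv : K * (expR (- (4 * pi / beta) * j%:R) * Hn (a ^- j) phi) @[j --> \oo] --> 0.
  by rewrite -[X in _ --> X](mulr0 K); apply: cvgMr.
rewrite -(cvg_lim (@Rhausdorff R) cv); apply: limr_ge; first by apply/cvg_ex; exists 0.
exact: nearW.
Qed.

Lemma decayingD f g : allspec f -> allspec g -> decaying f -> decaying g ->
  decaying (fun x => f x + g x).
Proof.
move=> hf hg df dg.
have cv : 2 * (expR (- (4 * pi / beta) * j%:R) * Hn (a ^- j) f +
    expR (- (4 * pi / beta) * j%:R) * Hn (a ^- j) g) @[j --> \oo] --> 0.
  by rewrite -[X in _ --> X](mulr0 2) -[X in 2 * X](addr0 0); apply: cvgMr; exact: cvgD.
apply: (squeeze_cvgr _ (cvg_cst 0) cv); apply: nearW => j /=.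
have aj : 0 < a ^- j by rewrite invr_gt0 exprn_gt0.
rewrite mulr_ge0 ?expR_ge0 ?sqn_ge0//= -mulrDr mulrCA ler_wpM2l ?expR_ge0//.
by rewrite /Hn wmulD; apply: sqnD_le; [case: (hf _ aj)|case: (hg _ aj)].
Qed.

Lemma decayingN f : decaying f -> decaying (fun x => - f x).
Proof.
rewrite /decaying; suff -> : (fun j : nat => expR (- (4 * pi / beta) * j%:R) * Hn (a ^- j) f) =
  (fun j : nat => expR (- (4 * pi / beta) * j%:R) * Hn (a ^- j) (fun x => - f x)) by [].
apply/funext => j; rewrite -HnN; congr (_ * Hn _ _).
by apply/funext => x; rewrite mulN1r.
Qed.

(** Half of the exponential weight bounds x^p, the other half is square
    integrable. The constant is written in the scale of h because its
    growth for small h is what limits the density of the lattice. *)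
Lemma L1_pspec A h : L2 A -> supported posline A -> 0 < h ->
  exists2 M : R, 0 < M & \int[mu]_t `|wmul h (pspec p A) t| <= M /\
    M ^+ 2 = (p / pi) `^ (2 * p) / (2 * pi) * (sqn A + 1) * (h^-1) `^ (2 * p + 1).
Proof.
move=> LA sA h0; have h2 : 0 < h / 2 by rewrite divr_gt0.
have pi0 := pi_gt0 R.
pose c := (p / (pi * h)) `^ p.
pose M := c * Num.sqrt ((2 * pi * h)^-1 * (sqn A + 1)).
have sA1 : 0 < sqn A + 1 by rewrite ltr_wpDl// sqn_ge0.
have ph0 : 0 < p / (pi * h) by rewrite divr_gt0// mulr_gt0.
have q0 : 0 < (2 * pi * h)^-1 * (sqn A + 1) by rewrite mulr_gt0// invr_gt0 !mulr_gt0.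
exists M; first by rewrite mulr_gt0 ?powR_gt0 ?sqrtr_gt0.
have [Lw sw] := L2_halfwgt h2.
have hp := allspec_pspec LA sA.
have Aabs : L2 (fun x => `|A x|).
  apply: (L2_le (g := A)) => //; first by apply: measurableT_comp => //; exact: L2_meas.
  by move=> x; rewrite normr_id.
have sqA : sqn (fun x => `|A x|) = sqn A.
  by apply: eq_Rintegral => x _; rewrite real_normK ?num_real.
split.
  apply: (@le_trans _ _ (c * inner2 (fun x => wgt (h / 2) x * \1_halfline x) (fun x => `|A x|))).
    rewrite /inner2 -IZ; last exact: L2M.
    apply: le_I.
    - by apply: intble_abs; exact: allspec_intble.
    - by apply: intbleZ; exact: L2M.
    move=> x; have [x0|x0] := ltP 0 x; last first.
      have -> : wmul h (pspec p A) x = 0.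
        by rewrite /wmul /pspec sA ?mulr0 ?mul0r// /posline/= in_itv/= andbT => /(le_lt_trans x0); rewrite ltxx.
      by rewrite normr0 !mulr_ge0 ?powR_ge0 ?wgt_ge0// indicE.
    rewrite indicE mem_set; last by rewrite /halfline/= in_itv/= andbT ltW.
    rewrite mulr1 /wmul /pspec.
    have -> : wgt h x = wgt (h / 2) x * wgt (h / 2) x by rewrite -wgtD -splitr.
    rewrite (_ : x `^ p * A x * _ = (x `^ p * wgt (h / 2) x) * (wgt (h / 2) x * A x)); last by ring.
    rewrite normrM ger0_norm ?mulr_ge0 ?powR_ge0 ?wgt_ge0// normrM (ger0_norm (wgt_ge0 _ _)).
    rewrite ler_wpM2r ?mulr_ge0 ?wgt_ge0//.
    have := @powR_expR_le R p (2 * pi * (h / 2)) x p0 _ (ltW x0).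
    have -> : 2 * pi * (h / 2) = pi * h by field.
    rewrite /wgt; have -> : 2 * pi * (h / 2) * x = pi * h * x by field.
    by apply; rewrite mulr_gt0.
  rewrite /M ler_wpM2l ?powR_ge0//.
  apply: le_trans (ler_norm _) _; apply: le_trans (abs_ip Lw Aabs) _.
  rewrite -sqrtrM ?sqn_ge0// ler_wsqrtr// sqA.
  apply: ler_pM; rewrite ?sqn_ge0 ?lerDl//; apply: le_trans sw _.
  by have -> : 4 * pi * (h / 2) = 2 * pi * h by field.
rewrite /M exprMn sqr_sqrtr ?(ltW q0)// /c.
have -> : (p / (pi * h)) `^ p ^+ 2 = (p / pi) `^ (2 * p) * (h^-1) `^ (2 * p).
  rewrite -powR_mulrn ?powR_ge0// -powRrM -powRM ?invr_ge0 ?divr_ge0 ?(ltW h0) ?(ltW p0) ?(ltW pi0)//.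
  by rewrite [p * 2]mulrC invfM mulrA.
have -> : (h^-1) `^ (2 * p + 1) = (h^-1) `^ (2 * p) * h^-1.
  by rewrite powRD ?powRr1 ?invr_ge0 ?(ltW h0)// (gt_eqF (_ : 0 < h^-1)) ?implybT// invr_gt0.
by rewrite !invfM; ring.
Qed.

(** Young's inequality with L1_pspec: the squared norm of the convolution
    on the line of height h is at most a multiple of h^-(2 p + 1) times
    that of the second factor, which is o (h^-(2 p)). The product is of the
    order h^-(1 + 4 p), allowed by the condition on the lattice even in the
    case of equality, because of the little o. *)
Lemma decaying_conv A F : L2 A -> supported posline A -> L2 F -> supported posline F ->
  decaying (convolve (pspec p A) (pspec p F)).
Proof.
move=> LA sA LF sF; pose C := (p / pi) `^ (2 * p) / (2 * pi) * (sqn A + 1).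
have C0 : 0 <= C.
  by rewrite !mulr_ge0 ?powR_ge0 ?invr_ge0 ?addr_ge0 ?sqn_ge0// mulr_ge0// pi_ge0.
have cv : C * ((a ^- j) `^ (2 * p) * Hn (a ^- j) (pspec p F)) @[j --> \oo] --> 0.
  by rewrite -[X in _ --> X](mulr0 C); apply: cvgMr; exact: energy_vanish.
apply: (squeeze_cvgr _ (cvg_cst 0) cv); apply: nearW => j /=.
rewrite mulr_ge0 ?expR_ge0 ?sqn_ge0//=.
have aj : 0 < a ^- j by rewrite invr_gt0 exprn_gt0.
have aj' : 0 < a ^+ j by rewrite exprn_gt0.
have hA := allspec_pspec LA sA; have hF := allspec_pspec LF sF.
have [M M0 [iM M2]] := L1_pspec LA sA aj.
have [_ le] := hspec_conv M0 (hA _ aj) (hF _ aj) (allspec_intble hA aj) iM.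
apply: le_trans (ler_wpM2l (expR_ge0 _) le) _.
rewrite M2 invrK -/C; set E := expR _; set H := Hn _ (pspec p F).
rewrite [X in X <= _](_ : _ = C * (E * (a ^+ j) `^ (2 * p + 1) * H)); last by ring.
rewrite ler_wpM2l// ler_wpM2r ?sqn_ge0//.
have -> : (a ^- j) `^ (2 * p) = expR (- (2 * p * (j%:R * ln a))).
  by rewrite /powR gt_eqF// lnV ?posrE// lnXn// mulr_natl; congr expR; ring.
have -> : (a ^+ j) `^ (2 * p + 1) = expR ((2 * p + 1) * (j%:R * ln a)).
  by rewrite /powR gt_eqF// lnXn// -[ln a *+ j]mulr_natl.
rewrite /E -expRD ler_expR -subr_ge0.
have -> : - (2 * p * (j%:R * ln a)) - (- (4 * pi / beta) * j%:R + (2 * p + 1) * (j%:R * ln a)) =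
  j%:R / beta * (4 * pi - beta * ln a * (1 + 4 * p)) by field; rewrite gt_eqF.
by rewrite mulr_ge0 ?subr_ge0// divr_ge0// ltW.
Qed.

Variables A1 B1 A2 B2 : R -> R.
Hypotheses (LA1 : L2 A1) (LB1 : L2 B1) (LA2 : L2 A2) (LB2 : L2 B2).
Hypotheses (sA1 : supported posline A1) (sB1 : supported posline B1).
Hypotheses (sA2 : supported posline A2) (sB2 : supported posline B2).

Let P := pspec p.

(** The spectrum of the product of the two analytic functions is the
    convolution of their spectra, to which vanishing_rows applies. *)
Lemma product_vanish :
  (forall (i : nat) (n : int), let y := a ^- i in let x := n%:~R * (beta * y) in
     (Ure (P A1) (P B1) y x = 0 /\ Uim (P A1) (P B1) y x = 0) \/
     (Ure (P A2) (P B2) y x = 0 /\ Uim (P A2) (P B2) y x = 0)) ->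
  forall x, (Ure (P A1) (P B1) 1 x = 0 /\ Uim (P A1) (P B1) 1 x = 0) \/
     (Ure (P A2) (P B2) 1 x = 0 /\ Uim (P A2) (P B2) 1 x = 0).
Proof.
move=> Hz.
have [hA1 hB1 hA2 hB2] := And4 (allspec_pspec LA1 sA1) (allspec_pspec LB1 sB1)
  (allspec_pspec LA2 sA2) (allspec_pspec LB2 sB2).
set er := convr (P A1) (P B1) (P A2) (P B2).
set ei := convi (P A1) (P B1) (P A2) (P B2).
have hr : allspec er by exact: allspec_convr.
have hi : allspec ei by exact: allspec_convi.
have Uz i n : Ure er ei (a ^- i) (n%:~R * (beta * a ^- i)) = 0 /\
    Uim er ei (a ^- i) (n%:~R * (beta * a ^- i)) = 0.
  have ai : 0 < a ^- i by rewrite invr_gt0 exprn_gt0.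
  rewrite /er /ei Ure_mul// Uim_mul//.
  by case: (Hz i n) => /= -[-> ->]; rewrite !(mulr0, mul0r) subr0 addr0.
have rows i : rowr beta (a ^- i) er = 0 /\ rowr beta (a ^- i) ei = 0.
  have ai : 0 < a ^- i by rewrite invr_gt0 exprn_gt0.
  have z n : FQ (wmul (a ^- i) er) (n%:~R * (beta * a ^- i)) = 0 /\
     FQ (wmul (a ^- i) ei) (n%:~R * (beta * a ^- i)) = 0.
    have [u1 u2] := Uz i n; have [u3 u4] := Uz i (- n).
    rewrite mulrNz mulNr in u3 u4.
    by apply: FQ_eq0_of_U => //; exact: allspec_intble.
  by split; rewrite /rowr /rowe esum1// => n _; have [z1 z2] := z n; rewrite ?z1 ?z2.
have nr : Hn 1 er = 0.
  apply: vanishing_rows => //; last by move=> i; case: (rows i).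
  apply: decayingD; [exact: allspec_conv| |exact: decaying_conv|].
    by move=> y y0; have := hspecZ (-1) (allspec_conv hB1 hB2 y0); congr hspec; apply/funext => x; rewrite mulN1r.
  by apply: decayingN; exact: decaying_conv.
have ni : Hn 1 ei = 0.
  apply: vanishing_rows => //; last by move=> i; case: (rows i).
  by apply: decayingD; [exact: allspec_conv|exact: allspec_conv|exact: decaying_conv|exact: decaying_conv].
move=> x; have ir := allspec_intble hr ltr01; have ii := allspec_intble hi ltr01.
have [_ Lr] := hr _ ltr01; have [_ Li] := hi _ ltr01.
have [c1 s1] := FC_FS_null x ir Lr nr; have [c2 s2] := FC_FS_null x ii Li ni.
have er0 : Ure er ei 1 x = 0 by rewrite /Ure c1 s2 addr0.
have ei0 : Uim er ei 1 x = 0 by rewrite /Uim s1 c2 subr0.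
move: er0 ei0; rewrite /er /ei Ure_mul// Uim_mul//.
move: (Ure _ _ _ _) (Uim _ _ _ _) (Ure _ _ _ _) (Uim _ _ _ _) => u' v' u v e2 e1.
(* The modulus of a product of complex numbers. *)
have : (u ^+ 2 + v ^+ 2) * (u' ^+ 2 + v' ^+ 2) = 0.
  by transitivity ((u * u' - v * v') ^+ 2 + (u * v' + v * u') ^+ 2); [ring|rewrite e1 e2 expr0n/= addr0].
move/eqP; rewrite mulf_eq0 !paddr_eq0 ?sqr_ge0// !sqrf_eq0.
by case/orP => /andP[/eqP -> /eqP ->]; [left|right].
Qed.

End lattice_uniqueness.

(** * Analyticity on a horizontal line *)

Lemma pi_neq0 {R : realType} : pi != 0 :> R.
Proof. by rewrite gt_eqF// pi_gt0. Qed.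

Section moments.
Context {R : realType}.
Local Notation mu := (@lebesgue_measure R).
Implicit Types A B f g : R -> R.
Implicit Types x t c s : R.

(** An exponentially decreasing function: its transform is analytic on a
    strip around the real line. *)
Definition expint c g := supported halfline g /\ intble (fun t => g t * expR (c * t)).

Lemma expint_meas c g : expint c g -> measurable_fun setT g.
Proof.
move=> [_ /intble_meas mg].
have -> : g = fun t => (g t * expR (c * t)) * wgt (c / (2 * pi)) t.
  apply/funext => t; rewrite -mulrA /wgt -expRD.
  have -> : c * t + - (2 * pi * (c / (2 * pi)) * t) = 0.
    by move: (@pi_neq0 R); move: (@pi R) => P P0; field.
  by rewrite expR0 mulr1.
by apply: measurable_funM => //; exact: measurable_wgt.
Qed.

Lemma expint_dominated c g (h : R -> R) (K : R) : expint c g -> measurable_fun setT h ->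
  (forall t, 0 <= t -> `|h t| <= K * expR (c * t)) -> intble (fun t => h t * g t).
Proof.
move=> eg mh hK; have mg := expint_meas eg; have [sg ig] := eg.
apply: (intble_le (g := fun t => K * (g t * expR (c * t)))); last exact: intbleZ.
  exact: measurable_funM.
move=> t; have [t0|t0] := leP 0 t; last first.
  by rewrite sg ?(mulr0, mul0r)// /halfline/= in_itv/= andbT leNgt t0.
rewrite mulrCA !normrM mulrC ler_wpM2l// -normrM.
exact: le_trans (hK _ t0) (ler_norm _).
Qed.

Definition mom n g t : R := t ^+ n * g t.

Lemma mom0 g : mom 0 g = g.
Proof. by apply/funext => t; rewrite /mom expr0 mul1r. Qed.

Lemma momS n g : mom n.+1 g = fun t => t * mom n g t.
Proof. by apply/funext => t; rewrite /mom exprS mulrA. Qed.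

Lemma intble_mom c g n : 0 < c -> expint c g -> intble (mom n g).
Proof.
move=> c0 eg; apply: (expint_dominated (K := (n.+1%:R / c) `^ n.+1%:R + 1) eg).
  exact: measurable_funX.
move=> t t0; rewrite ger0_norm ?exprn_ge0//.
have e1 : 1 <= expR (c * t) by rewrite -[X in X <= _]expR0 ler_expR mulr_ge0// ltW.
have K0 : 0 <= (n.+1%:R / c) `^ n.+1%:R :> R by exact: powR_ge0.
have [t1|t1] := leP t 1.
  apply: (@le_trans _ _ 1); first by rewrite exprn_ile1.
  by rewrite -[X in X <= _]mul1r ler_pM// lerDr.
apply: (@le_trans _ _ (t ^+ n.+1)); first by rewrite exprS ler_peMl ?exprn_ge0// ltW.
have := @powR_expR_le R n.+1%:R c t (ltr0Sn _ _) c0 t0.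
rewrite powR_mulrn// expRN ler_pdivrMr ?expR_gt0// => h; apply: le_trans h _.
by rewrite ler_wpM2r ?expR_ge0// lerDl.
Qed.

(** The power series of the cosine and of the sine are integrated term by
    term; exp (c t) dominates them when |s| <= c. *)
Lemma moments_zero c g s : 0 < c -> expint c g -> `|s| <= c ->
  (forall n, \int[mu]_t mom n g t = 0) ->
  \int[mu]_t (g t * cos (s * t)) = 0 /\ \int[mu]_t (g t * sin (s * t)) = 0.
Proof.
move=> c0 eg sc mg0; have mg := expint_meas eg; have [sg ig] := eg.
have gen (k : R -> R) (co : nat -> R) : (forall n, `|co n| <= (n`!%:R)^-1) ->
    (forall z, series (fun n => co n * z ^+ n) n @[n --> \oo] --> k z) ->
    \int[mu]_t (g t * k (s * t)) = 0.
  move=> cob cok; pose u N t := g t * series (fun n => co n * (s * t) ^+ n) N.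
  have uE N t : u N t = \sum_(0 <= n < N) (co n * s ^+ n) * mom n g t.
    rewrite /u /series/= mulr_sumr; apply: eq_bigr => n _.
    by rewrite exprMn /mom; ring.
  have im n : intble (fun t => co n * s ^+ n * mom n g t) by apply: intbleZ; exact: (intble_mom n c0 eg).
  have uI N : \int[mu]_t u N t = 0.
    have -> : u N = fun t => \sum_(0 <= n < N) (co n * s ^+ n) * mom n g t.
      by apply/funext => t; exact: uE.
    rewrite I_sum// big1// => n _; rewrite IZ ?mg0 ?mulr0//; exact: (intble_mom n c0 eg).
  have um N : measurable_fun setT (u N).
    have -> : u N = fun t => \sum_(0 <= n < N) (co n * s ^+ n) * mom n g t.
      by apply/funext => t; exact: uE.
    by apply: intble_meas; exact: intble_sum.
  have ucv t : u N t @[N --> \oo] --> g t * k (s * t) by apply: cvgMr; exact: cok.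
  have ub N t : `|u N t| <= `|g t * expR (c * t)|.
    have [t0|t0] := leP 0 t; last first.
      by rewrite /u sg ?(mulr0, mul0r)// /halfline/= in_itv/= andbT leNgt t0.
    rewrite /u !normrM; apply: ler_wpM2l => //; rewrite (ger0_norm (expR_ge0 _)).
    have ct0 : 0 <= c * t by rewrite mulr_ge0// ltW.
    apply: (@le_trans _ _ (series (exp_coeff (c * t)) N)).
      rewrite /series/=; apply: le_trans (ler_norm_sum _ _ _) _.
      apply: ler_sum => n _; rewrite normrM normrX exp_coeffE/= ler_pM ?exprn_ge0//.
      by apply: lerXn2r; rewrite ?nnegrE// normrM (ger0_norm t0) ler_wpM2r.
    rewrite /expR; apply: nondecreasing_cvgn_le; last exact: is_cvg_series_exp_coeff.
    by apply/nondecreasing_seqP => n; rewrite seriesSr lerDl exp_coeff_ge0.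
  have [_ h _] := I_dct um ucv (intble_abs ig) ub.
  move: h; under eq_fun do rewrite uI.
  move=> h; by rewrite -(cvg_unique (@Rhausdorff R) (cvg_cst 0) h).
split.
- apply: (gen cos (fun n => (~~ odd n)%:R * (-1) ^+ n./2 / n`!%:R)) => [n|z].
    rewrite !normrM normrX normrN1 expr1n mulr1 normfV normr_nat [`|n`!%:R|]ger0_norm//.
    by case: odd; rewrite ?mul0r ?mul1r ?invr_ge0.
  rewrite cos.unlock; have := @is_cvg_series_cos_coeff R z.
  by rewrite cos_coeffE.
- apply: (gen sin (fun n => (odd n)%:R * (-1) ^+ n.-1./2 / n`!%:R)) => [n|z].
    rewrite !normrM normrX normrN1 expr1n mulr1 normfV normr_nat [`|n`!%:R|]ger0_norm//.
    by case: odd; rewrite ?mul0r ?mul1r ?invr_ge0.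
  rewrite sin.unlock; have := @is_cvg_series_sin_coeff R z.
  by rewrite sin_coeffE.
Qed.

End moments.

Section identity_theorem.
Context {R : realType}.
Local Notation mu := (@lebesgue_measure R).
Implicit Types A B f g : R -> R.
Implicit Types x t c s : R.

(** The functions of this form, with A and B exponentially decreasing, are
    analytic; their derivatives have the same form, with moments of A and B
    as coefficients. *)
Definition trig A B x : R := FC A x + FS B x.

Lemma trigE A B x : intble A -> intble B ->
  trig A B x = \int[mu]_t (A t * cos (2 * pi * t * x) + B t * sin (2 * pi * t * x)).
Proof. by move=> iA iB; rewrite ID//; [exact: intble_cos|exact: intble_sin]. Qed.

Lemma is_derive_trig A B x t : is_derive x (1:R)
  (fun x => A t * cos (2 * pi * t * x) + B t * sin (2 * pi * t * x))
  (2 * pi * (t * (B t * cos (2 * pi * t * x) - A t * sin (2 * pi * t * x)))).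
Proof.
pose c := 2 * pi * t.
have D : is_derive x (1:R) (fun x => c * x) c.
  have -> : (fun x => c * x) = c \*: @id R by [].
  by apply: is_derive_eq; rewrite /GRing.scale/= mulr1.
have D1 := is_deriveZ (A t) (@is_derive1_comp R cos _ x _ _ (is_derive_cos (c * x)) D).
have D2 := is_deriveZ (B t) (@is_derive1_comp R sin _ x _ _ (is_derive_sin (c * x)) D).
have := is_deriveD D1 D2; move=> /is_derive_eq; apply.
by rewrite /GRing.scale/= /c; ring.
Qed.

(** Differentiation under the integral sign. *)
Lemma trig_derive A B u v x : intble A -> intble B -> intble (mom 1 A) -> intble (mom 1 B) ->
  u < x < v -> (forall z, u < z < v -> trig A B z = 0) ->
  trig (mom 1 B) (fun t => - mom 1 A t) x = 0.
Proof.
move=> iA iB iA1 iB1 uxv Z.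
pose k (z t : R) := A t * cos (2 * pi * t * z) + B t * sin (2 * pi * t * z).
pose dk (z t : R) := 2 * pi * (t * (B t * cos (2 * pi * t * z) - A t * sin (2 * pi * t * z))).
have kd z t : is_derive z (1:R) (k ^~ t) (dk z t) by exact: is_derive_trig.
have d1E z t : partial1of2 k z t = dk z t.
  by rewrite partial1of2E; exact: derive_val.
have Ix : `]u, v[%classic x by rewrite /= in_itv/=.
pose G t := 2 * pi * (`|mom 1 A t| + `|mom 1 B t|).
have G0 t : 0 <= G t by rewrite mulr_ge0// ?addr_ge0// mulr_ge0// pi_ge0.
have iG : mu.-integrable setT (EFin \o G).
  by apply: intbleZ; apply: intbleD; exact: intble_abs.
have ik z : `]u, v[%classic z -> mu.-integrable setT (EFin \o k z).
  by move=> _; apply: intbleD; [exact: intble_cos|exact: intble_sin].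
have kdb z t : `]u, v[%classic z -> setT t -> derivable (k ^~ t) z 1.
  by move=> _ _; have [] := kd z t.
have kG z t : `]u, v[%classic z -> setT t -> `|partial1of2 k z t| <= G t.
  move=> _ _; rewrite d1E /dk /G normrM ger0_norm ?mulr_ge0 ?pi_ge0//.
  rewrite ler_wpM2l ?mulr_ge0 ?pi_ge0// /mom expr1 mulrBr.
  apply: le_trans (ler_normB _ _) _; rewrite addrC !mulrA !normrM.
  by apply: lerD; rewrite ler_piMr ?mulr_ge0 ?cos_max ?sin_max.
have := differentiation_under_integral measurableT Ix ik kdb G0 iG kG.
set F := fun x' => _.
have F0 z : u < z < v -> F z = 0.
  by move=> zI; rewrite /F -trigE// Z.
have -> : (F^`())%classic x = 0.
  rewrite derive1E (@near_eq_derive _ _ _ F (fun=> 0)) ?derive_cst//.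
  have : \forall z \near x, z \in `]u, v[ by apply: near_in_itvoo; rewrite in_itv/=.
  by apply: filterS => z; rewrite in_itv/=; exact: F0.
under eq_Rintegral do rewrite d1E.
pose D t := mom 1 B t * cos (2 * pi * t * x) + (- mom 1 A t) * sin (2 * pi * t * x).
have iD : intble D.
  by apply: intbleD; [exact: intble_cos|apply: intble_sin; exact: intbleN].
have -> : (fun t => dk x t) = fun t => 2 * pi * D t.
  by apply/funext => t; rewrite /dk /D /mom expr1; ring.
rewrite IZ// => /esym/eqP; rewrite mulf_eq0 mulf_eq0 pnatr_eq0/= gt_eqF ?pi_gt0//= => /eqP <-.
by rewrite trigE//; exact: intbleN.
Qed.

Lemma trigN A B x : intble A -> intble B ->
  trig (fun t => - A t) (fun t => - B t) x = - trig A B x.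
Proof.
move=> iA iB; rewrite !trigE//; [|exact: intbleN..].
rewrite -IN; last by apply: intbleD; [exact: intble_cos|exact: intble_sin].
by apply: eq_Rintegral => t _; ring.
Qed.

(** The vanishing at x of the real and of the imaginary part of the
    integral of (A + i B) (t) exp (- 2 i pi t x). Taking both keeps the
    pair of conditions stable under differentiation. *)
Definition trig0 A B x := trig A B x = 0 /\ trig B (fun t => - A t) x = 0.

Lemma trig0_mom1 A B u v : intble A -> intble B -> intble (mom 1 A) -> intble (mom 1 B) ->
  (forall z, u < z < v -> trig0 A B z) ->
  forall z, u < z < v -> trig0 (mom 1 A) (mom 1 B) z.
Proof.
move=> iA iB iA1 iB1 Z z zI.
have momN : mom 1 (fun t => - A t) = fun t => - mom 1 A t.
  by apply/funext => t; rewrite /mom mulrN.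
split; last by apply: (trig_derive iA iB iA1 iB1 zI) => w wI; case: (Z w wI).
have iNA1 : intble (mom 1 (fun t => - A t)) by rewrite momN; exact: intbleN.
have := trig_derive iB (intbleN iA) iB1 iNA1 zI (fun w wI => (Z w wI).2).
by rewrite momN trigN// => /eqP; rewrite oppr_eq0 => /eqP.
Qed.

Variables (A B : R -> R) (c : R).
Hypotheses (c0 : 0 < c) (eA : expint c A) (eB : expint c B).

Let iA n : intble (mom n A). Proof. exact: (intble_mom n c0 eA). Qed.
Let iB n : intble (mom n B). Proof. exact: (intble_mom n c0 eB). Qed.

Lemma trig0_moments u v : (forall z, u < z < v -> trig0 A B z) ->
  forall n z, u < z < v -> trig0 (mom n A) (mom n B) z.
Proof.
move=> Z; elim => [|n ih]; first by rewrite !mom0.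
have mE g : mom n.+1 g = mom 1 (mom n g).
  by apply/funext => t; rewrite momS /mom expr1.
by rewrite !mE; apply: trig0_mom1 => //; rewrite -mE.
Qed.

(** The Taylor expansion at x: the derivatives at x are moments of the
    modulated functions f and g. *)
Lemma moments_trig0 x x' : (forall n, trig0 (mom n A) (mom n B) x) ->
  `|2 * pi * (x' - x)| <= c -> trig0 A B x'.
Proof.
move=> Z sc; set s := 2 * pi * (x' - x) in sc.
pose f t := A t * cos (2 * pi * t * x) + B t * sin (2 * pi * t * x).
pose g t := B t * cos (2 * pi * t * x) - A t * sin (2 * pi * t * x).
have expD F G : expint c F -> expint c G -> expint c (fun t => F t * cos (2 * pi * t * x) + G t * sin (2 * pi * t * x)).
  move=> [sF iF] [sG iG]; split; first by move=> t tn; rewrite sF// sG// !mul0r addr0.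
  have := intbleD (intble_cos x iF) (intble_sin x iG); congr intble.
  by apply/funext => t; ring.
have expN F : expint c F -> expint c (fun t => - F t).
  move=> [sF iF]; split; first by move=> t tn; rewrite sF// oppr0.
  by have := intbleN iF; congr intble; apply/funext => t; rewrite mulNr.
have ef : expint c f by exact: expD.
have eg : expint c g.
  by have := expD _ _ eB (expN _ eA); congr expint; apply/funext => t; rewrite /g mulNr.
have fm n : \int[mu]_t mom n f t = 0.
  have [h _] := Z n; rewrite trigE// in h; rewrite -[RHS]h.
  by apply: eq_Rintegral => t _; rewrite /mom /f; ring.
have gm n : \int[mu]_t mom n g t = 0.
  have [_ h] := Z n; rewrite trigE// in h; last exact: intbleN.
  rewrite -[RHS]h.
  by apply: eq_Rintegral => t _; rewrite /mom /g; ring.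
have [fc fs] := moments_zero c0 ef sc fm; have [gc gs] := moments_zero c0 eg sc gm.
have i1 F : expint c F -> intble F by move=> eF; have := intble_mom 0 c0 eF; rewrite mom0.
have bc : forall t, `|cos (s * t)| <= 1 by move=> t; exact: cos_max.
have bs : forall t, `|sin (s * t)| <= 1 by move=> t; exact: sin_max.
have mc : measurable_fun setT (fun t => cos (s * t)).
  by have := measurable_cosM (s / (2 * pi)); congr measurable_fun; apply/funext => t; congr cos; move: (@pi_neq0 R); move: (@pi R) => P P0; field.
have ms : measurable_fun setT (fun t => sin (s * t)).
  by have := measurable_sinM (s / (2 * pi)); congr measurable_fun; apply/funext => t; congr sin; move: (@pi_neq0 R); move: (@pi R) => P P0; field.
have ib F (h : R -> R) : expint c F -> measurable_fun setT h -> (forall t : R, `|h t| <= 1) -> intble (fun t => F t * h t).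
  by move=> eF mh hb; have := intble_bounded mh hb (i1 _ eF); congr intble; apply/funext => t; exact: mulrC.
have add t : 2 * pi * t * x' = 2 * pi * t * x + s * t by rewrite /s; ring.
split.
- rewrite trigE; [|exact: i1..].
  transitivity (\int[mu]_t (f t * cos (s * t) + g t * sin (s * t))).
    by apply: eq_Rintegral => t _; rewrite add cosD sinD /f /g; ring.
  by rewrite ID ?fc ?gs ?addr0//; exact: ib.
- rewrite trigE; [|exact: i1|by apply: intbleN; exact: i1].
  transitivity (\int[mu]_t (g t * cos (s * t) - f t * sin (s * t))).
    by apply: eq_Rintegral => t _; rewrite add cosD sinD /f /g; ring.
  by rewrite IB ?gc ?fs ?subr0//; exact: ib.
Qed.

(** The principle of isolated zeros: vanishing propagates by steps of a
    fixed length, within the radius of convergence of the Taylor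
    expansions. *)
Lemma trig0_identity u v : u < v -> (forall z, u < z < v -> trig0 A B z) ->
  forall x, trig0 A B x.
Proof.
move=> uv Z; pose d := c / (4 * pi).
have pi0 := pi_gt0 R.
have d0 : 0 < d by rewrite divr_gt0// mulr_gt0.
have dc z w : `|z - w| <= 2 * d -> `|2 * pi * (z - w)| <= c.
  rewrite normrM ger0_norm ?mulr_ge0 ?(ltW pi0)// => h.
  rewrite (_ : c = 2 * pi * (2 * d)); last by rewrite /d; move: (@pi_neq0 R); move: (@pi R) => P P0; field.
  by rewrite ler_wpM2l ?mulr_ge0 ?(ltW pi0).
pose x0 := (u + v) / 2.
have x0I : u < x0 < v by rewrite /x0; apply/andP; split; lra.
have main k : forall x, `|x - x0| <= k%:R * d -> forall n, trig0 (mom n A) (mom n B) x.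
  elim: k => [|k ih] x.
    rewrite mul0r normr_le0 subr_eq0 => /eqP -> n.
    exact: (trig0_moments Z).
  (* The point w lies at a fraction k / (k + 1) of the way from x0 to x,
     one step before x. *)
  move=> xk; pose w := x0 + (x - x0) * (k%:R / k.+1%:R).
  have k1 : 0 < k.+1%:R :> R by rewrite ltr0n.
  have wk : `|w - x0| <= k%:R * d.
    rewrite /w addrC addKr normrM [`|_ / _|]ger0_norm ?divr_ge0// mulrA.
    by rewrite ler_pdivrMr// mulrAC mulrC -mulrA ler_wpM2l// mulrC.
  have xw : `|x - w| <= d.
    rewrite /w; have -> : x - (x0 + (x - x0) * (k%:R / k.+1%:R)) = (x - x0) / k.+1%:R.
      by rewrite -natr1; field; rewrite natr1 gt_eqF.
    by rewrite normrM normfV (gtr0_norm k1) ler_pdivrMr// mulrC.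
  move=> n; apply: (trig0_moments (u := w - 2 * d) (v := w + 2 * d)) => [z zI|].
    apply: (moments_trig0 (ih w wk)); apply: dc; rewrite ler_norml; lra.
  move: xw; rewrite ler_norml => /andP[h1 h2]; apply/andP; split; lra.
move=> x; have [k hk] : exists k : nat, `|x - x0| / d <= k%:R.
  by exists (Num.truncn (`|x - x0| / d)).+1; rewrite ltW// truncnS_gt.
by rewrite ler_pdivrMr// in hk; have := main k x hk 0; rewrite !mom0.
Qed.

End identity_theorem.

Section dichotomy.
Context {R : realType}.
Local Notation mu := (@lebesgue_measure R).
Implicit Types A B : R -> R.

Lemma allspec_expint A : allspec A -> expint pi (wmul 1 A).
Proof.
move=> hA; have [sA _] := hA _ ltr01; split; first exact: supported_wmul.
have h2 : (0:R) < 2^-1 by rewrite invr_gt0.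
have := allspec_intble hA h2; congr intble; apply/funext => t.
rewrite /wmul /wgt -[RHS]mulrA -expRD; congr (_ * expR _); by field.
Qed.

Lemma U_trig A B x : allspec A ->
  (Ure A B 1 x = 0 /\ Uim A B 1 x = 0) <-> trig0 (wmul 1 A) (wmul 1 B) x.
Proof.
move=> hA; rewrite /Ure /Uim /trig0 /trig.
suff -> : FS (fun t => - wmul 1 A t) x = - FS (wmul 1 A) x by [].
rewrite /FS -IN; last by apply: intble_sin; exact: allspec_intble.
by apply: eq_Rintegral => t _; rewrite mulNr.
Qed.

Lemma continuous_trig A B : intble A -> intble B -> continuous (trig A B).
Proof. by move=> iA iB x; apply: cvgD; [exact: continuous_FC|exact: continuous_FS]. Qed.

Lemma continuous_neq0_itv (F : R -> R) x : continuous F -> F x != 0 ->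
  exists u v : R, u < v /\ forall z, u < z < v -> F z != 0.
Proof.
move=> cF Fx; have : \forall z \near x, F z != 0.
  exact: (cvgr_neq0 _ (cF x) Fx).
move=> /nbhs_ballP[e e0 he]; exists (x - e), (x + e); split; first by rewrite /= in e0; lra.
by move=> z /andP[h1 h2]; apply: he; rewrite /ball/= ltr_norml; apply/andP; split; lra.
Qed.

(** Where one function is not zero, it is not zero on an interval, by
    continuity; the other one then vanishes on that interval, hence
    everywhere. *)
Lemma one_factor_vanishes A1 B1 A2 B2 : allspec A1 -> allspec B1 -> allspec A2 -> allspec B2 ->
  (forall x, (Ure A1 B1 1 x = 0 /\ Uim A1 B1 1 x = 0) \/
     (Ure A2 B2 1 x = 0 /\ Uim A2 B2 1 x = 0)) ->
  (forall x, Ure A1 B1 1 x = 0 /\ Uim A1 B1 1 x = 0) \/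
  (forall x, Ure A2 B2 1 x = 0 /\ Uim A2 B2 1 x = 0).
Proof.
move=> hA1 hB1 hA2 hB2 H.
have [?|/existsNP[x0 hx]] := pselect (forall x, Ure A1 B1 1 x = 0 /\ Uim A1 B1 1 x = 0).
  by left.
right; suff [u [v [uv nz]]] : exists u v : R, u < v /\
    forall z, u < z < v -> ~ (Ure A1 B1 1 z = 0 /\ Uim A1 B1 1 z = 0).
  move=> x; apply/(U_trig B2 x hA2).
  apply: (trig0_identity (pi_gt0 R) (allspec_expint hA2) (allspec_expint hB2) uv) => z zI.
  by apply/(U_trig B2 z hA2); case: (H z) => // /(nz _ zI).
have cre : continuous (Ure A1 B1 1).
  by apply: continuous_trig; exact: allspec_intble.
have cim : continuous (Uim A1 B1 1).
  by move=> x; apply: cvgB; [apply: continuous_FC|apply: continuous_FS]; exact: allspec_intble.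
have [h1|h1] := eqVneq (Ure A1 B1 1 x0) 0.
  have h2 : Uim A1 B1 1 x0 != 0 by apply/eqP => h2; apply: hx.
  have [u [v [uv nz]]] := continuous_neq0_itv cim h2.
  by exists u, v; split => // z /nz /eqP nz' [_].
have [u [v [uv nz]]] := continuous_neq0_itv cre h1.
by exists u, v; split => // z /nz /eqP nz' [].
Qed.

(** Values at opposite points give the transforms of A and B separately;
    then Plancherel. *)
Lemma U_inj A B : allspec A -> allspec B ->
  (forall x, Ure A B 1 x = 0 /\ Uim A B 1 x = 0) -> Hn 1 A = 0 /\ Hn 1 B = 0.
Proof.
move=> hA hB U0; have iA := allspec_intble hA ltr01; have iB := allspec_intble hB ltr01.
have [_ LA] := hA _ ltr01; have [_ LB] := hB _ ltr01.
have Q x : FQ (wmul 1 A) x = 0 /\ FQ (wmul 1 B) x = 0.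
  by have [u1 u2] := U0 x; have [u3 u4] := U0 (- x); apply: FQ_eq0_of_U.
have z f : intble f -> L2 f -> (forall x, FQ f x = 0) -> sqn f = 0.
  move=> fi Lf Qf; have [_ _ <-] := plancherel Lf fi.
  have C0 x : FC f x = 0 /\ FS f x = 0.
    by have /eqP := Qf x; rewrite /FQ paddr_eq0 ?sqr_ge0// !sqrf_eq0 => /andP[/eqP -> /eqP ->].
  have -> : FC f = fun=> 0 by apply/funext => x; have [] := C0 x.
  have -> : FS f = fun=> 0 by apply/funext => x; have [] := C0 x.
  by rewrite /sqn expr0n/= /Rintegral integral0 addr0.
by split; apply: z => // x; have [] := Q x.
Qed.

End dichotomy.

(** * The Fourier transform of square integrable functions *)

Section square_norm.
Context {R : realType}.
Local Notation mu := (@lebesgue_measure R).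
Implicit Types f g : R -> R.

Lemma Lnorm2E f : ('N[mu]_2%:E [EFin \o f] = (\int[mu]_x (f x ^+ 2)%:E) `^ 2^-1)%E.
Proof.
rewrite unlock /Lnorm; congr (_ `^ _)%E; apply: eq_integral => x _ /=.
by rewrite powR_mulrn// real_normK ?num_real.
Qed.

Lemma Lnorm2_sqn f : L2 f -> ('N[mu]_2%:E [EFin \o f] = (Num.sqrt (sqn f))%:E)%E.
Proof. by move=> Lf; rewrite Lnorm2E -EFin_sqn// poweR_EFin powR12_sqrt// sqn_ge0. Qed.

Lemma realL2_L2 f : realL2 f -> L2 f.
Proof.
move=> Lf; split; last exact: (Lfun2_integrable_sqr Lf).
by have := sub_Lfun_mfun Lf; rewrite inE.
Qed.

Lemma L2_realL2 f : L2 f -> realL2 f.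
Proof.
move=> Lf; rewrite /realL2 inE/=; apply/andP; split; rewrite inE/=; first exact: L2_meas.
by rewrite /finite_norm Lnorm2_sqn// ltry.
Qed.

Lemma cdist2E (f g : R -> R[i]) :
  L2 (fun x => complex.Re (f x) - complex.Re (g x)) ->
  L2 (fun x => complex.Im (f x) - complex.Im (g x)) ->
  cdist2 f g = (Num.sqrt (sqn (fun x => complex.Re (f x) - complex.Re (g x)) +
     sqn (fun x => complex.Im (f x) - complex.Im (g x))))%:E.
Proof.
move=> Lr Li; rewrite /cdist2.
rewrite (_ : (fun x => _) = EFin \o (fun x => ComplexField.Normc.normc (f x - g x))); last by [].
rewrite Lnorm2E.
have -> : (\int[mu]_x (ComplexField.Normc.normc (f x - g x) ^+ 2)%:E)%E =
    (sqn (fun x => complex.Re (f x) - complex.Re (g x)) +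
     sqn (fun x => complex.Im (f x) - complex.Im (g x)))%:E.
  rewrite /sqn -ID; [|exact: Lr.2|exact: Li.2].
  rewrite EFin_I; last by apply: intbleD; [exact: Lr.2|exact: Li.2].
  apply: eq_integral => x _; congr EFin; case: (f x) => a b; case: (g x) => c d /=.
  by rewrite sqr_sqrtr// addr_ge0// sqr_ge0.
by rewrite poweR_EFin powR12_sqrt// addr_ge0// sqn_ge0.
Qed.

Lemma cdist2_cvg0 (u : nat -> R -> R[i]) (f : R -> R[i]) :
  (forall n, L2 (fun x => complex.Re (u n x) - complex.Re (f x))) ->
  (forall n, L2 (fun x => complex.Im (u n x) - complex.Im (f x))) ->
  cdist2 (u n) f @[n --> \oo] --> 0%E ->
  L2cvg (fun n x => complex.Re (u n x)) (fun x => complex.Re (f x)) /\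
  L2cvg (fun n x => complex.Im (u n x)) (fun x => complex.Im (f x)).
Proof.
move=> Lr Li; under eq_fun do rewrite cdist2E//.
move=> /fine_cvgP[_] /= h.
set S := fun n => sqn (fun x => complex.Re (u n x) - complex.Re (f x)) +
     sqn (fun x => complex.Im (u n x) - complex.Im (f x)).
have S0 n : 0 <= S n by rewrite addr_ge0 ?sqn_ge0.
have cS : S n @[n --> \oo] --> 0.
  have -> : S = fun n => Num.sqrt (S n) * Num.sqrt (S n).
    by apply/funext => n /=; rewrite -expr2 sqr_sqrtr.
  rewrite -[X in _ --> X](mulr0 0); exact: (cvgM h h).
split; apply: (squeeze_cvgr _ (cvg_cst 0) cS); apply: nearW => n /=;
  by rewrite sqn_ge0/= ?lerDl ?lerDr sqn_ge0.
Qed.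

Lemma cLfun2 (f : R -> R[i]) : cLfun 2%:E f ->
  L2 (fun x => complex.Re (f x)) /\ L2 (fun x => complex.Im (f x)).
Proof. by move=> [h1 h2]; split; exact: realL2_L2. Qed.

Lemma cLfun1 (f : R -> R[i]) : cLfun 1%E f ->
  intble (fun x => complex.Re (f x)) /\ intble (fun x => complex.Im (f x)).
Proof. by move=> [h1 h2]; split; apply/Lfun1_integrable. Qed.

Lemma fourier1E (f : R -> R[i]) xi :
  intble (fun x => complex.Re (f x)) -> intble (fun x => complex.Im (f x)) ->
  complex.Re (fourier1 f xi) = FC (fun x => complex.Re (f x)) xi + FS (fun x => complex.Im (f x)) xi /\
  complex.Im (fourier1 f xi) = FC (fun x => complex.Im (f x)) xi - FS (fun x => complex.Re (f x)) xi.
Proof.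
move=> ir ii; have c1 := intble_cos xi ir; have c2 := intble_cos xi ii.
have s1 := intble_sin xi ir; have s2 := intble_sin xi ii.
split.
  rewrite /fourier1/= /FC /FS -ID//; apply: eq_Rintegral => x _.
  by case: (f x) => a b /=; rewrite cosN sinN mulrN opprK.
rewrite /fourier1/= /FC /FS -IB//; apply: eq_Rintegral => x _.
by case: (f x) => a b /=; rewrite cosN sinN mulrN addrC.
Qed.

End square_norm.

Section real_fourier.
Context {R : realType}.
Local Notation mu := (@lebesgue_measure R).
Implicit Types f g A B : R -> R.

(** The functions A and B represent the cosine and the sine transform of f,
    extended by density. *)
Definition FTr f A B := [/\ L2 f, L2 A, L2 B & exists u : nat -> R -> R,
  [/\ forall n, L2 (u n) /\ intble (u n), L2cvg u f,
      L2cvg (fun n => FC (u n)) A & L2cvg (fun n => FS (u n)) B]].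

Lemma cvg0_cM (c : R) (b : nat -> R) : b n @[n --> \oo] --> 0 -> c * b n @[n --> \oo] --> 0.
Proof. by move=> b0; rewrite -[X in _ --> X](mulr0 c); exact: cvgMr. Qed.

Lemma cvg0_D (b b' : nat -> R) : b n @[n --> \oo] --> 0 -> b' n @[n --> \oo] --> 0 ->
  b n + b' n @[n --> \oo] --> 0.
Proof. by move=> h h'; rewrite -[X in _ --> X](addr0 0); exact: cvgD. Qed.

Lemma L2cvg_le (u : nat -> R -> R) f (b : nat -> R) : b n @[n --> \oo] --> 0 ->
  (forall n, sqn (fun x => u n x - f x) <= b n) -> L2cvg u f.
Proof.
move=> b0 ub; apply: (squeeze_cvgr _ (cvg_cst 0) b0); apply: nearW => n /=.
by rewrite sqn_ge0/= ub.
Qed.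

Lemma plancherel_le f : L2 f -> intble f -> sqn (FC f) <= sqn f /\ sqn (FS f) <= sqn f.
Proof.
move=> Lf fi; have [_ _ e] := plancherel Lf fi; rewrite -e.
by split; [exact: (ler_wpDr (sqn_ge0 _) (lexx _))|exact: (ler_wpDl (sqn_ge0 _) (lexx _))].
Qed.

Lemma L2cvg_ae u f g : (forall n, L2 (u n)) -> L2 f -> L2 g ->
  sqn (fun x => f x - g x) = 0 -> L2cvg u f -> L2cvg u g.
Proof.
move=> Lu Lf Lg fg uf.
have cv : 2 * (sqn (fun x => u n x - f x) + sqn (fun x => f x - g x)) @[n --> \oo] --> 0.
  rewrite fg -[X in _ --> X](mulr0 2) -[X in 2 * X](addr0 0); apply: cvgMr.
  by apply: cvgD => //; exact: cvg_cst.
apply: (squeeze_cvgr _ (cvg_cst 0) cv); apply: nearW => n /=.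
rewrite sqn_ge0/= (_ : (fun x => u n x - g x) = fun x => (u n x - f x) + (f x - g x)).
  by apply: sqnD_le; exact: L2B.
by apply/funext => x; rewrite addrA subrK.
Qed.

Lemma FTr_ae f A B A' B' : FTr f A B -> L2 A' -> L2 B' ->
  sqn (fun x => A x - A' x) = 0 -> sqn (fun x => B x - B' x) = 0 -> FTr f A' B'.
Proof.
move=> [Lf LA LB [u [Lu uf uA uB]]] LA' LB' eA eB; split => //; exists u; split => //.
  by apply: L2cvg_ae eA uA => // n; have [] := plancherel (Lu n).1 (Lu n).2.
by apply: L2cvg_ae eB uB => // n; have [] := plancherel (Lu n).1 (Lu n).2.
Qed.

Lemma parseval f g : L2 f -> intble f -> L2 g -> intble g ->
  inner2 f g = inner2 (FC f) (FC g) + inner2 (FS f) (FS g).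
Proof.
move=> Lf fi Lg gi; have [Lcf Lsf ef] := plancherel Lf fi.
have [Lcg Lsg eg] := plancherel Lg gi.
have [_ _] := plancherel (L2D Lf Lg) (intbleD fi gi).
have -> : FC (fun x => f x + g x) = fun xi => FC f xi + FC g xi.
  by apply/funext => xi; exact: FCD.
have -> : FS (fun x => f x + g x) = fun xi => FS f xi + FS g xi.
  by apply/funext => xi; exact: FSD.
rewrite (sqnD Lcf Lcg) (sqnD Lsf Lsg) (sqnD Lf Lg) -ef -eg; clear.
move: (inner2 _ _) (inner2 _ _) (inner2 _ _) (sqn _) (sqn _) (sqn _) (sqn _) => *; lra.
Qed.

Lemma FTr_parseval f A B g A' B' : FTr f A B -> FTr g A' B' ->
  inner2 f g = inner2 A A' + inner2 B B'.
Proof.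
move=> [Lf LA LB [u [Lu uf uA uB]]] [Lg LA' LB' [v [Lv vg vA vB]]].
have Lu1 n := (Lu n).1; have Lv1 n := (Lv n).1.
have LCu n : L2 (FC (u n)) by have [] := plancherel (Lu n).1 (Lu n).2.
have LSu n : L2 (FS (u n)) by have [] := plancherel (Lu n).1 (Lu n).2.
have LCv n : L2 (FC (v n)) by have [] := plancherel (Lv n).1 (Lv n).2.
have LSv n : L2 (FS (v n)) by have [] := plancherel (Lv n).1 (Lv n).2.
have h1 := ip_cvg Lu1 Lv1 Lf Lg uf vg.
have h2 : inner2 (u n) (v n) @[n --> \oo] --> inner2 A A' + inner2 B B'.
  rewrite (_ : (fun n => inner2 (u n) (v n)) =
    (fun n => inner2 (FC (u n)) (FC (v n)) + inner2 (FS (u n)) (FS (v n)))); last first.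
    by apply/funext => n; apply: parseval => //; [case: (Lu n)|case: (Lv n)].
  by apply: cvgD; exact: ip_cvg.
exact: (cvg_unique (@Rhausdorff R) h1 h2).
Qed.

(** Parseval's identity gives the same value to the three inner products of
    the two representatives. *)
Lemma FTr_unique f A B A' B' : FTr f A B -> FTr f A' B' ->
  sqn (fun x => A x - A' x) = 0 /\ sqn (fun x => B x - B' x) = 0.
Proof.
move=> h h'; have [_ LA LB _] := h; have [_ LA' LB' _] := h'.
have e1 := FTr_parseval h h; have e2 := FTr_parseval h h'; have e3 := FTr_parseval h' h'.
rewrite !ipxx in e1 e2 e3.
have := sqn_ge0 (fun x => A x - A' x); have := sqn_ge0 (fun x => B x - B' x).
rewrite !sqnB// => p1 p2; split; lra.
Qed.

(** By Plancherel the transforms of the truncations form Cauchy sequences. *)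
Lemma FTr_exists f : L2 f -> exists A B, FTr f A B.
Proof.
move=> Lf; pose u := trunc f.
have Lu n : L2 (u n) by exact: L2_trunc.
have iu n : intble (u n) by exact: intble_trunc.
have LCu n : L2 (FC (u n)) by have [] := plancherel (Lu n) (iu n).
have LSu n : L2 (FS (u n)) by have [] := plancherel (Lu n) (iu n).
have uf : L2cvg u f by exact: L2cvg_trunc.
have D m n : sqn (fun x => FC (u m) x - FC (u n) x) + sqn (fun x => FS (u m) x - FS (u n) x) =
    sqn (fun x => u m x - u n x).
  have [_ _ <-] := plancherel (L2B (Lu m) (Lu n)) (intbleB (iu m) (iu n)).
  by congr (sqn _ + sqn _); apply/funext => xi; rewrite ?FCB ?FSB.
have [|A LA uA] := L2_complete LCu.
  move=> e e0; have [N HN] := L2cvg_cauchy Lu Lf uf e0; exists N => m n Nm Nn.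
  by apply: le_trans (HN m n Nm Nn); rewrite -D lerDl sqn_ge0.
have [|B LB uB] := L2_complete LSu.
  move=> e e0; have [N HN] := L2cvg_cauchy Lu Lf uf e0; exists N => m n Nm Nn.
  by apply: le_trans (HN m n Nm Nn); rewrite -D lerDr sqn_ge0.
by exists A, B; split => //; exists u; split.
Qed.

(** The approximating sequence may be complex; its imaginary part tends to
    zero, so its real part also approximates f. *)
Lemma FTr_of_fourier2 f (h : R -> R[i]) : is_fourier2 (fun x => (f x)%:C%C) h ->
  FTr f (fun x => complex.Re (h x)) (fun x => - complex.Im (h x)).
Proof.
move=> [/cLfun2[Lf _] /cLfun2[Lhr Lhi] [u [Lu uf uh]]].
pose pr n x := complex.Re (u n x); pose qi n x := complex.Im (u n x).
have [Lp Lq] : (forall n, L2 (pr n)) /\ (forall n, L2 (qi n)).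
  by split => n; have [_ /cLfun2[]] := Lu n.
have [ip iq] : (forall n, intble (pr n)) /\ (forall n, intble (qi n)).
  by split => n; have [/cLfun1[]] := Lu n.
have L0 : L2 (fun x : R => complex.Im ((f x)%:C)%C) by exact: L2_0.
have [up uq] := cdist2_cvg0 (fun n => L2B (Lp n) Lf) (fun n => L2B (Lq n) L0) uf.
have {}uq : sqn (qi n) @[n --> \oo] --> 0.
  by move: uq; rewrite /L2cvg; under [in X in X -> _]eq_fun do under eq_fun do rewrite subr0.
have LCp n : L2 (FC (pr n)) by have [] := plancherel (Lp n) (ip n).
have LSp n : L2 (FS (pr n)) by have [] := plancherel (Lp n) (ip n).
have LCq n : L2 (FC (qi n)) by have [] := plancherel (Lq n) (iq n).
have LSq n : L2 (FS (qi n)) by have [] := plancherel (Lq n) (iq n).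
have reE n x : complex.Re (fourier1 (u n) x) = FC (pr n) x + FS (qi n) x.
  by have [] := fourier1E x (ip n) (iq n).
have imE n x : complex.Im (fourier1 (u n) x) = FC (qi n) x - FS (pr n) x.
  by have [] := fourier1E x (ip n) (iq n).
have [||uA uB] := cdist2_cvg0 (u := fun n => fourier1 (u n)) (f := h) _ _ uh.
- by move=> n; under eq_fun do rewrite reE; apply: L2B => //; exact: L2D.
- by move=> n; under eq_fun do rewrite imE; apply: L2B => //; exact: L2B.
split; [exact: Lf|exact: Lhr|exact: L2N|].
exists pr; split; [by move=> n; split|exact: up| |].
- apply: (L2cvg_le (cvg0_cM 2 (cvg0_D uA uq))) => n.
  have -> : (fun x => FC (pr n) x - complex.Re (h x)) =
     (fun x => (complex.Re (fourier1 (u n) x) - complex.Re (h x)) + - FS (qi n) x).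
    by apply/funext => x; rewrite reE; ring.
  apply: le_trans (sqnD_le _ _) _.
  + by under eq_fun do rewrite reE; apply: L2B => //; exact: L2D.
  + exact: L2N.
  + rewrite sqnN; apply: ler_wpM2l => //; apply: lerD; first exact: lexx.
    exact: (plancherel_le (Lq n) (iq n)).2.
- apply: (L2cvg_le (cvg0_cM 2 (cvg0_D uB uq))) => n; rewrite -sqnN.
  have -> : (fun x => - (FS (pr n) x - - complex.Im (h x))) =
     (fun x => (complex.Im (fourier1 (u n) x) - complex.Im (h x)) + - FC (qi n) x).
    by apply/funext => x; rewrite imE; ring.
  apply: le_trans (sqnD_le _ _) _.
  + by under eq_fun do rewrite imE; apply: L2B => //; exact: L2B.
  + exact: L2N.
  + rewrite sqnN; apply: ler_wpM2l => //; apply: lerD; first exact: lexx.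
    exact: (plancherel_le (Lq n) (iq n)).1.
Qed.

Lemma L2cvg_opp u f : (forall n, L2 (u n)) -> L2 f -> L2cvg u f ->
  L2cvg (fun n x => u n (- x)) (fun x => f (- x)).
Proof.
move=> Lu Lf; rewrite /L2cvg => uf; under eq_fun do rewrite (sqn_opp (L2B (Lu _) Lf)).
exact: uf.
Qed.

Lemma FTr_opp f A B : FTr f A B -> FTr f (fun x => A (- x)) (fun x => - B (- x)).
Proof.
move=> [Lf LA LB [u [Lu uf uA uB]]]; split => //; [exact: L2_opp|by apply: L2N; exact: L2_opp|].
exists u; split => //.
  have := L2cvg_opp (fun n => _) LA uA; rewrite (_ : (fun n x => FC (u n) (- x)) = fun n => FC (u n)).
    by apply => n; have [] := plancherel (Lu n).1 (Lu n).2.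
  by apply/funext => n; apply/funext => x; exact: FCN.
have LS n : L2 (FS (u n)) by have [] := plancherel (Lu n).1 (Lu n).2.
have h := L2cvg_opp LS LB uB; rewrite /L2cvg in h *.
suff -> : (fun n => sqn (fun x => FS (u n) x - - B (- x))) = (fun n => sqn (fun x => FS (u n) (- x) - B (- x))) by [].
apply/funext => n; rewrite -[LHS]sqnN; congr sqn; apply/funext => x.
by rewrite FSN; [ring|case: (Lu n)].
Qed.

(** The transform of an affine change of variables, first for integrable
    functions and then in the limit. *)
Lemma FTr_affine f A B (s t : R) : 0 < s -> FTr f A B ->
  FTr (fun x => f (s * x + t))
    (fun xi => s^-1 * (cos (2 * pi * t * (xi / s)) * A (xi / s) + sin (2 * pi * t * (xi / s)) * B (xi / s)))
    (fun xi => s^-1 * (cos (2 * pi * t * (xi / s)) * B (xi / s) - sin (2 * pi * t * (xi / s)) * A (xi / s))).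
Proof.
move=> s0 [Lf LA LB [u [Lu uf uA uB]]]; have si0 : 0 < s^-1 by rewrite invr_gt0.
have Ldil F : L2 F -> L2 (fun xi => F (xi / s)).
  by move=> LF; have := L2_affine 0 si0 LF; congr L2; apply/funext => xi; rewrite addr0 mulrC.
have sdil F : L2 F -> sqn (fun xi => F (xi / s)) = s * sqn F.
  move=> LF; have := sqn_affine 0 si0 LF; rewrite invrK => <-.
  by congr sqn; apply/funext => xi; rewrite addr0 mulrC.
have mc : measurable_fun setT (fun xi : R => cos (2 * pi * t * (xi / s))).
  have := measurable_cosM (t / s); congr measurable_fun; apply/funext => xi; congr cos.
  by rewrite -!mulrA (mulrCA xi t).
have ms : measurable_fun setT (fun xi : R => sin (2 * pi * t * (xi / s))).
  have := measurable_sinM (t / s); congr measurable_fun; apply/funext => xi; congr sin.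
  by rewrite -!mulrA (mulrCA xi t).
have LC F : L2 F -> L2 (fun xi => cos (2 * pi * t * (xi / s)) * F (xi / s)).
  move=> LF; have := L2_bounded mc (fun xi => cos_max _) (Ldil _ LF); congr L2.
have LS F : L2 F -> L2 (fun xi => sin (2 * pi * t * (xi / s)) * F (xi / s)).
  move=> LF; have := L2_bounded ms (fun xi => sin_max _) (Ldil _ LF); congr L2.
have sC F : L2 F -> sqn (fun xi => cos (2 * pi * t * (xi / s)) * F (xi / s)) <= s * sqn F.
  move=> LF; rewrite -sdil//; apply: le_sqn; [exact: L2_meas (LC _ LF)| |exact: Ldil].
  by move=> x; rewrite normrM ler_piMl// cos_max.
have sS F : L2 F -> sqn (fun xi => sin (2 * pi * t * (xi / s)) * F (xi / s)) <= s * sqn F.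
  move=> LF; rewrite -sdil//; apply: le_sqn; [exact: L2_meas (LS _ LF)| |exact: Ldil].
  by move=> x; rewrite normrM ler_piMl// sin_max.
have LCu n : L2 (FC (u n)) by have [] := plancherel (Lu n).1 (Lu n).2.
have LSu n : L2 (FS (u n)) by have [] := plancherel (Lu n).1 (Lu n).2.
have Lu1 n := (Lu n).1; have Lu2 n := (Lu n).2.
split; [exact: L2_affine|by apply: L2Z; apply: L2D; [exact: LC|exact: LS]|
  by apply: L2Z; apply: L2B; [exact: LC|exact: LS]|].
exists (fun n x => u n (s * x + t)); split.
- by move=> n; split; [exact: L2_affine|exact: intble_affine].
- apply: (L2cvg_le (cvg0_cM s^-1 uf)) => n.
  by rewrite -(sqn_affine t s0 (L2B (Lu1 n) Lf)).
- apply: (L2cvg_le (cvg0_cM (s^-1 ^+ 2) (cvg0_cM 2 (cvg0_D (cvg0_cM s uA) (cvg0_cM s uB))))) => n.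
  have LA' := L2B (LCu n) LA; have LB' := L2B (LSu n) LB.
  have -> : (fun x => FC (fun x0 => u n (s * x0 + t)) x - s^-1 * (cos (2 * pi * t * (x / s)) * A (x / s) + sin (2 * pi * t * (x / s)) * B (x / s))) =
    (fun x => s^-1 * (cos (2 * pi * t * (x / s)) * (FC (u n) (x / s) - A (x / s)) + sin (2 * pi * t * (x / s)) * (FS (u n) (x / s) - B (x / s)))).
    by apply/funext => x; rewrite FC_affine//; ring.
  rewrite sqnZ; last by apply: L2D; [exact: (LC _ LA')|exact: (LS _ LB')].
  rewrite ler_wpM2l ?sqr_ge0//; apply: le_trans (sqnD_le (LC _ LA') (LS _ LB')) _.
  by apply: ler_wpM2l => //; apply: lerD; [exact: (sC _ LA')|exact: (sS _ LB')].
- apply: (L2cvg_le (cvg0_cM (s^-1 ^+ 2) (cvg0_cM 2 (cvg0_D (cvg0_cM s uB) (cvg0_cM s uA))))) => n.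
  have LA' := L2B (LCu n) LA; have LB' := L2B (LSu n) LB.
  have -> : (fun x => FS (fun x0 => u n (s * x0 + t)) x - s^-1 * (cos (2 * pi * t * (x / s)) * B (x / s) - sin (2 * pi * t * (x / s)) * A (x / s))) =
    (fun x => s^-1 * (cos (2 * pi * t * (x / s)) * (FS (u n) (x / s) - B (x / s)) + - (sin (2 * pi * t * (x / s)) * (FC (u n) (x / s) - A (x / s))))).
    by apply/funext => x; rewrite FS_affine//; ring.
  rewrite sqnZ; last by apply: L2D; [exact: (LC _ LB')|apply: L2N; exact: (LS _ LA')].
  rewrite ler_wpM2l ?sqr_ge0//; apply: le_trans (sqnD_le (LC _ LB') (L2N (LS _ LA'))) _.
  by apply: ler_wpM2l => //; rewrite sqnN; apply: lerD; [exact: (sC _ LB')|exact: (sS _ LA')].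
Qed.

End real_fourier.

(** * Wavelet transforms on the half-plane *)

Section half_spectrum.
Context {R : realType}.
Local Notation mu := (@lebesgue_measure R).
Implicit Types f g A B F : R -> R.

Lemma I_half F : intble F -> \int[mu]_x F x = \int[mu]_x ((F x + F (- x)) * \1_posline x).
Proof.
move=> iF; have mp : measurable (posline : set R) by exact: measurable_itv.
have mn : measurable (`]-oo, 0%R[ : set R) by exact: measurable_itv.
have mh : measurable (halfline : set R) by exact: measurable_itv.
have iFo := intble_opp iF.
have e1 : \int[mu]_x F x = \int[mu]_x (F x * \1_halfline x) + \int[mu]_x (F x * \1_(`]-oo, 0%R[) x).
  rewrite -ID; [|exact: intble_indic..]; apply: eq_Rintegral => x _.
  rewrite !indicE !mem_setE /halfline !in_itv/= andbT.
  by case: (leP 0 x) => _; rewrite ?mulr1 ?mulr0 ?addr0 ?add0r.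
have e2 : \int[mu]_x (F x * \1_halfline x) = \int[mu]_x (F x * \1_posline x).
  rewrite !I_indicE /halfline /posline Rintegral_itv_obnd_cbnd//.
  exact: integrableS iF.
have e3 : \int[mu]_x (F x * \1_(`]-oo, 0%R[) x) = \int[mu]_x (F (- x) * \1_posline x).
  rewrite -(I_opp (intble_meas (intble_indic mn iF))); apply: eq_Rintegral => x _.
  by rewrite !indicE !mem_setE /posline !in_itv/= andbT oppr_lt0.
rewrite e1 e2 e3 -ID; [|exact: intble_indic..].
by apply: eq_Rintegral => x _; rewrite mulrDl.
Qed.

(** Since f is real, A is even and B is odd, but only almost everywhere;
    these combinations restrict them to the half-line with no choice of a
    representative. *)
Definition evenpart A x : R := (A x + A (- x)) * \1_posline x.
Definition oddpart B x : R := (B x - B (- x)) * \1_posline x.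

Lemma L2_evenpart A : L2 A -> L2 (evenpart A).
Proof.
by move=> LA; apply: L2_indic; [exact: measurable_itv|apply: L2D => //; exact: L2_opp].
Qed.

Lemma L2_oddpart A : L2 A -> L2 (oddpart A).
Proof.
by move=> LA; apply: L2_indic; [exact: measurable_itv|apply: L2B => //; exact: L2_opp].
Qed.

Lemma supported_evenpart A : supported posline (evenpart A).
Proof. exact: supported_indic. Qed.

Lemma supported_oddpart A : supported posline (oddpart A).
Proof. exact: supported_indic. Qed.

Lemma sqn_half A : L2 A -> (forall x, A (- x) ^+ 2 = A x ^+ 2) ->
  sqn (fun x => A x * \1_posline x) = 2^-1 * sqn A.
Proof.
move=> LA Ae; rewrite /sqn (I_half LA.2).
have -> : (fun x => (A x ^+ 2 + A (- x) ^+ 2) * \1_posline x) =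
  (fun x => 2 * (A x * \1_posline x) ^+ 2).
  by apply/funext => x; rewrite Ae exprMn [X in _ = _ * (_ * X)]expr2 indic_sq; ring.
rewrite IZ ?mulKf//; have := (L2_indic (measurable_itv (`]0%R, +oo[ : interval R)) LA).2.
by [].
Qed.

(** The evenness of A and the oddness of B come from uniqueness of the
    transform, applied to the reflected pair. *)
Lemma FTr_norm f A B : FTr f A B ->
  sqn (evenpart A) + sqn (oddpart B) = 2 * sqn f.
Proof.
move=> h; have [_ LA LB _] := h; have [eA eB] := FTr_unique h (FTr_opp h).
have LAo := L2_opp LA; have LBo := L2_opp LB.
rewrite -(ipxx f) (FTr_parseval h h) !ipxx.
rewrite /evenpart /oddpart (sqn_half (L2D LA LAo)); last by move=> x; rewrite opprK addrC.
rewrite (sqn_half (L2B LB LBo)); last by move=> x; rewrite opprK -sqrrN opprB.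
rewrite sqnD// sqnB// !sqn_opp//.
rewrite sqnB// sqn_opp// in eA.
have {}eB : sqn (fun x => B x + B (- x)) = 0.
  by rewrite -[RHS]eB; congr sqn; apply/funext => x; rewrite opprK.
rewrite sqnD// sqn_opp// in eB.
move: eA eB; clear; move: (inner2 _ _) (inner2 _ _) (sqn _) (sqn _) => i1 i2 s1 s2 *; lra.
Qed.

End half_spectrum.

Section wavelet_spectrum.
Context {R : realType}.
Local Notation mu := (@lebesgue_measure R).
Implicit Types f g A B F : R -> R.
Variables (p : R) (P HP : R -> R).
Hypotheses (p0 : 0 < p) (hP : is_poisson_wavelet p P) (hH : is_hilbert_transform P HP).

Definition pcst : R := (2 * pi) `^ (p + 2^-1).
(** The Fourier transform of the Poisson wavelet. *)
Definition pker (xi : R) : R := pcst * `|xi| `^ p * expR (- (2 * pi * `|xi|)).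

Lemma pcst_gt0 : 0 < pcst.
Proof. by rewrite powR_gt0// mulr_gt0// pi_gt0. Qed.

Lemma FTr_poisson : FTr P pker (fun=> 0).
Proof.
by have [_ /FTr_of_fourier2 /=] := hP; rewrite oppr0.
Qed.

(** The multiplier - i sgn exchanges the cosine and the sine transform, up
    to sign. *)
Lemma FTr_hilbert : FTr HP (fun=> 0) (fun xi => Num.sg xi * pker xi).
Proof.
have [_ _ [h [h1 h2]]] := hH.
have F1 := FTr_of_fourier2 h1; have F2 := FTr_of_fourier2 h2.
have [eA eB] := FTr_unique F1 FTr_poisson.
have [_ Lk _ _] := FTr_poisson.
have [_ Lr Li _] := F1; have [_ L1 L2' _] := F2.
have sg1 (x : R) : `|Num.sg x| <= 1 by case: sgrP => _; rewrite ?normr0 ?normrN1 ?normr1.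
have msg : measurable_fun setT (Num.sg : R -> R).
  have -> : (Num.sg : R -> R) = fun x => \1_(`]0%R, +oo[) x - \1_(`]-oo, 0%R[) x.
    apply/funext => x; rewrite !indicE !mem_setE !in_itv/= andbT.
    by case: sgrP => _; rewrite ?subrr ?subr0 ?sub0r.
  by apply: measurable_funB; apply: measurable_fun_indic; exact: measurable_itv.
have Lsk : L2 (fun xi => Num.sg xi * pker xi).
  apply: (L2_le (g := pker)) => //; first by apply: measurable_funM => //; exact: L2_meas.
  by move=> x; rewrite normrM ler_piMl.
apply: (FTr_ae F2) => //; first exact: L2_0.
- apply/eqP; rewrite eq_le sqn_ge0 andbT -[X in _ <= X]eB; apply: le_sqn.
  + by apply: L2_meas; apply: L2B => //; exact: L2_0.
  + move=> x; rewrite !subr0 normrN; case: (h x) => hr hi /=.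
    by rewrite mul0r sub0r mulNr opprK normrM ler_piMl.
  + by apply: L2B => //; exact: L2_0.
- apply/eqP; rewrite eq_le sqn_ge0 andbT -[X in _ <= X]eA; apply: le_sqn.
  + by apply: L2_meas; exact: L2B.
  + move=> x; case: (h x) => hr hi /=.
    by rewrite mul0r add0r mulNr opprK -mulrBr normrM ler_piMl.
  + exact: L2B.
Qed.

Lemma wavelet_ip phi f (b a : R) : wavelet_transform phi f b a =
  a `^ (- 2^-1) * inner2 f (fun x => phi (a^-1 * x + - (b / a))).
Proof.
rewrite /wavelet_transform; congr (_ * _); apply: eq_Rintegral => x _.
by congr (_ * phi _); rewrite mulrBl mulrC.
Qed.

Lemma FTr_ip_half f A B phi C D : FTr f A B -> FTr phi C D ->
  inner2 f phi = \int[mu]_x ((A x * C x + B x * D x + (A (- x) * C (- x) + B (- x) * D (- x))) * \1_posline x).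
Proof.
move=> h h'; have [_ LA LB _] := h; have [_ LC LD _] := h'.
have iAC := L2M LA LC; have iBD := L2M LB LD.
by rewrite (FTr_parseval h h') /inner2 -ID// (I_half (intbleD iAC iBD)).
Qed.

Lemma pker_pos (a x : R) : 0 < a -> 0 < x ->
  pker (a * x) = pcst * a `^ p * x `^ p * wgt a x.
Proof.
move=> a0 x0; have ax : 0 < a * x by exact: mulr_gt0.
rewrite /pker gtr0_norm// powRM ?ltW// /wgt mulrA.
by congr (_ * expR _); ring.
Qed.

Lemma pkerN x : pker (- x) = pker x.
Proof. by rewrite /pker normrN. Qed.

Let scale_cst (a : R) : 0 < a -> a `^ (- 2^-1) * (a * (pcst * a `^ p)) = pcst * a `^ (p + 2^-1).
Proof.
move=> a0; have an0 : a != 0 by rewrite gt_eqF.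
have e : a `^ (- 2^-1) * a = a `^ 2^-1.
  rewrite -[X in _ * X](powRr1 (ltW a0)) -powRD ?an0 ?implybT//.
  by congr (_ `^ _); field.
by rewrite powRD ?an0 ?implybT// mulrA e; ring.
Qed.

(** Parseval's identity with the transform of the translated and dilated
    wavelet, folded onto the positive half-line. *)
Lemma wavelet_poisson f A B (b a : R) : FTr f A B -> 0 < a ->
  wavelet_transform P f b a = pcst * a `^ (p + 2^-1) *
    Ure (pspec p (evenpart A)) (pspec p (oddpart B)) a b.
Proof.
move=> hf a0; have ai : 0 < a^-1 by rewrite invr_gt0.
have [_ LA LB _] := hf.
have LE := L2_evenpart LA; have LO := L2_oddpart LB.
have iE := allspec_intble (allspec_pspec p0 LE (supported_evenpart A)) a0.
have iO := allspec_intble (allspec_pspec p0 LO (supported_oddpart B)) a0.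
rewrite wavelet_ip (FTr_ip_half hf (FTr_affine (- (b / a)) ai FTr_poisson)).
rewrite -scale_cst// -!mulrA; congr (_ * _).
rewrite /Ure /FC /FS -ID; [|exact: intble_cos|exact: intble_sin].
rewrite !mulrA -IZ; last by apply: intbleD; [exact: intble_cos|exact: intble_sin].
apply: eq_Rintegral => x _; rewrite invrK.
have [x0|x0] := ltP 0 x; last first.
  by rewrite /wmul /pspec /evenpart /oddpart indicE memNset ?(mulr0, mul0r, addr0)// /posline/= in_itv/= andbT => /(le_lt_trans x0); rewrite ltxx.
have ta z : 2 * pi * - (b / a) * (z * a) = - (2 * pi * z * b) by field; rewrite gt_eqF.
have c1 : cos (2 * pi * - (b / a) * (x * a)) = cos (2 * pi * x * b) by rewrite ta cosN.
have s1 : sin (2 * pi * - (b / a) * (x * a)) = - sin (2 * pi * x * b) by rewrite ta sinN.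
have c2 : cos (2 * pi * - (b / a) * (- x * a)) = cos (2 * pi * x * b) by rewrite ta mulrN mulNr opprK.
have s2 : sin (2 * pi * - (b / a) * (- x * a)) = sin (2 * pi * x * b) by rewrite ta mulrN mulNr opprK.
have k1 : pker (x * a) = pcst * a `^ p * x `^ p * wgt a x by rewrite mulrC pker_pos.
have k2 : pker (- x * a) = pcst * a `^ p * x `^ p * wgt a x by rewrite mulNr pkerN.
rewrite c1 s1 c2 s2 k1 k2 /wmul /pspec /evenpart /oddpart.
by set w := wgt a x; ring.
Qed.

Lemma wavelet_hilbert f A B (b a : R) : FTr f A B -> 0 < a ->
  wavelet_transform HP f b a = pcst * a `^ (p + 2^-1) *
    Uim (pspec p (evenpart A)) (pspec p (oddpart B)) a b.
Proof.
move=> hf a0; have ai : 0 < a^-1 by rewrite invr_gt0.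
have [_ LA LB _] := hf.
have LE := L2_evenpart LA; have LO := L2_oddpart LB.
have iE := allspec_intble (allspec_pspec p0 LE (supported_evenpart A)) a0.
have iO := allspec_intble (allspec_pspec p0 LO (supported_oddpart B)) a0.
rewrite wavelet_ip (FTr_ip_half hf (FTr_affine (- (b / a)) ai FTr_hilbert)).
rewrite -scale_cst// -!mulrA; congr (_ * _).
rewrite /Uim /FC /FS -IB; [|exact: intble_cos|exact: intble_sin].
rewrite !mulrA -IZ; last by apply: intbleB; [exact: intble_cos|exact: intble_sin].
apply: eq_Rintegral => x _; rewrite invrK.
have [x0|x0] := ltP 0 x; last first.
  by rewrite /wmul /pspec /evenpart /oddpart indicE memNset ?(mulr0, mul0r, subr0)// /posline/= in_itv/= andbT => /(le_lt_trans x0); rewrite ltxx.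
have ta z : 2 * pi * - (b / a) * (z * a) = - (2 * pi * z * b) by field; rewrite gt_eqF.
have sx : Num.sg (x * a) = 1 by rewrite gtr0_sg// mulr_gt0.
have sNx : Num.sg (- x * a) = -1 by rewrite mulNr sgrN sx.
have c1 : cos (2 * pi * - (b / a) * (x * a)) = cos (2 * pi * x * b) by rewrite ta cosN.
have s1 : sin (2 * pi * - (b / a) * (x * a)) = - sin (2 * pi * x * b) by rewrite ta sinN.
have c2 : cos (2 * pi * - (b / a) * (- x * a)) = cos (2 * pi * x * b) by rewrite ta mulrN mulNr opprK.
have s2 : sin (2 * pi * - (b / a) * (- x * a)) = sin (2 * pi * x * b) by rewrite ta mulrN mulNr opprK.
have k1 : pker (x * a) = pcst * a `^ p * x `^ p * wgt a x by rewrite mulrC pker_pos.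
have k2 : pker (- x * a) = pcst * a `^ p * x `^ p * wgt a x by rewrite mulNr pkerN.
rewrite sx sNx c1 s1 c2 s2 k1 k2 /wmul /pspec /evenpart /oddpart.
by set w := wgt a x; ring.
Qed.

(** The two wavelet transforms of f are the real and the imaginary part of
    one analytic function, whose spectrum x^p (A + i B) has the norm of f
    up to a factor. *)
Lemma spectrum f : L2 f -> exists A B : R -> R,
  [/\ L2 A, L2 B, supported posline A, supported posline B & sqn A + sqn B = 2 * sqn f /\
   forall b a : R, 0 < a ->
    wavelet_transform P f b a = pcst * a `^ (p + 2^-1) * Ure (pspec p A) (pspec p B) a b /\
    wavelet_transform HP f b a = pcst * a `^ (p + 2^-1) * Uim (pspec p A) (pspec p B) a b].
Proof.
move=> Lf; have [A [B h]] := FTr_exists Lf; have [_ LA LB _] := h.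
exists (evenpart A), (oddpart B); split; [exact: L2_evenpart|exact: L2_oddpart|
  exact: supported_evenpart|exact: supported_oddpart|].
split; first exact: (FTr_norm h).
by move=> b a a0; split; [exact: wavelet_poisson|exact: wavelet_hilbert].
Qed.

End wavelet_spectrum.

(** * Full spark vectors and lattice sums *)

Section planar_vectors.
Context {R : realType}.
Implicit Types (v : 'I_3 -> 'rV[R]_2) (x y : R).

Definition dot (l : 'rV[R]_2) x y : R := l ord0 ord0 * x + l ord0 ord_max * y.

Definition det2 (l l' : 'rV[R]_2) : R :=
  l ord0 ord0 * l' ord0 ord_max - l ord0 ord_max * l' ord0 ord0.

Lemma full_spark_det2 v i j : full_spark v -> i != j -> det2 (v i) (v j) != 0.
Proof.
move=> [_ fs] ij.
pose s (k : 'I_2) := if k == ord0 then i else j.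
have s_inj : injective s.
  move=> k l; rewrite /s; case: (eqVneq k ord0) => [->|k0]; case: (eqVneq l ord0) => [->//|l0].
  - by move=> e; rewrite e eqxx in ij.
  - by move=> e; rewrite e eqxx in ij.
  - move=> _; apply: val_inj => /=.
    by move: k k0 l l0 => [[|[|k]] hk]// _ [[|[|l]] hl].
have := fs s s_inj; rewrite row_full_unit unitmxE unitfE.
rewrite (expand_det_row _ ord0) !big_ord_recl big_ord0 addr0 /cofactor !det_mx11 !mxE /=.
rewrite expr0 expr1 mul1r mulN1r mulrN /s /=.
have -> : lift ord0 (0 : 'I_1) = ord_max :> 'I_2 by apply: val_inj.
have -> : lift ord_max (0 : 'I_1) = ord0 :> 'I_2 by apply: val_inj.
by rewrite (_ : (0 : 'I_1) = ord0).
Qed.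

(** Cramer's rule. *)
Lemma dot_solve (l l' : 'rV[R]_2) x y :
  det2 l l' * x = l' ord0 ord_max * dot l x y - l ord0 ord_max * dot l' x y /\
  det2 l l' * y = l ord0 ord0 * dot l' x y - l' ord0 ord0 * dot l x y.
Proof. by rewrite /det2 /dot; split; ring. Qed.

Lemma dot_eq0 (l l' : 'rV[R]_2) x y : det2 l l' != 0 ->
  dot l x y = 0 -> dot l' x y = 0 -> x = 0 /\ y = 0.
Proof.
move=> d0 e1 e2; have [h1 h2] := dot_solve l l' x y.
rewrite e1 e2 !mulr0 subr0 in h1 h2.
by split; apply: (mulfI d0); rewrite mulr0.
Qed.

Definition nrm2 (l : 'rV[R]_2) : R := l ord0 ord0 ^+ 2 + l ord0 ord_max ^+ 2.

Lemma nrm2_ge0 l : 0 <= nrm2 l.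
Proof. by rewrite addr_ge0 ?sqr_ge0. Qed.

(** Lagrange's identity. *)
Lemma dot_sq_le l x y : dot l x y ^+ 2 <= nrm2 l * (x ^+ 2 + y ^+ 2).
Proof.
rewrite -subr_ge0 (_ : _ - _ = (l ord0 ord0 * y - l ord0 ord_max * x) ^+ 2) ?sqr_ge0//.
by rewrite /dot /nrm2; ring.
Qed.

(** Two independent linear forms control the vector: Cramer's rule and
    Lagrange's identity. *)
Lemma dot_sq_ge (l l' : 'rV[R]_2) x y :
  det2 l l' ^+ 2 * (x ^+ 2 + y ^+ 2) <=
  (nrm2 l + nrm2 l') * (dot l x y ^+ 2 + dot l' x y ^+ 2).
Proof.
have [h1 h2] := dot_solve l l' x y.
rewrite mulrDr -!exprMn h1 h2 /nrm2; set u := dot l x y; set w := dot l' x y.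
set a := l ord0 ord0; set b := l ord0 ord_max; set c := l' ord0 ord0; set d := l' ord0 ord_max.
rewrite -subr_ge0 (_ : _ - _ = (a * u + c * w) ^+ 2 + (b * u + d * w) ^+ 2).
  by rewrite addr_ge0 ?sqr_ge0.
by ring.
Qed.

(** Among three choices between two vectors, one vector is chosen twice;
    two independent linear forms then vanish on it. *)
Lemma spark_dichotomy v x y x' y' : full_spark v ->
  (forall i, dot (v i) x y = 0 \/ dot (v i) x' y' = 0) ->
  (x = 0 /\ y = 0) \/ (x' = 0 /\ y' = 0).
Proof.
move=> fs H; pose i0 : 'I_3 := inord 0; pose i1 : 'I_3 := inord 1; pose i2 : 'I_3 := inord 2.
have n01 : i0 != i1 by rewrite -val_eqE /= !inordK.
have n02 : i0 != i2 by rewrite -val_eqE /= !inordK.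
have n12 : i1 != i2 by rewrite -val_eqE /= !inordK.
have D i j : i != j -> det2 (v i) (v j) != 0 by exact: full_spark_det2.
case: (H i0) (H i1) (H i2) => [a|a] [b|b] [c|c].
- by left; exact: (dot_eq0 (D _ _ n01) a b).
- by left; exact: (dot_eq0 (D _ _ n01) a b).
- by left; exact: (dot_eq0 (D _ _ n02) a c).
- by right; exact: (dot_eq0 (D _ _ n12) b c).
- by left; exact: (dot_eq0 (D _ _ n12) b c).
- by right; exact: (dot_eq0 (D _ _ n02) a c).
- by right; exact: (dot_eq0 (D _ _ n01) a b).
- by right; exact: (dot_eq0 (D _ _ n01) a b).
Qed.

End planar_vectors.

Section lattice_sums.
Context {R : realType}.

Lemma esum_ord n (a : 'I_n -> \bar R) : (forall i, 0 <= a i)%E ->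
  (\esum_(i in [set: 'I_n]) a i = \sum_(i < n) a i)%E.
Proof.
move=> a0; have E : [set: 'I_n] = [set` enum 'I_n].
  by apply/seteqP; split => i _ //=; rewrite mem_enum.
rewrite E esum_fset; [|by rewrite -E; exact: finite_finset|by move=> i _].
by rewrite -fsbig_seq ?enum_uniq// big_enum.
Qed.

Variables alpha beta : R.
Hypotheses (a1 : 1 < alpha) (b0 : 0 < beta).

Definition lattice_point (z : int * int) : R * R :=
  (alpha ^ z.1 * beta * z.2%:~R, alpha ^ z.1).

Lemma lattice_bij : set_bij [set: int * (int * 'I_3)]
  [set k : 'I_3 * (R * R) | hyperbolic_lattice beta alpha k.2]
  (fun t => (t.2.2, lattice_point (t.1, t.2.1))).
Proof.
have a0 : 0 < alpha by exact: lt_trans a1.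
split.
- by move=> [m [n i]] _; exists m, n.
- move=> [m [n i]] [m' [n' i']] _ _ [-> h1 h2].
  have mm : m = m'.
    by apply: (ieexprIz a0 _ h2); rewrite gt_eqF.
  move: h1; rewrite mm => /mulfI; rewrite mulf_neq0 ?gt_eqF ?exprz_gt0// => /(_ isT) /intr_inj ->.
  by [].
- by move=> [i [b a]] [m [n [-> ->]]]; exists (m, (n, i)).
Qed.

Lemma esum_lattice (F : 'I_3 * (R * R) -> \bar R) : (forall k, 0 <= F k)%E ->
  (\esum_(k in [set k : 'I_3 * (R * R) | hyperbolic_lattice beta alpha k.2]) F k =
   \esum_(m in [set: int]) \esum_(n in [set: int]) \sum_(i < 3) F (i, lattice_point (m, n)))%E.
Proof.
move=> F0; rewrite (reindex_esum _ _ _ _ lattice_bij).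
have -> : [set: int * (int * 'I_3)] = [set: int] `*`` (fun=> [set: int * 'I_3]).
  by apply/seteqP; split.
rewrite -(esum_esum (a := fun m (ni : int * 'I_3) => F (ni.2, lattice_point (m, ni.1))))//.
apply: eq_esum => m _.
have -> : [set: int * 'I_3] = [set: int] `*`` (fun=> [set: 'I_3]) by apply/seteqP; split.
rewrite -(esum_esum (a := fun n i => F (i, lattice_point (m, n))))//.
by apply: eq_esum => n _; rewrite esum_ord.
Qed.

Lemma countable_lattice :
  countable [set k : 'I_3 * (R * R) | hyperbolic_lattice beta alpha k.2].
Proof.
have [_ _ h2] := lattice_bij.
have -> : [set k : 'I_3 * (R * R) | hyperbolic_lattice beta alpha k.2] =
    (fun t : int * (int * 'I_3) => (t.2.2, lattice_point (t.1, t.2.1))) @` setT.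
  apply/seteqP; split; first exact: h2.
  by move=> _ [[m [n i]] _ <-]; exists m, n.
exact: sub_countable (card_image_le _ _) (countableP _).
Qed.

End lattice_sums.

(** * Sign retrieval and the frame property *)

Section wavelet_linear.
Context {R : realType}.
Local Notation mu := (@lebesgue_measure R).
Implicit Types (f g phi psi : R -> R).

Lemma wavelet_transformD phi f g (b a : R) : 0 < a -> L2 phi -> L2 f -> L2 g ->
  wavelet_transform phi (fun x => f x + g x) b a =
  wavelet_transform phi f b a + wavelet_transform phi g b a.
Proof.
move=> a0 Lp Lf Lg; have ai : 0 < a^-1 by rewrite invr_gt0.
by rewrite !wavelet_ip ipDl ?mulrDr//; exact: L2_affine.
Qed.

Lemma wavelet_transformB phi f g (b a : R) : 0 < a -> L2 phi -> L2 f -> L2 g ->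
  wavelet_transform phi (fun x => f x - g x) b a =
  wavelet_transform phi f b a - wavelet_transform phi g b a.
Proof.
move=> a0 Lp Lf Lg; have ai : 0 < a^-1 by rewrite invr_gt0.
by rewrite !wavelet_ip ipBl ?mulrBr//; exact: L2_affine.
Qed.

Lemma wavelet_transform_dot (l : 'rV[R]_2) phi psi f (b a : R) : 0 < a ->
  L2 phi -> L2 psi -> L2 f ->
  wavelet_transform (fun x => l ord0 ord0 * phi x + l ord0 ord_max * psi x) f b a =
  dot l (wavelet_transform phi f b a) (wavelet_transform psi f b a).
Proof.
move=> a0 Lp Ls Lf; have ai : 0 < a^-1 by rewrite invr_gt0.
have L1 : L2 (fun x => phi (a^-1 * x + - (b / a))) by exact: L2_affine.
have L3 : L2 (fun x => psi (a^-1 * x + - (b / a))) by exact: L2_affine.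
rewrite !wavelet_ip ipDr//; [|exact: L2Z|exact: L2Z].
by rewrite ![inner2 f (fun x => _ * _)]ipC !ipZl// ![inner2 _ f]ipC /dot; ring.
Qed.

Lemma translation_dilation phi (b a : R) : translation b (dilation a phi) =
  fun x => a `^ (- 2^-1) * phi (a^-1 * x + - (b / a)).
Proof.
apply/funext => x; rewrite /translation /dilation; congr (_ * phi _).
by rewrite mulrBr [a^-1 * b]mulrC.
Qed.

Lemma inner2_translate phi f (b a : R) : 0 < a -> L2 phi -> L2 f ->
  inner2 f (translation b (dilation a phi)) = wavelet_transform phi f b a.
Proof.
move=> a0 Lp Lf; rewrite translation_dilation wavelet_ip ipC ipZl// ?[inner2 _ f]ipC//.
by apply: L2_affine => //; rewrite invr_gt0.
Qed.

Lemma L2_translate_dilate phi (b a : R) : 0 < a -> L2 phi ->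
  L2 (translation b (dilation a phi)).
Proof.
move=> a0 Lp; have ai : 0 < a^-1 by rewrite invr_gt0.
by rewrite translation_dilation; apply: L2Z; exact: L2_affine.
Qed.

End wavelet_linear.

Section sign_and_frame.
Context {R : realType}.
Local Notation mu := (@lebesgue_measure R).
Implicit Types (f g A B : R -> R).

Variables (p alpha beta : R) (P HP : R -> R) (lambda : 'I_3 -> 'rV[R]_2).
Hypotheses (p0 : 0 < p) (a1 : 1 < alpha) (b0 : 0 < beta).
Hypothesis pab : beta * ln alpha <= 4 * pi / (1 + 4 * p).
Hypotheses (hP : is_poisson_wavelet p P) (hH : is_hilbert_transform P HP).
Hypothesis fs : full_spark lambda.

Let phi (i : 'I_3) (x : R) := lambda i ord0 ord0 * P x + lambda i ord0 ord_max * HP x.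

Let a0 : 0 < alpha. Proof. exact: lt_trans a1. Qed.
Let LP : L2 P. Proof. by apply: realL2_L2; case: hP. Qed.
Let LH : L2 HP. Proof. by apply: realL2_L2; case: hH. Qed.
Let Lphi i : L2 (phi i). Proof. by apply: L2D; exact: L2Z. Qed.

(** The factor x^p and the weight vanish nowhere on the open half-line. *)
Lemma sqn_pspec_eq0 A : L2 A -> supported posline A -> Hn 1 (pspec p A) = 0 -> sqn A = 0.
Proof.
move=> LA sA h0; have [_ Lw] := hspec_pspec p0 (ltr01 : 0 < 1 :> R) LA sA.
apply: ae_sqn0; first exact: LA.1.
apply: ae_mono (sqn_eq0 Lw h0) => x; have [x0|xn] := pselect (posline x); last by rewrite sA.
have x_gt0 : 0 < x by move: x0; rewrite /posline /= in_itv /= andbT.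
move=> /eqP; rewrite /wmul /pspec !mulf_eq0 (gt_eqF (wgt_gt0 _ _)) orbF.
by rewrite (gt_eqF (powR_gt0 _ x_gt0)) => /eqP.
Qed.

Lemma spectrum_eq0 A B : L2 A -> supported posline A -> L2 B -> supported posline B ->
  (forall x, Ure (pspec p A) (pspec p B) 1 x = 0 /\ Uim (pspec p A) (pspec p B) 1 x = 0) ->
  sqn A + sqn B = 0.
Proof.
move=> LA sA LB sB h0.
have [] := U_inj (allspec_pspec p0 LA sA) (allspec_pspec p0 LB sB) h0.
by move=> /(sqn_pspec_eq0 LA sA) -> /(sqn_pspec_eq0 LB sB) ->; rewrite addr0.
Qed.

(** Equal magnitudes mean that each coefficient of f - g or of f + g
    vanishes. *)
Lemma sign_retrieval f g : L2 f -> L2 g ->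
  (forall (i : 'I_3) (b a : R), hyperbolic_lattice beta alpha (b, a) ->
     `|wavelet_transform (phi i) f b a| = `|wavelet_transform (phi i) g b a|) ->
  eq_up_to_sign f g.
Proof.
move=> Lf Lg Heq.
have L_D := L2D Lf Lg; have L_B := L2B Lf Lg.
have [A1 [B1 [LA1 LB1 sA1 sB1 [n1 W1]]]] := spectrum p0 hP hH L_B.
have [A2 [B2 [LA2 LB2 sA2 sB2 [n2 W2]]]] := spectrum p0 hP hH L_D.
have pab' : beta * ln alpha * (1 + 4 * p) <= 4 * pi.
  by rewrite -ler_pdivlMr// addr_gt0// mulr_gt0.
have key := product_vanish p0 a1 b0 pab' LA1 LB1 LA2 LB2 sA1 sB1 sA2 sB2.
have /key {}key : forall (i : nat) (n : int), let y := alpha ^- i in let x := n%:~R * (beta * y) in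
     (Ure (pspec p A1) (pspec p B1) y x = 0 /\ Uim (pspec p A1) (pspec p B1) y x = 0) \/
     (Ure (pspec p A2) (pspec p B2) y x = 0 /\ Uim (pspec p A2) (pspec p B2) y x = 0).
  move=> i n y x; have y0 : 0 < y by rewrite invr_gt0 exprn_gt0.
  have hl : hyperbolic_lattice beta alpha (x, y).
    exists (- i%:Z)%R, n; rewrite /x /y exprnN; congr (_, _); ring.
  have [e1 e2] := W1 x y y0; have [e3 e4] := W2 x y y0.
  have c0 : pcst p * y `^ (p + 2^-1) != 0.
    by rewrite mulf_neq0// gt_eqF// ?pcst_gt0// powR_gt0.
  have := @spark_dichotomy R lambda
    (wavelet_transform P (fun x => f x - g x) x y) (wavelet_transform HP (fun x => f x - g x) x y)
    (wavelet_transform P (fun x => f x + g x) x y) (wavelet_transform HP (fun x => f x + g x) x y) fs.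
  case.
  - move=> k; rewrite -!wavelet_transform_dot//.
    rewrite wavelet_transformB ?wavelet_transformD//; [|exact: Lphi|exact: Lphi].
    have /eqP := Heq k x y hl; rewrite eqr_norm2 => /orP[/eqP ->|/eqP ->].
      by left; rewrite subrr.
    by right; rewrite addNr.
  - by rewrite e1 e2 => -[h h']; left; split; apply: (mulfI c0); rewrite mulr0.
  - by rewrite e3 e4 => -[h h']; right; split; apply: (mulfI c0); rewrite mulr0.
have H := allspec_pspec p0.
have [h0|h0] := one_factor_vanishes (H _ LA1 sA1) (H _ LB1 sB1) (H _ LA2 sA2) (H _ LB2 sB2) key.
  left; have /sqn_eq0 : sqn (fun x => f x - g x) = 0.
    apply: (mulfI (_ : 2 != 0 :> R)); rewrite ?pnatr_eq0// mulr0 -n1.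
    exact: spectrum_eq0.
  move=> /(_ L_B); apply: ae_mono => x /eqP; rewrite subr_eq0 => /eqP h _; exact: h.
right; have /sqn_eq0 : sqn (fun x => f x + g x) = 0.
  apply: (mulfI (_ : 2 != 0 :> R)); rewrite ?pnatr_eq0// mulr0 -n2.
  exact: spectrum_eq0.
by move=> /(_ L_D); apply: ae_mono => x /eqP; rewrite addr_eq0 => /eqP h _; exact: h.
Qed.

(** Adding the samples at opposite points removes the cross terms between
    the cosine and the sine transform. *)
Lemma esum_transform y A B : 0 < y -> L2 A -> supported posline A -> L2 B -> supported posline B ->
  (\esum_(n in [set: int]) (Ure (pspec p A) (pspec p B) y (y * beta * n%:~R) ^+ 2 +
     Uim (pspec p A) (pspec p B) y (y * beta * n%:~R) ^+ 2)%:E =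
   (rowr beta y (pspec p A))%:E + (rowr beta y (pspec p B))%:E)%E.
Proof.
move=> y0 LA sA LB sB.
have y2 : y / 2 < y by rewrite ltr_pdivrMr// ltr_pMr// ltrDl.
have y20 : 0 < y / 2 by rewrite divr_gt0.
have hA := hspec_pspec p0 y20 LA sA; have hB := hspec_pspec p0 y20 LB sB.
rewrite (hspec_EFin_rowr b0 (ltW y20) y2 hA) (hspec_EFin_rowr b0 (ltW y20) y2 hB).
rewrite /rowe -esumD; [|by move=> *; rewrite lee_fin FQ_ge0..].
have iA := hspec_intble y2 hA; have iB := hspec_intble y2 hB.
apply: esum_even_part => n.
- by rewrite lee_fin addr_ge0 ?sqr_ge0.
- by rewrite -EFinD lee_fin addr_ge0 ?FQ_ge0.
have xE (k : int) : y * beta * k%:~R = k%:~R * (beta * y) by ring.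
rewrite !xE mulrNz mulNr; set x := n%:~R * _.
rewrite -!EFinD; congr EFin; rewrite /Ure /Uim /FQ !FCN !FSN//.
by ring.
Qed.

(** Summing the squares of the three linear forms at a lattice point is, up
    to constants, taking the squared modulus of the analytic function; its
    sum over a row is the row energy of A plus that of B, and
    spectral_frame applies to both. *)
Lemma lattice_frame : is_frame [set k : 'I_3 * (R * R) | hyperbolic_lattice beta alpha k.2]
    (fun k => translation k.2.1 (dilation k.2.2 (phi k.1))).
Proof.
split.
- exact: countable_lattice.
- move=> [i [b a]] [m [n [_ ->]]] /=; apply: L2_realL2.
  by apply: L2_translate_dilate; [exact: exprz_gt0|exact: Lphi].
have pab2 : beta * ln alpha < 2 * pi / p.
  apply: le_lt_trans pab _; have pp := @pi_gt0 R.
  rewrite ltr_pdivrMr ?addr_gt0 ?mulr_gt0//.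
  rewrite mulrAC ltr_pdivlMr//.
  have : 0 < pi * (2 + 4 * p) :> R by rewrite mulr_gt0// addr_gt0// mulr_gt0.
  by rewrite mulrDr; nra.
have [c1 [c2 [c10 c20 FR]]] := spectral_frame p0 a1 b0 pab2.
pose i0 : 'I_3 := inord 0; pose i1 : 'I_3 := inord 1.
have n01 : i0 != i1 by rewrite -val_eqE /= !inordK.
have D0 := full_spark_det2 fs n01.
pose N01 := nrm2 (lambda i0) + nrm2 (lambda i1) + 1.
have N010 : 0 < N01 by rewrite ltr_pwDr// addr_ge0 ?nrm2_ge0.
pose d1 := det2 (lambda i0) (lambda i1) ^+ 2 / N01.
have d10 : 0 < d1 by rewrite divr_gt0// exprn_even_gt0.
pose d2 := \sum_(i < 3) nrm2 (lambda i) + 1.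
have d20 : 0 < d2 by rewrite ltr_pwDr// sumr_ge0// => *; exact: nrm2_ge0.
(* Two of the three forms are enough for the lower bound. *)
have low x y : d1 * (x ^+ 2 + y ^+ 2) <= \sum_(i < 3) dot (lambda i) x y ^+ 2.
  rewrite /d1 mulrAC ler_pdivrMr//; apply: le_trans (dot_sq_ge _ _ _ _) _.
  rewrite mulrC; apply: ler_pM.
  - by rewrite addr_ge0 ?sqr_ge0.
  - by rewrite addr_ge0 ?nrm2_ge0.
  - rewrite (bigD1 i0)//= (bigD1 i1) 1?eq_sym//= addrA lerDl sumr_ge0// => *; exact: sqr_ge0.
  - by rewrite lerDl.
have up x y : \sum_(i < 3) dot (lambda i) x y ^+ 2 <= d2 * (x ^+ 2 + y ^+ 2).
  rewrite mulrDl mulr_suml mul1r.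
  apply: ler_wpDr; first by rewrite addr_ge0 ?sqr_ge0.
  by apply: ler_sum => i _; exact: dot_sq_le.
pose K := pcst p ^+ 2.
have K0 : 0 < K by rewrite exprn_gt0// pcst_gt0.
have pos (u v : R) : 0 < u -> 0 < v -> 0 < u * K * (2 * v).
  by move=> u0 v0; apply: mulr_gt0; [exact: mulr_gt0|rewrite mulr_gt0].
exists (d1 * K * (2 * c1)), (d2 * K * (2 * c2)); split; [exact: pos|exact: pos|].
move=> f /realL2_L2 Lf.
have [A [B [LA LB sA sB [nf W]]]] := spectrum p0 hP hH Lf.
pose V (m n : int) := Ure (pspec p A) (pspec p B) (alpha ^ m) (alpha ^ m * beta * n%:~R) ^+ 2 +
  Uim (pspec p A) (pspec p B) (alpha ^ m) (alpha ^ m * beta * n%:~R) ^+ 2.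
have V0 m n : 0 <= V m n by rewrite addr_ge0 ?sqr_ge0.
pose S := (\esum_(m in [set: int]) \esum_(n in [set: int]) (K * (alpha ^ m) `^ (2 * p + 1) * V m n)%:E)%E.
pose T (m n : int) := \sum_(i < 3) dot (lambda i)
   (wavelet_transform P f (alpha ^ m * beta * n%:~R) (alpha ^ m))
   (wavelet_transform HP f (alpha ^ m * beta * n%:~R) (alpha ^ m)) ^+ 2.
have am m : 0 < alpha ^ m by exact: exprz_gt0.
have SE : S = (K%:E * (\esum_(k in [set: int]) ((alpha ^ k) `^ (2 * p + 1) * rowr beta (alpha ^ k) (pspec p A))%:E
    + \esum_(k in [set: int]) ((alpha ^ k) `^ (2 * p + 1) * rowr beta (alpha ^ k) (pspec p B))%:E))%E.
  have h0 C m : 0 <= (alpha ^ m) `^ (2 * p + 1) * rowr beta (alpha ^ m) (pspec p C).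
    by apply: mulr_ge0; [exact: powR_ge0|exact: rowr_ge0].
  rewrite -esumD; [|by move=> *; rewrite lee_fin h0..].
  rewrite -esum_intZl; [|exact: ltW|by move=> *; rewrite -EFinD lee_fin addr_ge0].
  apply: eq_esum => m _.
  under eq_esum do rewrite EFinM.
  rewrite esum_intZl; [|by apply: mulr_ge0; [exact: ltW|exact: powR_ge0]|by move=> n; rewrite lee_fin].
  by rewrite esum_transform// -!EFinD -!EFinM -mulrA -mulrDr.
have VT m n : (wavelet_transform P f (alpha ^ m * beta * n%:~R) (alpha ^ m)) ^+ 2 +
   (wavelet_transform HP f (alpha ^ m * beta * n%:~R) (alpha ^ m)) ^+ 2 = K * (alpha ^ m) `^ (2 * p + 1) * V m n.
  have [-> ->] := W (alpha ^ m * beta * n%:~R) (alpha ^ m) (am m).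
  rewrite (_ : 2 * p + 1 = (p + 2^-1) + (p + 2^-1)); last by field.
  rewrite (@powRD _ _ (p + 2^-1) (p + 2^-1)); last by rewrite (gt_eqF (am m)) implybT.
  by rewrite /K /V; ring.
have -> : (\esum_(k in [set k : 'I_3 * (R * R) | hyperbolic_lattice beta alpha k.2])
    (`|inner2 f (translation k.2.1 (dilation k.2.2 (phi k.1)))| ^+ 2)%:E =
    \esum_(m in [set: int]) \esum_(n in [set: int]) (T m n)%:E)%E.
  rewrite (esum_lattice a1 b0); last by move=> k; rewrite lee_fin sqr_ge0.
  apply: eq_esum => m _; apply: eq_esum => n _.
  rewrite /T -sumEFin; apply: eq_bigr => i _; congr EFin.
  rewrite /lattice_point /= inner2_translate// real_normK ?num_real//.
  by rewrite wavelet_transform_dot.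
have -> : ('N[mu]_2%:E [EFin \o f] ^+ 2 = (sqn f)%:E)%E.
  by rewrite Lnorm2_sqn// -EFin_expe sqr_sqrtr ?sqn_ge0.
have [lA uA] := FR A LA sA; have [lB uB] := FR B LB sB.
have dS (d : R) : 0 < d -> (d%:E * S = \esum_(m in [set: int]) \esum_(n in [set: int])
   (d * (K * (alpha ^ m) `^ (2 * p + 1) * V m n))%:E)%E.
  move=> d0; rewrite /S -esum_intZl; [|exact: ltW|].
    apply: eq_esum => m _; rewrite -esum_intZl; [by []|exact: ltW|].
    move=> n; rewrite lee_fin; apply: mulr_ge0 => //.
    by apply: mulr_ge0; [exact: ltW|exact: powR_ge0].
  move=> m; apply: esum_ge0 => n _; rewrite lee_fin; apply: mulr_ge0 => //.
  by apply: mulr_ge0; [exact: ltW|exact: powR_ge0].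
split.
- apply: (@le_trans _ _ (d1%:E * S)%E); last first.
    rewrite dS//; apply: le_esum => m _; apply: le_esum => n _.
    by rewrite lee_fin -VT; exact: low.
  rewrite SE [leLHS](_ : (_ * _)%E = (d1%:E * (K%:E * (c1 * sqn A + c1 * sqn B)%:E))%E).
    apply: lee_wpmul2l; first by rewrite lee_fin ltW.
    apply: lee_wpmul2l; first by rewrite lee_fin ltW.
    by rewrite EFinD; apply: leeD; [exact: lA|exact: lB].
  by rewrite -mulrDr nf -!EFinM; congr EFin; ring.
- apply: (@le_trans _ _ (d2%:E * S)%E).
    rewrite dS//; apply: le_esum => m _; apply: le_esum => n _.
    by rewrite lee_fin -VT; exact: up.
  rewrite SE [leRHS](_ : _ = (d2%:E * (K%:E * (c2 * sqn A + c2 * sqn B)%:E))%E).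
    apply: lee_wpmul2l; first by rewrite lee_fin ltW.
    apply: lee_wpmul2l; first by rewrite lee_fin ltW.
    by rewrite EFinD; apply: leeD; [exact: uA|exact: uB].
  by rewrite -mulrDr nf -!EFinM; congr EFin; ring.
Qed.

Lemma lattice_sign_retrieval : does_sign_retrieval
    [set k : 'I_3 * (R * R) | hyperbolic_lattice beta alpha k.2]
    (fun k => translation k.2.1 (dilation k.2.2 (phi k.1))).
Proof.
split; first exact: lattice_frame.
move=> f g /realL2_L2 Lf /realL2_L2 Lg H; apply: sign_retrieval => // i b a hl.
have an0 : 0 < a by case: hl => m [n [_ ->]]; exact: exprz_gt0.
by rewrite -!inner2_translate//; exact: (H (i, (b, a))).
Qed.

End sign_and_frame.

Unset Implicit Arguments.

Theorem theorem3p3 (R : realType) (p alpha beta : R) (P HP : R -> R)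
    (lambda : 'I_3 -> 'rV[R]_2) :
  0 < p -> 1 < alpha -> 0 < beta ->
  beta * ln alpha <= 4 * pi / (1 + 4 * p) ->
  is_poisson_wavelet p P ->
  is_hilbert_transform P HP ->
  full_spark lambda ->
  let phi := fun (i : 'I_3) (x : R) =>
    lambda i ord0 ord0 * P x + lambda i ord0 ord_max * HP x in
  (forall f g : R -> R, realL2 f -> realL2 g ->
     (forall (i : 'I_3) (b a : R), hyperbolic_lattice beta alpha (b, a) ->
        `|wavelet_transform (phi i) f b a| =
        `|wavelet_transform (phi i) g b a|) ->
     eq_up_to_sign f g) /\
  does_sign_retrieval
    [set k : 'I_3 * (R * R) | hyperbolic_lattice beta alpha k.2]
    (fun k => translation k.2.1 (dilation k.2.2 (phi k.1))).
Proof.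
move=> p0 a1 b0 pab hP hH fs phi; split.
  move=> f g /realL2_L2 Lf /realL2_L2 Lg.
  exact: (sign_retrieval p0 a1 b0 pab hP hH fs Lf Lg).
exact: (lattice_sign_retrieval p0 a1 b0 pab hP hH fs).
Qed.
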